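(* Let $v\in L^1((0,T);C^{0,1}(\Omega;\mathbb R^2))$, with $v\cdot n=0$ on $\partial\Omega$ when $\Omega$ is a bounded domain. For each $N$ considered, with $h=\sqrt{|\Omega|/N}$, assume that the set $\mathcal M=\mathcal M_h\subset\Omega^N$ of minimizers of $\mathscr F$ over $\Omega^N$ is nonempty and compact, and let $r_h>0$ be small enough that every $X\in\overline{\mathcal U_{r_h}}$ has pairwise distinct generators, and that $\overline{\mathcal U_{r_h}}\subset\Omega^N$ when $\Omega$ is a bounded domain, where $\mathcal U_{r}:=\{X\in\Omega^N:\operatorname{dist}(X,\mathcal M)<r\}$. Assume that there is $C_1>0$, independent of $h$, such that $\mathscr D(X)\le C_1h$ for every $X\in\mathcal U_{r_h}$. Let $X^{h,0}\in\mathcal U_{r_h}$ satisfy $\mathscr F(X^{h,0})-\mathscr F^\ast<\delta_{r_h}$, where $\mathscr F^\ast=\inf_{\Omega^N}\mathscr F$ and $\delta_{r}:=\inf\{\mathscr F(X)-\mathscr F^\ast: X\in\overline{\mathcal U_{r}},\ \operatorname{dist}(X,\mathcal M)=r\}$. Let $\alpha_h\in L^1(0,T)$, $\alpha_h\ge0$, and $X^h=(x_1^h,\dots,x_N^h)$ be such that $X^h$ is the unique absolutely continuous solution on $[0,T]$ of $$\dot x_i^h(t)=v(t,x_i^h(t))+\alpha_h(t)\left(c_i(X^h(t))-x_i^h(t)\right),\quad 1\le i\le N,\qquad X^h(0)=X^{h,0},$$ and $X^h(t)\in\mathcal U_{r_h}$ for every $t\in[0,T]$. Set $A_h:=\int_0^T\alpha_h(t)\,dt$.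 There exists a constant $C_3>0$, depending only on $C_1$ and $\Omega$, with the following property. If $r_h\le C_3h$, then the following hold for every $t\in[0,T]$. (i) The generators stay separated: $|x_i^h(t)-x_j^h(t)|\ge2C_3h$ for $i\ne j$. (ii) The cell volumes $V_i^h(t):=|\Omega_i(X^h(t))|$ satisfy $V_i^h(t)\ge h^2/C_4$ and $V_i^h(t)\ge V_i^h(0)/C_4$. (iii) $\int_0^T\alpha_h(t)\mathscr G(X^h(t))\,dt\le C_4h^2$. (iv) If $\rho_0\in L^p(\Omega)$, $\rho_0\ge0$, for some $1<p\le\infty$, then $$B_h(T)\le C_5\,h\,A_h^{1/\min\{p,2\}},$$ where $$B_h(T):=\int_0^T e^{\Lambda(T)-\Lambda(s)}\alpha_h(s)\sum_{i=1}^N M_i^h\left|c_i(X^h(s))-x_i^h(s)\right|ds,\qquad M_i^h:=\int_{\Omega_i(X^h(0))}\rho_0\,dx .$$ The constant $C_4$ depends only on $C_1$, $\Omega$ and $\Lambda(T)$, and $C_5$ depends also on $p$ and $\|\rho_0\|_{L^p}$.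
   Context: Domain. $T>0$ is finite. $\Omega$ is either a bounded convex Lipschitz domain of $\mathbb R^2$ or a flat torus $\Omega=\mathbb R^2/\mathcal L$, where $\mathcal L=\mathbb Z\ell_1+\mathbb Z\ell_2$ with $\ell_1,\ell_2\in\mathbb R^2$ linearly independent. On the torus, $|x-y|=\min_{k\in\mathcal L}|\tilde x-\tilde y-k|$ denotes the torus distance ($\tilde x,\tilde y\in\mathbb R^2$ representatives); balls and diameters are understood accordingly, and functions on $\Omega$ are identified with $\mathcal L$-periodic functions on $\mathbb R^2$. Voronoi tessellation. For $X=(x_1,\dots,x_N)\in\Omega^N$ with pairwise distinct entries (generators), $\Omega_i(X):=\{x\in\Omega: |x-x_i|<|x-x_j|\ \text{for all } j\ne i\}$, $V_i(X):=|\Omega_i(X)|$, and $c_i(X):=V_i(X)^{-1}\int_{\Omega_i(X)}x\,dx$ is the centroid. On the torus, the displacement $c_i(X)-x_i\in\mathbb R^2$ is defined by $c_i-x_i=\frac1{V_i}\int_{P_i}(y-x_i)\,dy$, where, for representatives $x_j\in\mathbb R^2$, $P_i:=\{y\in\mathbb R^2:\ |y-x_i|\le|y-x_j-k|\ \text{for all } 1\le j\le N,\ k\in\mathcal L\}$ (Euclidean norms); it does not depend on the chosen representatives. Indicators. $\mathscr F(X):=\sum_{i}\int_{\Omega_i(X)}|x-x_i|^2\,dx=\int_\Omega\min_{1\le i\le N}|x-x_i|^2\,dx$, the last expression defining $\mathscr F$ on all of $\overline\Omega^N$ (also when generators coincide); $\mathscr G(X):=\sum_{i}V_i(X)|x_i-c_i(X)|^2$;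 $\mathscr D(X):=\max_i\operatorname{diam}(\Omega_i(X))$. $L(t):=\|v(t,\cdot)\|_{C^{0,1}(\Omega)}$ (in particular $v(t,\cdot)$ is $L(t)$-Lipschitz) and $\Lambda(t):=\int_0^tL(s)\,ds$. $\operatorname{dist}$ is the distance on $\Omega^N$ induced by $|X-Y|=(\sum_i|x_i-y_i|^2)^{1/2}$, closures are taken in $\overline\Omega^N$, and $\inf\emptyset=+\infty$. *)

(* Defs.v *)
From HB Require Import structures.
From mathcomp Require Import all_boot all_order all_algebra.
From mathcomp Require Import all_classical all_reals all_analysis.
From mathcomp Require Import ring.

Set Implicit Arguments.
Unset Strict Implicit.
Unset Printing Implicit Defensive.
Import Order.TTheory GRing.Theory Num.Theory.
Import numFieldNormedType.Exports.

Local Open Scope classical_set_scope.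
Local Open Scope ring_scope.

(* The library norm on R * R is the sup norm; all distances below are
   Euclidean and go through [enorm]. *)
Definition dot (R : realType) (x y : R * R) : R := x.1 * y.1 + x.2 * y.2.

Definition enorm (R : realType) (x : R * R) : R := Num.sqrt (dot x x).

Definition leb2 (R : realType)
    : {measure set (measurableTypeR R * measurableTypeR R) -> \bar R} :=
  (@lebesgue_measure R \x @lebesgue_measure R)%E.

Definition area (R : realType) (D : set (R * R)) : R := fine (leb2 R D).

Definition vector_integral (R : realType) (D : set (R * R))
    (f : R * R -> R * R) : R * R :=
  (\int[leb2 R]_(x in D) (f x).1, \int[leb2 R]_(x in D) (f x).2).

Inductive planar_domain (R : realType) : Type :=
  | Bounded of set (R * R)
  | FlatTorus of R * R & R * R.

(* Near each boundary point, D is the strict epigraph of a Lipschitz function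
   in orthonormal coordinates whose vertical axis is the unit vector e. *)
Definition lipschitz_domain (R : realType) (D : set (R * R)) : Prop :=
  forall x, (closure D `\` D) x ->
  exists (e : R * R) (rho K : R) (g : R -> R),
    [/\ enorm e = 1, 0 < rho, forall s t, `|g s - g t| <= K * `|s - t| &
      forall y, enorm (y - x) < rho -> (D y <-> g (dot (e.2, - e.1) y) < dot e y)].

Definition admissible_domain (R : realType) (Om : planar_domain R) : Prop :=
  match Om with
  | Bounded D =>
      [/\ open D, D !=set0, bounded_set D, convex_set D & lipschitz_domain D]
  | FlatTorus l1 l2 =>
      forall a b : R, a *: l1 + b *: l2 = 0 -> a = 0 /\ b = 0
  end.

(* Both cases are treated on representatives in the plane: the torus R^2/L has
   carrier R^2 and lattice L, a bounded domain D has carrier D and the trivial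
   lattice.  Subsets of the torus are L-periodic subsets of the plane, and
   their areas and integrals are computed on the fundamental cell. *)
Definition carrier (R : realType) (Om : planar_domain R) : set (R * R) :=
  if Om is Bounded D then D else setT.

Definition lattice (R : realType) (Om : planar_domain R) : set (R * R) :=
  match Om with
  | Bounded _ => [set 0]
  | FlatTorus l1 l2 => [set k | exists m n : int, k = l1 *~ m + l2 *~ n]
  end.

Definition cell (R : realType) (Om : planar_domain R) : set (R * R) :=
  match Om with
  | Bounded D => D
  | FlatTorus l1 l2 => [set x | exists a b : R,
      [/\ 0 <= a < 1, 0 <= b < 1 & x = a *: l1 + b *: l2]]
  end.

Definition dist_domain (R : realType) (Om : planar_domain R) (x y : R * R) : R :=
  inf [set enorm (x - y - k) | k in lattice Om].

Definition lattice_periodic (R : realType) (V : zmodType)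
    (Om : planar_domain R) (f : R * R -> V) : Prop :=
  forall k, lattice Om k -> periodic f k.

Definition conf (R : realType) (Om : planar_domain R) (N : nat) : Type :=
  'I_N -> R * R.

Definition dist_conf (R : realType) (Om : planar_domain R) (N : nat)
    (X Y : conf Om N) : R :=
  Num.sqrt (\sum_(i < N) dist_domain Om (X i) (Y i) ^+ 2).

(* [dist_conf] makes [conf Om N] a pseudometric space, in which [closure] and
   [compact] of sets of representatives are those of the subsets of Om^N that
   they represent (points at distance 0 represent the same configuration). *)
Section conf_pseudometric.
Variables (R : realType) (Om : planar_domain R) (N : nat).

Lemma enormE (x : R * R) : enorm x = Num.sqrt (x.1 ^+ 2 + x.2 ^+ 2).
Proof. by rewrite /enorm /dot !expr2. Qed.

Lemma cauchy_schwarz_sum (n : nat) (a b : 'I_n -> R) :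
  (\sum_i a i * b i) ^+ 2 <= (\sum_i a i ^+ 2) * (\sum_i b i ^+ 2).
Proof.
set A := \sum_i a i ^+ 2; set B := \sum_i b i ^+ 2; set C := \sum_i _ * _.
have B0 : 0 <= B by apply: sumr_ge0 => i _; exact: sqr_ge0.
have key : 0 <= B * (A * B - C ^+ 2).
  have -> : B * (A * B - C ^+ 2) = \sum_i (B * a i - C * b i) ^+ 2.
    transitivity (\sum_i (B ^+ 2 * a i ^+ 2 - 2 * B * C * (a i * b i)
                          + C ^+ 2 * b i ^+ 2)).
      rewrite big_split sumrB -!mulr_sumr -/A -/B -/C /=.
      by rewrite mulrBr; ring.
    by apply: eq_bigr => i _; ring.
  by apply: sumr_ge0 => i _; exact: sqr_ge0.
have [B00|Bn0] := eqVneq B 0; last first.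
  by rewrite -subr_ge0 -(@pmulr_rge0 _ B)// lt_def Bn0.
suff -> : C = 0 by rewrite expr0n /= B00 mulr0.
apply: big1 => i _.
move/eqP: B00; rewrite psumr_eq0; last by move=> ? _; exact: sqr_ge0.
by move=> /allP /(_ i (mem_index_enum i)); rewrite sqrf_eq0 => /eqP ->; rewrite mulr0.
Qed.

Lemma minkowski_sum (n : nat) (a b : 'I_n -> R) :
  Num.sqrt (\sum_i (a i + b i) ^+ 2) <=
  Num.sqrt (\sum_i a i ^+ 2) + Num.sqrt (\sum_i b i ^+ 2).
Proof.
have A0 : 0 <= \sum_i a i ^+ 2 by apply: sumr_ge0 => i _; exact: sqr_ge0.
have B0 : 0 <= \sum_i b i ^+ 2 by apply: sumr_ge0 => i _; exact: sqr_ge0.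
rewrite -[leRHS]ger0_norm ?addr_ge0 ?sqrtr_ge0// -sqrtr_sqr.
apply: ler_wsqrtr; rewrite sqrrD !sqr_sqrtr//.
under eq_bigr do rewrite sqrrD.
rewrite !big_split /= lerD2r lerD2l -mulr2n lerMn2r /= -sqrtrM//.
apply: le_trans (ler_norm _) _; rewrite -sqrtr_sqr.
by apply: ler_wsqrtr; exact: cauchy_schwarz_sum.
Qed.

Lemma enorm_ge0 (x : R * R) : 0 <= enorm x.
Proof. exact: sqrtr_ge0. Qed.

Lemma enorm0 : enorm (0 : R * R) = 0.
Proof. by rewrite enormE /= expr0n /= addr0 sqrtr0. Qed.

Lemma enormN (x : R * R) : enorm (- x) = enorm x.
Proof. by rewrite !enormE /= !sqrrN. Qed.

Lemma enormD (x y : R * R) : enorm (x + y) <= enorm x + enorm y.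
Proof.
have := @minkowski_sum 2 (fun i => if i == 0 then x.1 else x.2)
  (fun i => if i == 0 then y.1 else y.2).
by rewrite !big_ord_recl !big_ord0 /= !addr0 !enormE.
Qed.

Lemma lattice0 : lattice Om 0.
Proof. by case: Om => //= l1 l2; exists 0, 0; rewrite !mulr0z addr0. Qed.

Lemma latticeN k : lattice Om k -> lattice Om (- k).
Proof.
case: Om => [_ ->|l1 l2 [m [n ->]]] /=; first by rewrite oppr0.
by exists (- m), (- n); rewrite !mulrNz opprD.
Qed.

Lemma latticeD k k' : lattice Om k -> lattice Om k' -> lattice Om (k + k').
Proof.
case: Om => [_ -> ->|l1 l2 [m [n ->]] [m' [n' ->]]] /=; first by rewrite addr0.
by exists (m + m'), (n + n'); rewrite !mulrzDr addrACA.
Qed.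

Lemma dist_domain_has_inf x y :
  has_inf [set enorm (x - y - k) | k in lattice Om].
Proof.
split; first by exists (enorm (x - y - 0)), 0 => //; exact: lattice0.
by exists 0 => _ [k _ <-]; exact: enorm_ge0.
Qed.

Lemma dist_domain_ge0 x y : 0 <= dist_domain Om x y.
Proof.
apply: lb_le_inf; first by case: (dist_domain_has_inf x y).
by move=> _ [k _ <-]; exact: enorm_ge0.
Qed.

Lemma dist_domain_le x y k : lattice Om k ->
  dist_domain Om x y <= enorm (x - y - k).
Proof.
move=> Lk; apply: ge_inf; first by case: (dist_domain_has_inf x y).
by exists k.
Qed.

Lemma dist_domainxx x : dist_domain Om x x = 0.
Proof.
apply/eqP; rewrite eq_le dist_domain_ge0 andbT.
by apply: le_trans (dist_domain_le _ _ lattice0) _; rewrite subrr subr0 enorm0.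
Qed.

Lemma dist_domainC x y : dist_domain Om x y = dist_domain Om y x.
Proof.
suff H a b : dist_domain Om a b <= dist_domain Om b a.
  by apply/eqP; rewrite eq_le !H.
apply: lb_le_inf; first by case: (dist_domain_has_inf b a).
move=> _ [k Lk <-].
have -> : enorm (b - a - k) = enorm (a - b - - k).
  by rewrite -[LHS]enormN opprD opprB.
by apply: dist_domain_le; exact: latticeN.
Qed.

Lemma dist_domain_triangle y x z :
  dist_domain Om x z <= dist_domain Om x y + dist_domain Om y z.
Proof.
rewrite -lerBlDr; apply: lb_le_inf; first by case: (dist_domain_has_inf x y).
move=> _ [k Lk <-]; rewrite lerBlDr addrC -lerBlDr.
apply: lb_le_inf; first by case: (dist_domain_has_inf y z).
move=> _ [k' Lk' <-]; rewrite lerBlDr addrC.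
apply: le_trans (dist_domain_le _ _ (latticeD Lk Lk')) _.
apply: le_trans (enormD _ _).
by rewrite addrACA -opprD subrKA.
Qed.

Let conf_ball (X : conf Om N) (e : R) : set (conf Om N) :=
  [set Y | dist_conf X Y < e].

Let conf_ent : set_system (conf Om N * conf Om N) := entourage_ conf_ball.

HB.instance Definition _ := gen_eqMixin (conf Om N).
HB.instance Definition _ := gen_choiceMixin (conf Om N).
HB.instance Definition _ := hasNbhs.Build (conf Om N) (nbhs_ conf_ent).

Let conf_ball_center (X : conf Om N) (e : R) : 0 < e -> conf_ball X e X.
Proof.
move=> e0; rewrite /conf_ball /= /dist_conf big1 ?sqrtr0// => i _.
by rewrite dist_domainxx expr0n.
Qed.

Let conf_ball_sym (X Y : conf Om N) (e : R) : conf_ball X e Y -> conf_ball Y e X.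
Proof.
by rewrite /conf_ball /= /dist_conf; under eq_bigr do rewrite dist_domainC.
Qed.

Let conf_ball_triangle (X Y Z : conf Om N) (e1 e2 : R) :
  conf_ball X e1 Y -> conf_ball Y e2 Z -> conf_ball X (e1 + e2) Z.
Proof.
rewrite /conf_ball /= => XY YZ; apply: le_lt_trans (ltrD XY YZ).
apply: le_trans (minkowski_sum _ _); apply: ler_wsqrtr; apply: ler_sum => i _.
by rewrite lerXn2r ?nnegrE ?addr_ge0 ?dist_domain_ge0// dist_domain_triangle.
Qed.

HB.instance Definition _ := @Nbhs_isPseudoMetric.Build R (conf Om N)
  conf_ent erefl conf_ball conf_ball_center conf_ball_sym conf_ball_triangle
  erefl.

End conf_pseudometric.

Definition conf_in (R : realType) (Om : planar_domain R) (N : nat)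
    : set (conf Om N) :=
  [set X | forall i, carrier Om (X i)].
Arguments conf_in {R} Om N _.

Definition distinct_generators (R : realType) (Om : planar_domain R) (N : nat)
    (X : conf Om N) : Prop :=
  forall i j, i != j -> 0 < dist_domain Om (X i) (X j).

Definition voronoi (R : realType) (Om : planar_domain R) (N : nat)
    (X : conf Om N) (i : 'I_N) : set (R * R) :=
  [set x | carrier Om x /\
    forall j, j != i -> dist_domain Om x (X i) < dist_domain Om x (X j)].

Definition volume (R : realType) (Om : planar_domain R) (N : nat)
    (X : conf Om N) (i : 'I_N) : R :=
  area (voronoi X i `&` cell Om).

Definition planar_polygon (R : realType) (Om : planar_domain R) (N : nat)
    (X : conf Om N) (i : 'I_N) : set (R * R) :=
  [set y | forall j k, lattice Om k -> enorm (y - X i) <= enorm (y - X j - k)].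

(* The vector c_i(X) - x_i *)
Definition displacement (R : realType) (Om : planar_domain R) (N : nat)
    (X : conf Om N) (i : 'I_N) : R * R :=
  match Om with
  | Bounded _ =>
      (volume X i)^-1 *: vector_integral (voronoi X i) (fun x => x) - X i
  | FlatTorus _ _ =>
      (volume X i)^-1 *: vector_integral (planar_polygon X i) (fun y => y - X i)
  end.

Definition energy (R : realType) (Om : planar_domain R) (N : nat)
    (X : conf Om N) : R :=
  \int[leb2 R]_(x in cell Om) inf [set dist_domain Om x (X i) ^+ 2 | i in [set: 'I_N]].

Definition centroid_defect (R : realType) (Om : planar_domain R) (N : nat)
    (X : conf Om N) : R :=
  \sum_(i < N) volume X i * enorm (displacement X i) ^+ 2.

Definition diameter (R : realType) (Om : planar_domain R) (A : set (R * R)) : R :=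
  sup [set d | exists x y, [/\ A x, A y & d = dist_domain Om x y]].

Definition max_diameter (R : realType) (Om : planar_domain R) (N : nat)
    (X : conf Om N) : R :=
  \big[Num.max/0]_(i < N) diameter Om (voronoi X i).

Definition mesh_size (R : realType) (Om : planar_domain R) (N : nat) : R :=
  Num.sqrt (area (cell Om) / N%:R).

Definition min_energy (R : realType) (Om : planar_domain R) (N : nat) : R :=
  inf [set energy X | X in conf_in Om N].

Definition minimizers (R : realType) (Om : planar_domain R) (N : nat)
    : set (conf Om N) :=
  [set X | conf_in Om N X /\ forall Y, conf_in Om N Y -> energy X <= energy Y].
Arguments minimizers {R} Om N _.

Definition dist_minimizers (R : realType) (Om : planar_domain R) (N : nat)
    (X : conf Om N) : R :=
  inf [set dist_conf X Y | Y in minimizers Om N].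

Definition tube (R : realType) (Om : planar_domain R) (N : nat) (r : R)
    : set (conf Om N) :=
  [set X | conf_in Om N X /\ dist_minimizers X < r].
Arguments tube {R} Om N r _.

Definition energy_gap (R : realType) (Om : planar_domain R) (N : nat) (r : R)
    : \bar R :=
  ereal_inf [set (energy X - min_energy Om N)%R%:E | X in
    [set X : conf Om N | closure (tube Om N r) X /\ dist_minimizers X = r]].

(* The norm of C^{0,1}(Om); the second supremum ranges over distinct points. *)
Definition C01_norm (R : realType) (Om : planar_domain R)
    (f : R * R -> R * R) : \bar R :=
  (ereal_sup [set (enorm (f x))%:E | x in carrier Om] +
   ereal_sup [set q | exists x y, [/\ carrier Om x, carrier Om y,
     (0 < dist_domain Om x y)%R &
     q = (enorm (f x - f y)%R / dist_domain Om x y)%R%:E]])%E.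

Definition C01 (R : realType) (Om : planar_domain R)
    : set (R * R -> R * R) :=
  [set f | lattice_periodic Om f /\ (C01_norm Om f < +oo)%E].
Arguments C01 {R} Om _.

Definition C01_simple (R : realType) (Om : planar_domain R)
    (s : R -> R * R -> R * R) : Prop :=
  exists (n : nat) (E : 'I_n -> set R) (f : 'I_n -> R * R -> R * R),
    [/\ forall i, measurable (E i), forall i, C01 Om (f i) &
      forall t x, s t x = \sum_(i < n) \1_(E i) t *: f i x].

(* Bochner space L^1((0,T); C^{0,1}(Om; R^2)): almost everywhere limits of
   simple functions (strong measurability), with integrable norm. *)
Definition L1_C01 (R : realType) (Om : planar_domain R) (T : R)
    (v : R -> R * R -> R * R) : Prop :=
  [/\ {ae @lebesgue_measure R, forall t, t \in `]0, T[ -> C01 Om (v t)},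
      exists2 s : nat -> R -> R * R -> R * R, (forall k, C01_simple Om (s k)) &
        {ae @lebesgue_measure R, forall t, t \in `]0, T[ ->
          C01_norm Om (fun x => v t x - s k t x) @[k --> \oo] --> 0%E} &
      (\int[@lebesgue_measure R]_(t in `]0%R, T[) C01_norm Om (v t) < +oo)%E].

Definition Lambda (R : realType) (Om : planar_domain R)
    (v : R -> R * R -> R * R) (t : R) : R :=
  fine (\int[@lebesgue_measure R]_(s in `]0%R, t[) C01_norm Om (v s))%E.

(* Outward unit normal of a convex domain at the boundary points where it
   exists: the unique unit normal of a supporting half-plane. *)
Definition supporting_normal (R : realType) (D : set (R * R)) (x n : R * R)
    : Prop :=
  enorm n = 1 /\ forall y, D y -> dot n (y - x) <= 0.

Definition outward_normal (R : realType) (D : set (R * R)) (x n : R * R)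
    : Prop :=
  supporting_normal D x n /\ forall m, supporting_normal D x m -> m = n.

(* The boundary values of v(t, .) are those of its continuous extension. *)
Definition tangential (R : realType) (Om : planar_domain R) (T : R)
    (v : R -> R * R -> R * R) : Prop :=
  match Om with
  | Bounded D =>
      {ae @lebesgue_measure R, forall t, t \in `]0, T[ ->
        forall x n, (closure D `\` D) x -> outward_normal D x n ->
          dot (v t y) n @[y --> within D (nbhs x)] --> 0}
  | FlatTorus _ _ => True
  end.

Definition absolutely_continuous (R : realType) (T : R) (g : R -> R * R)
    : Prop :=
  forall e : R, 0 < e -> exists2 d : R, 0 < d &
    forall (n : nat) (a b : 'I_n -> R),
      (forall i, 0 <= a i <= b i /\ b i <= T) ->
      trivIset setT (fun i => `]a i, b i[%classic) ->
      \sum_(i < n) (b i - a i) < d ->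
      \sum_(i < n) enorm (g (b i) - g (a i)) < e.

(* Distinctness of the generators makes the centroids in the right-hand side
   meaningful. *)
Definition lloyd_solution (R : realType) (Om : planar_domain R) (N : nat)
    (T : R) (v : R -> R * R -> R * R) (alpha : R -> R) (X0 : conf Om N)
    (X : R -> conf Om N) : Prop :=
  [/\ forall t, t \in `[0, T] -> conf_in Om N (X t) /\ distinct_generators (X t),
      forall i, absolutely_continuous T (fun t => X t i),
      {ae @lebesgue_measure R, forall t, t \in `]0, T[ -> forall i,
        is_derive t 1 (fun s => X s i)
          (v t (X t i) + alpha t *: displacement (X t) i)} &
      forall i, X 0 i = X0 i].

Definition mass (R : realType) (Om : planar_domain R) (N : nat)
    (rho : R * R -> R) (X : conf Om N) (i : 'I_N) : R :=
  \int[leb2 R]_(x in voronoi X i `&` cell Om) rho x.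

Definition Lp_norm (R : realType) (Om : planar_domain R) (p : \bar R)
    (rho : R * R -> R) : \bar R :=
  'N[leb2 R]_p[EFin \o (rho \_ (cell Om))]%E.

Definition transport_error (R : realType) (Om : planar_domain R) (N : nat)
    (T : R) (v : R -> R * R -> R * R) (alpha : R -> R) (rho : R * R -> R)
    (X : R -> conf Om N) : \bar R :=
  (\int[@lebesgue_measure R]_(s in `]0%R, T[)
    (expR (Lambda Om v T - Lambda Om v s) * alpha s *
     \sum_(i < N) mass rho (X 0) i * enorm (displacement (X s) i))%R%:E)%E.

(* Main.v *)
Require Import Defs.
From HB Require Import structures.
From mathcomp Require Import all_boot all_order all_algebra.
From mathcomp Require Import all_classical all_reals all_analysis.
From mathcomp Require Import measurable_realfun ess_sup_inf.
From mathcomp Require Import ring lra.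
Import Order.TTheory GRing.Theory Num.Theory.
Import numFieldNormedType.Exports.
Set Implicit Arguments.
Unset Strict Implicit.
Unset Printing Implicit Defensive.
Local Open Scope classical_set_scope.
Local Open Scope ring_scope.

(** Write V_i for the area of the cell of the generator x_i, d_i for the vector
    from x_i to the centroid of this cell, D for a bound of the cell diameters,
    of the order of h, L for the C^{0,1} norm of v, and A for the integral of
    alpha.

    The energy is the integral of a minimum of squared distances.  Keeping each
    point assigned to its old generator while the generators move from X to Y
    overestimates the new energy, so that (energy_semiconcave)
      energy Y - energy X <=
        sum_i V_i (|Y_i - X_i|^2 - 2 (Y_i - X_i) . d_i).
    Along the flow this bounds the upper Dini derivative of the energy by
      - 2 alpha G - 2 sum_i V_i d_i . v(x_i),
    where G is the centroid defect.  The last sum looks of first order in D, but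
    V_i d_i is the integral of y - x_i over the cell, and y - x_i is half the
    gradient of the squared distance to the nearest generator, a function
    bounded by D^2.  Integrating by parts against the Lipschitz field v leaves a
    term of size L D^2 (flux_bound).  The integration by parts is carried out on
    difference quotients in the coordinate directions, against the positive
    parts of the components of v: semiconcavity gives inequalities in one
    direction only, which nonnegative weights preserve.  Convexity of the
    fundamental cell bounds the boundary terms, since a convex set inside a
    square differs from its translate by a thin layer (shift_layer).

    The energy is at most D^2 times the area of the domain, and it is absolutely
    continuous in time, so the Dini estimate can be integrated
    (ac_le_integral) and yields the bound of the total dissipation
    (dissipation_bound).  The integrals in time are suprema over simple
    functions, hence it suffices to estimate measurable functions below the
    integrand (integral_itv_le).

    For a minimizer, two generators at a distance d much smaller than h would be
    wasteful.  Some point z is at distance at least h / 3 from all generators;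
    moving one of the two to z raises the cost on its former cell by O(h d) and
    lowers it by at least h^2 / 18 on the ball of radius h / 12 around z, whose
    area is of the order of h^2 (minimizer_separation).  A configuration close
    to a minimizer inherits the separation (tube_separation), a separated
    generator has a small ball in its cell (volume_ge), and a cell of diameter at
    most C1 h has area at most of the order of h^2 (volume_le).

    For the transport error, the inequality x y <= b^(1-m) x^m + b y^2 with
    m = min(p, 2) and 0 <= y <= 1 (young_small) is applied on each cell to the
    density and to |d_i| / D.  It separates a moment of the density, bounded by
    the L^p norm (moment_bound), from a quantity controlled by the centroid
    defect (weighted_displacement_le), because the volumes at times 0 and t are
    comparable.  Integration in time, dissipation_bound and the choice
    b = A^(1/m) give the power of A (transport_error_rate).

    On the torus everything is read on plane representatives.  Up to a null set
    of ties, the plane polygon around a representative of x_i is sent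
    bijectively onto the Voronoi cell by lattice translations
    (integral_vcell_voronoi), and on it the torus distance to x_i is
    Euclidean (vcell_dist). *)

(** * Measure theory of the plane *)

Definition box (R : realType) (a b c d : R) : set (R * R) :=
  `]a, b[%classic `*` `]c, d[%classic.

Lemma measurable_box (R : realType) (a b c d : R) : measurable (box a b c d).
Proof. by apply: measurableX; exact: measurable_itv. Qed.

Lemma nbhs_plane_box (R : realType) (U : set (R * R)) (x : R * R) : open U -> U x ->
  exists2 e : R, 0 < e & box (x.1 - e) (x.1 + e) (x.2 - e) (x.2 + e) `<=` U.
Proof.
move=> oU Ux; have : nbhs x U by exact: open_nbhs_nbhs.
rewrite -nbhs_ballE => -[e /= e0 xe]; exists e => // -[y1 y2] [/=].
rewrite !in_itv/= => /andP[a b] /andP[c d]; apply: xe.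
by split; rewrite /ball/= /ball/= ltr_norml ltrBlDr ltrBrDr; apply/andP; split; lra.
Qed.

Lemma box_subP (R : realType) (U : set (R * R)) :
  (forall x, U x -> exists2 e : R, 0 < e &
    box (x.1 - e) (x.1 + e) (x.2 - e) (x.2 + e) `<=` U) -> open U.
Proof.
move=> H; rewrite openE => x Ux; have [e e0 xe] := H _ Ux.
rewrite /interior -nbhs_ballE; exists e => //= -[y1 y2] [/=].
rewrite /ball/= /ball/= !ltr_norml => /andP[a b] /andP[c d].
by apply: xe; split; rewrite /= in_itv/=; apply/andP; split; lra.
Qed.

(** The rational boxes contained in U form a countable cover of U. *)
Lemma open_plane_measurable (R : realType) (U : set (R * R)) :
  open U -> measurable U.
Proof.
move=> oU.
pose B (k : (rat * rat) * (rat * rat)) : set (R * R) :=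
  box (ratr k.1.1) (ratr k.1.2) (ratr k.2.1) (ratr k.2.2).
pose F k := if `[< B k `<=` U >] then B k else set0.
have -> : U = \bigcup_k F k.
  apply/seteqP; split => [x Ux|x [k _]]; last first.
    by rewrite /F; case: ifPn => // /asboolP + ?; exact.
  have [e e0 xe] := nbhs_plane_box oU Ux.
  have lt1 (z : R) : z - e < z by lra.
  have lt2 (z : R) : z < z + e by lra.
  have [p1] := rat_in_itvoo (lt1 x.1); rewrite in_itv/= => /andP[a1 a2].
  have [q1] := rat_in_itvoo (lt2 x.1); rewrite in_itv/= => /andP[b1 b2].
  have [p2] := rat_in_itvoo (lt1 x.2); rewrite in_itv/= => /andP[c1 c2].
  have [q2] := rat_in_itvoo (lt2 x.2); rewrite in_itv/= => /andP[d1 d2].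
  exists ((p1, q1), (p2, q2)) => //; rewrite /F; case: ifPn => [_|/asboolP].
    by split; rewrite /= in_itv/=; apply/andP; split.
  case; apply: subset_trans xe => -[y1 y2] [/=].
  rewrite !in_itv/= => /andP[? ?] /andP[? ?].
  by split; rewrite /= in_itv/=; apply/andP; split; lra.
apply: countable_bigcupT_measurable => [|k].
  exact: countableP.
rewrite /F; case: ifPn => _; first exact: measurable_box.
exact: measurable0.
Qed.

Lemma enorm_le_coord (R : realType) (z : R * R) : enorm z <= `|z.1| + `|z.2|.
Proof.
rewrite enormE -[leRHS]ger0_norm ?addr_ge0// -sqrtr_sqr ler_wsqrtr//.
rewrite -(real_normK (num_real z.1)) -(real_normK (num_real z.2)).
by have := normr_ge0 z.1; have := normr_ge0 z.2; nra.
Qed.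

Lemma coord_le_enorm (R : realType) (z : R * R) :
  `|z.1| <= enorm z /\ `|z.2| <= enorm z.
Proof.
rewrite enormE -!sqrtr_sqr; split; apply: ler_wsqrtr.
  by rewrite lerDl sqr_ge0.
by rewrite lerDr sqr_ge0.
Qed.

(** The superlevel sets are open in D. *)
Lemma lipschitz_measurable (R : realType) (D : set (R * R)) (f : R * R -> R) (K : R) :
  open D -> (forall x y, D x -> D y -> `|f x - f y| <= K * enorm (x - y)) ->
  measurable_fun D f.
Proof.
move=> oD fK mD; apply: (measurability _ (measurable_realfun.RGenOInfty.measurableE R)) => //.
move=> _ [_ [a ->] <-]; apply: open_plane_measurable; apply: box_subP => x [Dx /=].
rewrite in_itv/= andbT => afx; have [e e0 xe] := nbhs_plane_box oD Dx.
have K1 : 0 < `|K| + 1 by rewrite ltr_wpDl.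
pose d := Num.min e ((f x - a) / (2 * (`|K| + 1))).
exists d; first by rewrite lt_min e0 divr_gt0// ?subr_gt0// mulr_gt0.
have de : d <= e by rewrite ge_min lexx.
have da : d * (2 * (`|K| + 1)) <= f x - a.
  by rewrite -ler_pdivlMr ?mulr_gt0// ge_min lexx orbT.
move=> [y1 y2] []; rewrite /= !in_itv/= => /andP[a1 a2] /andP[b1 b2].
have Dy : D (y1, y2) by apply: xe; split; rewrite /= in_itv/=; apply/andP; split; lra.
split => //; rewrite /preimage/= andbT.
have := fK _ _ Dx Dy; have := enorm_le_coord (x - (y1, y2)).
have : `|(x - (y1, y2)).1| < d by rewrite ltr_norml /=; apply/andP; split; lra.
have : `|(x - (y1, y2)).2| < d by rewrite ltr_norml /=; apply/andP; split; lra.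
have := ler_norm (f x - f (y1, y2)).
have := ler_norm K; have := enorm_ge0 (x - (y1, y2)).
set E := enorm _ => E0 KK h1 h2 h3 h4 h5.
have : K * E <= `|K| * E by rewrite ler_wpM2r.
have : `|K| * E <= (`|K| + 1) * E by rewrite ler_wpM2r ?lerDl.
have : (`|K| + 1) * E < (`|K| + 1) * (2 * d) by rewrite ltr_pM2l//; lra.
lra.
Qed.

Lemma leb2_box (R : realType) (a b c d : R) : a <= b -> c <= d ->
  leb2 R (box a b c d) = ((b - a) * (d - c))%:E.
Proof.
move=> ab cd.
have E : leb2 R (box a b c d) = (@lebesgue_measure R `]a, b[%classic * @lebesgue_measure R `]c, d[%classic)%E.
  apply: (@product_measure1E _ _ (measurableTypeR R) (measurableTypeR R) R
    (@lebesgue_measure R) (@lebesgue_measure R)); exact: measurable_itv.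
rewrite E; have L (x y : R) : x <= y -> @lebesgue_measure R `]x, y[%classic = (y - x)%:E.
  move=> xy; rewrite lebesgue_measure_itv/= lte_fin; case: ltP => [//|yx].
  by rewrite (le_anti (introT andP (conj xy yx))) subrr.
by rewrite !L.
Qed.

Lemma measurable_addr (R : realType) (e : R) :
  measurable_fun [set: R] (fun x : R => x + e).
Proof. by apply: measurable_funD. Qed.

Lemma lebesgue_measure_translation (R : realType) (e : R) (A : set R) :
  measurable A -> @lebesgue_measure R ((fun x => x + e) @^-1` A) = @lebesgue_measure R A.
Proof.
move=> mA.
have mf := @measurable_addr R e.
have -> : @lebesgue_measure R ((fun x => x + e) @^-1` A) =
   pushforward (@lebesgue_measure R) ((fun x => x + e) : measurableTypeR R -> measurableTypeR R) A by [].
apply/esym/lebesgue_measure_unique => //= _ [[a b]] _ <-.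
rewrite /pushforward.
have -> : (fun x => x + e) @^-1` `](a, b).1, (a, b).2]%classic = `]a - e, b - e]%classic.
  by apply/seteqP; split => x /=; rewrite !in_itv/= ltrBlDr lerBrDr.
rewrite !lebesgue_measure_itv/= !lte_fin ltrD2r; case: ifP => // _.
by rewrite -!EFinD; congr EFin; ring.
Qed.

Lemma measurable_plane_addr (R : realType) (e : R * R) :
  measurable_fun [set: R * R] (fun x : R * R => x + e).
Proof.
apply/measurable_fun_pairP; split => /=.
  by apply: measurable_funD => //; exact: measurable_fst.
by apply: measurable_funD => //; exact: measurable_snd.
Qed.

Lemma measurable_preimage_addr (R : realType) (e : R * R) (A : set (R * R)) :
  measurable A -> measurable ((fun x => x + e) @^-1` A).
Proof.
move=> mA; rewrite -[X in measurable X]setTI.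
exact: measurable_plane_addr.
Qed.

Lemma leb2_translation (R : realType) (e : R * R) (A : set (R * R)) :
  measurable A -> leb2 R ((fun x => x + e) @^-1` A) = leb2 R A.
Proof.
move=> mA.
have mf := @measurable_plane_addr R e.
pose m' := pushforward (leb2 R) ((fun x => x + e) :
  measurableTypeR R * measurableTypeR R -> measurableTypeR R * measurableTypeR R).
have -> : leb2 R ((fun x => x + e) @^-1` A) = m' A by [].
apply/esym/(@product_measure_unique _ _ (measurableTypeR R) (measurableTypeR R) R
    (@lebesgue_measure R) (@lebesgue_measure R)) => // B C mB mC.
rewrite /m' /pushforward.
transitivity (leb2 R (((fun x : R => x + e.1)%R @^-1` B) `*` ((fun x : R => x + e.2)%R @^-1` C))).
  by congr (leb2 R _); apply/seteqP; split => -[x y].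
have m1 (f : R) (D : set R) : measurable D -> measurable ((fun x => x + f) @^-1` D).
  by move=> mD; rewrite -[X in measurable X]setTI; exact: measurable_addr.
transitivity (@lebesgue_measure R ((fun x : R => x + e.1)%R @^-1` B) *
  @lebesgue_measure R ((fun x : R => x + e.2)%R @^-1` C))%E.
  apply: (@product_measure1E _ _ (measurableTypeR R) (measurableTypeR R) R
    (@lebesgue_measure R) (@lebesgue_measure R)); exact: m1.
by rewrite !lebesgue_measure_translation.
Qed.

Lemma ge0_integral_translation (R : realType) (e : R * R) (D : set (R * R))
    (f : R * R -> \bar R) :
  measurable D -> measurable_fun D f -> (forall x, D x -> (0 <= f x)%E) ->
  (\int[leb2 R]_(x in D) f x =
   \int[leb2 R]_(x in (fun x => x + e)%R @^-1` D) f (x + e)%R)%E.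
Proof.
move=> mD mf f0; have mt := @measurable_plane_addr R e.
pose m' := pushforward (leb2 R) ((fun x => x + e) :
  measurableTypeR R * measurableTypeR R -> measurableTypeR R * measurableTypeR R).
transitivity (\int[m']_(x in D) f x)%E.
  by apply: eq_measure_integral => A mA AD; apply/esym; exact: leb2_translation.
rewrite ge0_integral_pushforward// => x /set_mem; exact: f0.
Qed.

(** The product measure is symmetric in its factors. *)
Lemma leb2_ysection (R : realType) (A : set (R * R)) : measurable A ->
  leb2 R A = (\int[@lebesgue_measure R]_y (@lebesgue_measure R) (ysection A y))%E.
Proof.
move=> mA.
apply: (@product_measure_unique _ _ (measurableTypeR R) (measurableTypeR R) R
    (@lebesgue_measure R) (@lebesgue_measure R)
    (@lebesgue_measure R \x^ @lebesgue_measure R)%E) => // B C mB mC.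
exact: (@product_measure2E _ _ (measurableTypeR R) (measurableTypeR R) R
    (@lebesgue_measure R) (@lebesgue_measure R)).
Qed.

Lemma leb2_xsection (R : realType) (A : set (R * R)) :
  leb2 R A = (\int[@lebesgue_measure R]_x (@lebesgue_measure R) (xsection A x))%E.
Proof. by []. Qed.

(** S lies in the interval of length d that starts at inf S. *)
Lemma lebesgue_measure_le_diam (R : realType) (S : set R) (d : R) : 0 <= d ->
  measurable S -> (forall s s', S s -> S s' -> s' <= s + d) ->
  (@lebesgue_measure R S <= d%:E)%E.
Proof.
move=> d0 mS Sd; have [->|/set0P S0] := eqVneq S set0; first by rewrite measure0 lee_fin.
have [s0 Ss0] := S0.
have iS : has_inf S.
  by split; [exact: S0|exists (s0 - d) => s Ss; rewrite lerBlDr; exact: Sd].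
apply: (@le_trans _ _ (@lebesgue_measure R `[inf S, inf S + d]%classic)).
  apply: le_measure; rewrite ?inE//.
  move=> s Ss /=; rewrite in_itv/=; apply/andP; split; first by apply: ge_inf Ss; case: iS.
  rewrite -lerBlDr; apply: lb_le_inf; first exact: S0.
  by move=> s' Ss'; rewrite lerBlDr; exact: Sd.
rewrite lebesgue_measure_itv/= lte_fin; case: ifP => _; last by rewrite lee_fin.
by rewrite -EFinD lee_fin; lra.
Qed.

Lemma measurable_set_ltr (d : measure_display) (T : measurableType d) (R : realType) (D : set T)
    (f g : T -> R) : measurable D -> measurable_fun D f -> measurable_fun D g ->
  measurable (D `&` [set x | f x < g x]).
Proof.
move=> mD mf mg; have := measurable_fun_ltr mf mg mD (Y := [set true]).
by apply.
Qed.

Lemma measurable_set_ler (d : measure_display) (T : measurableType d) (R : realType) (D : set T)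
    (f g : T -> R) : measurable D -> measurable_fun D f -> measurable_fun D g ->
  measurable (D `&` [set x | f x <= g x]).
Proof.
move=> mD mf mg; have := measurable_fun_ler mf mg mD (Y := [set true]).
by apply.
Qed.

Lemma measurable_set_eqr (d : measure_display) (T : measurableType d) (R : realType) (D : set T)
    (f g : T -> R) : measurable D -> measurable_fun D f -> measurable_fun D g ->
  measurable (D `&` [set x | f x = g x]).
Proof.
move=> mD mf mg; have -> : D `&` [set x | f x = g x] = D `&` [set x | f x == g x].
  by apply/seteqP; split => x [Dx] /eqP.
have := measurable_fun_eqr mf mg mD (Y := [set true]).
by apply.
Qed.

(** * Convex sets and their translates *)

Definition convex_plane (R : realType) (D : set (R * R)) : Prop :=
  forall x y (t : R), D x -> D y -> 0 <= t <= 1 -> D (t *: x + (1 - t) *: y).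

Definition in_square (R : realType) (D : set (R * R)) (r : R) : Prop :=
  forall x, D x -> `|x.1| <= r /\ `|x.2| <= r.

Lemma enormZ (R : realType) (t : R) (x : R * R) : enorm (t *: x) = `|t| * enorm x.
Proof.
rewrite !enormE /= !exprMn -mulrDr sqrtrM ?sqr_ge0//.
by rewrite sqrtr_sqr.
Qed.

(** Contracting a box inside D towards a by the ratio rho / K stays in D by
    convexity, and ends up in the ball of radius rho because K bounds the
    diameter of D. *)
Lemma convex_area_near (R : realType) (D : set (R * R)) (p : R * R) (r s rho0 : R) :
  measurable D -> convex_plane D -> in_square D r -> 0 < s -> 0 < rho0 ->
  box (p.1 - s) (p.1 + s) (p.2 - s) (p.2 + s) `<=` D ->
  exists2 c : R, 0 < c & forall a rho, D a -> 0 < rho -> rho <= rho0 ->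
    ((c * rho ^+ 2)%:E <= leb2 R (D `&` [set x | enorm (x - a) < rho]%R))%E.
Proof.
move=> mD cD bD s0 rho00 pD.
pose K := 4 * `|r| + rho0.
have K0 : 0 < K by rewrite ltr_wpDl// mulr_ge0.
exists (4 * s ^+ 2 / K ^+ 2); first by rewrite divr_gt0 ?mulr_gt0 ?exprn_gt0.
move=> a rho Da r0 rr0; pose t := rho / K.
have t0 : 0 < t by rewrite divr_gt0.
have t1 : t <= 1 by rewrite ler_pdivrMr// mul1r /K; have := normr_ge0 r; lra.
pose q := a + t *: (p - a).
pose B := box (q.1 - t * s) (q.1 + t * s) (q.2 - t * s) (q.2 + t * s).
have ts : 0 < t * s by rewrite mulr_gt0.
have <- : leb2 R B = (4 * s ^+ 2 / K ^+ 2 * rho ^+ 2)%:E.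
  rewrite leb2_box; [|lra|lra]; congr EFin.
  by rewrite /t; field; rewrite gt_eqF.
apply: le_measure; rewrite ?inE//.
- exact: measurable_box.
- apply: measurable_set_ltr => //; apply: (measurable_funS measurableT) => //.
  apply: (@lipschitz_measurable R setT _ 1) => //; first exact: openT.
  move=> x y _ _; rewrite mul1r ler_norml; apply/andP; split.
    by have := enormD (y - x) (x - a); rewrite addrA subrK -(enormN (y - x)) opprB; lra.
  by have := enormD (x - y) (y - a); rewrite addrA subrK; lra.
- move=> [x1 x2] []; rewrite /= !in_itv/= => /andP[h1 h2] /andP[h3 h4].
  pose z := a + t^-1 *: ((x1, x2) - a).
  have tn0 : t != 0 by rewrite gt_eqF.
  have xE : (x1, x2) = t *: z + (1 - t) *: a.
    rewrite /z; apply/eqP; rewrite xpair_eqE /=; apply/andP; split; apply/eqP.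
      by rewrite /GRing.scale /=; field.
    by rewrite /GRing.scale /=; field.
  have Dz : D z.
    apply: pD; move: h1 h2 h3 h4; rewrite /q /z /= /GRing.scale /= => h1 h2 h3 h4.
    have E (u v w : R) : u + t * (w - u) - t * s < v -> v < u + t * (w - u) + t * s ->
        (w - s < u + t^-1 * (v - u)) && (u + t^-1 * (v - u) < w + s).
      move=> g1 g2; have -> : u + t^-1 * (v - u) = w + t^-1 * (v - (u + t * (w - u))) by field.
      rewrite ltrD2l ltrD2l; apply/andP; split.
        by rewrite mulrC ltr_pdivlMr//; lra.
      by rewrite mulrC ltr_pdivrMr//; lra.
    by split; rewrite /= in_itv/=; apply: E.
  split; first by rewrite xE; apply: cD => //; rewrite t1 ltW.
  rewrite /=.
  have -> : (x1, x2) - a = t *: (z - a).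
    by rewrite /z addrAC subrr add0r scalerA mulfV// scale1r.
  rewrite enormZ gtr0_norm// /t mulrAC -mulrA gtr_pMr//.
  rewrite ltr_pdivrMr// mul1r.
  have [az1 az2] := bD _ Da; have [z1 z2] := bD _ Dz.
  apply: le_lt_trans (enorm_le_coord _) _; rewrite /=.
  have := ler_normB z.1 a.1; have := ler_normB z.2 a.2; have := ler_norm r.
  rewrite /K; lra.
Qed.

(** The sections across one of the coordinate axes have at most one point. *)
Lemma line_null (R : realType) (p q c : R) : p != 0 \/ q != 0 ->
  let l := [set x : R * R | p * x.1 + q * x.2 = c] in
  measurable l /\ leb2 R l = 0%E.
Proof.
move=> pq l; have ml : measurable l.
  have := @measurable_set_eqr _ _ R setT (fun x : R * R => p * x.1 + q * x.2) (cst c).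
  rewrite setTI; apply => //; apply: measurable_funD; apply: measurable_funM => //.
split => //; case: pq => [p0|q0].
  rewrite leb2_ysection//; apply: integral0_eq => y _.
  apply: (@subset_measure0 _ _ _ (@lebesgue_measure R) _ [set (c - q * y) / p]) => //.
  - exact: measurable_ysection.
  - by move=> x; rewrite /ysection/= inE /l/= => <-; field.
  - exact: lebesgue_measure_set1.
rewrite leb2_xsection//; apply: integral0_eq => y _.
apply: (@subset_measure0 _ _ _ (@lebesgue_measure R) _ [set (c - p * y) / q]) => //.
- exact: measurable_xsection.
- by move=> x; rewrite /xsection/= inE /l/= => <-; field.
- exact: lebesgue_measure_set1.
Qed.

(** The difference of the squared distances to a and b is affine, so the
    bisector is a line. *)
Lemma bisector_null (R : realType) (a b : R * R) : a != b ->
  let l := [set x : R * R | enorm (x - a) = enorm (x - b)] in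
  measurable l /\ leb2 R l = 0%E.
Proof.
move=> ab l.
have -> : l = [set x | (2 * (b.1 - a.1)) * x.1 + (2 * (b.2 - a.2)) * x.2 =
   b.1 ^+ 2 + b.2 ^+ 2 - a.1 ^+ 2 - a.2 ^+ 2].
  have E (x c : R * R) : enorm (x - c) ^+ 2 = (x.1 - c.1) ^+ 2 + (x.2 - c.2) ^+ 2.
    by rewrite enormE sqr_sqrtr ?addr_ge0 ?sqr_ge0.
  apply/seteqP; split => x /=.
    by move/(congr1 (fun z => z ^+ 2)); rewrite !E => h; lra.
  move=> h; apply/eqP; rewrite -(@eqrXn2 _ 2) ?enorm_ge0//; apply/eqP; rewrite !E; lra.
apply: line_null; move: ab; case: a b {l} => a1 a2 [b1 b2] /=.
rewrite xpair_eqE negb_and => /orP[h|h]; [left|right];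
  by rewrite mulf_neq0// subr_eq0 eq_sym.
Qed.

(** The part of an interval I outside of its translate by d lies at one end of
    I, within `|d| of that end. *)
Lemma interval_shift_gap (R : realType) (I : set R) (d : R) :
  (forall x y t, I x -> I y -> x <= t <= y -> I t) ->
  forall s s', (I s /\ ~ I (s - d)) -> (I s' /\ ~ I (s' - d)) -> s' <= s + `|d|.
Proof.
move=> iI s s' [Is ns] [Is' ns']; rewrite leNgt; apply/negP => lt.
have [d0|d0] := leP 0 d.
  move: lt; rewrite ger0_norm// => lt; apply: ns'.
  by apply: (iI s s') => //; apply/andP; split; lra.
move: lt; rewrite ltr0_norm// => lt; apply: ns.
by apply: (iI s s') => //; apply/andP; split; lra.
Qed.

Lemma integral_le_on_segment (R : realType) (g : R -> \bar R) (r d : R) : 0 <= r -> 0 <= d ->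
  measurable_fun setT g -> (forall x, 0 <= g x)%E ->
  (forall x, g x <= d%:E)%E -> (forall x, r < `|x| -> g x = 0%E) ->
  (\int[@lebesgue_measure R]_x g x <= (2 * r * d)%:E)%E.
Proof.
move=> r0 d0 mg g0 gd gr; pose I : set R := `[- r, r]%classic.
have mI : measurable I by exact: measurable_itv.
apply: (@le_trans _ _ (\int[@lebesgue_measure R]_x (d%:E * (\1_I x)%:E))%E).
  apply: ge0_le_integral => //.
  - by apply: measurable_funeM; exact/measurable_EFinP.
  - move=> x _; rewrite indicE; have [xI|xI] := boolP (x \in I); first by rewrite mule1.
    rewrite mule0 gr//; rewrite ltNge; apply: contra xI => xr; rewrite inE /I/= in_itv/=.
    by rewrite -ler_norml.
rewrite ge0_integralZl_EFin//; last first.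
  - exact/measurable_EFinP.
have LI : @lebesgue_measure R I = (2 * r)%:E.
  rewrite lebesgue_measure_itv/= lte_fin; case: ifP => [_|/negbT].
    by rewrite -EFinD; congr EFin; ring.
  rewrite -leNgt => rr; have -> : r = 0 by lra.
  by rewrite mulr0.
rewrite integral_indic// setIT.
have -> : (d%:E * lebesgue_measure I = d%:E * (2 * r)%:E)%E by rewrite -LI.
by rewrite -EFinM lee_fin; lra.
Qed.

(** Each line parallel to e meets D in an interval, which exceeds its
    translate by a length at most d (interval_shift_gap), and the lines that
    meet D fill a strip of width 2 * r. *)
Lemma shift_layer (R : realType) (D : set (R * R)) (r d : R) (e : R * R) :
  measurable D -> convex_plane D -> in_square D r -> 0 <= r ->
  e = (d, 0) \/ e = (0, d) ->
  (leb2 R (D `\` [set x | D (x - e)%R]) <= (2 * r * `|d|)%:E)%E.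
Proof.
move=> mD cD bD r0 he.
have mA : measurable (D `\` [set x | D (x - e)]).
  by apply: measurableD => //; exact: (measurable_preimage_addr (- e) mD).
have key (I : set R) : measurable I ->
    (exists J : set R, (forall x y t, J x -> J y -> x <= t <= y -> J t) /\
      I = [set s | J s /\ ~ J (s - d)]) ->
    (@lebesgue_measure R I <= `|d|%:E)%E.
  move=> mI [J [iJ IE]]; apply: lebesgue_measure_le_diam => //.
  by move: mI; rewrite IE => _ s s'; exact: interval_shift_gap.
case: he => he.
  rewrite leb2_ysection//; apply: integral_le_on_segment => //.
  - exact: measurable_fun_ysection.
  - move=> y; apply: key; first exact: measurable_ysection.
    exists [set x | D (x, y)]; split.
      move=> x1 x2 t /= D1 D2 /andP[h1 h2].
      have [E|ne] := eqVneq x1 x2; first by have -> : t = x1 by lra.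
      have n0 : x2 - x1 != 0 by rewrite subr_eq0 eq_sym.
      have := @cD (x1, y) (x2, y) ((x2 - t) / (x2 - x1)) D1 D2.
      have p0 : 0 < x2 - x1 by rewrite lt_def n0/=; lra.
      have -> : (x2 - t) / (x2 - x1) *: (x1, y) + (1 - (x2 - t) / (x2 - x1)) *: (x2, y) = (t, y).
        by apply/eqP; rewrite xpair_eqE /= /GRing.scale /=; apply/andP; split; apply/eqP; field.
      apply; apply/andP; split; first by apply: divr_ge0; lra.
      by rewrite ler_pdivrMr// mul1r; lra.
    have E x : (x, y) - e = (x - d, y).
      by rewrite he; apply/eqP; rewrite xpair_eqE /= subr0 !eqxx.
    by apply/seteqP; split => x; rewrite /ysection /= inE /= E.
  - move=> y yr; have -> : ysection (D `\` [set x | D (x - e)]) y = set0.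
      apply/seteqP; split => // x; rewrite /ysection /= inE /= => -[/bD [_ /=]].
      by rewrite leNgt yr.
    by rewrite measure0.
rewrite leb2_xsection//; apply: integral_le_on_segment => //.
- exact: measurable_fun_xsection.
- move=> y; apply: key; first exact: measurable_xsection.
  exists [set x | D (y, x)]; split.
    move=> x1 x2 t /= D1 D2 /andP[h1 h2].
    have [E|ne] := eqVneq x1 x2; first by have -> : t = x1 by lra.
    have n0 : x2 - x1 != 0 by rewrite subr_eq0 eq_sym.
    have := @cD (y, x1) (y, x2) ((x2 - t) / (x2 - x1)) D1 D2.
    have p0 : 0 < x2 - x1 by rewrite lt_def n0/=; lra.
    have -> : (x2 - t) / (x2 - x1) *: (y, x1) + (1 - (x2 - t) / (x2 - x1)) *: (y, x2) = (y, t).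
      by apply/eqP; rewrite xpair_eqE /= /GRing.scale /=; apply/andP; split; apply/eqP; field.
    apply; apply/andP; split; first by apply: divr_ge0; lra.
    by rewrite ler_pdivrMr// mul1r; lra.
  have E x : (y, x) - e = (y, x - d).
    by rewrite he; apply/eqP; rewrite xpair_eqE /= subr0 !eqxx.
  by apply/seteqP; split => x; rewrite /xsection /= inE /= E.
- move=> y yr; have -> : xsection (D `\` [set x | D (x - e)]) y = set0.
    apply/seteqP; split => // x; rewrite /xsection /= inE /= => -[/bD [/= + _]].
    by rewrite leNgt yr.
  by rewrite measure0.
Qed.

(** * Lattices and fundamental cells *)

Section torus.
Variables (R : realType) (l1 l2 : R * R).
Hypothesis free : forall a b : R, a *: l1 + b *: l2 = 0 -> a = 0 /\ b = 0.

Let plane_eqP (x y : R * R) : x.1 = y.1 -> x.2 = y.2 -> x = y.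
Proof. by case: x y => ? ? [? ?] /= -> ->. Qed.

Definition basis_det : R := l1.1 * l2.2 - l1.2 * l2.1.
(** The coordinates in the basis (l1, l2), by Cramer's rule. *)
Definition basis_coord (x : R * R) : R * R :=
  ((x.1 * l2.2 - x.2 * l2.1) / basis_det, (l1.1 * x.2 - l1.2 * x.1) / basis_det).

Arguments basis_coord : simpl never.

Lemma basis_det_neq0 : basis_det != 0.
Proof.
apply/eqP => d0; move: (d0); rewrite /basis_det => d0'.
have [e1 e2] : l2.2 = 0 /\ - l1.2 = 0.
  by apply: free; apply: plane_eqP; rewrite /= /GRing.scale /=; lra.
have [e3 e4] : l2.1 = 0 /\ - l1.1 = 0.
  by apply: free; apply: plane_eqP; rewrite /= /GRing.scale /=; lra.
have [] : (1 : R) = 0 /\ (0 : R) = 0.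
  by apply: free; apply: plane_eqP; rewrite /= /GRing.scale /=; lra.
by move/eqP; rewrite oner_eq0.
Qed.

Lemma basis_coordK (x : R * R) : (basis_coord x).1 *: l1 + (basis_coord x).2 *: l2 = x.
Proof.
have := basis_det_neq0; rewrite /basis_coord /basis_det => d0.
by apply: plane_eqP; rewrite /= /GRing.scale /=; field.
Qed.

Lemma basis_coordE (a b : R) : basis_coord (a *: l1 + b *: l2) = (a, b).
Proof.
have := basis_det_neq0; rewrite /basis_coord /basis_det => d0.
by apply: plane_eqP; rewrite /= /GRing.scale /=; field.
Qed.

Lemma basis_coordB (x y : R * R) : basis_coord (x - y) = basis_coord x - basis_coord y.
Proof. by apply: plane_eqP; rewrite /basis_coord /= -mulrBl; congr (_ / _); ring. Qed.

Lemma basis_coord_bound : exists2 M : R, 0 < M & forall x e,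
  `|x.1| <= e -> `|x.2| <= e ->
  `|(basis_coord x).1| <= M * e /\ `|(basis_coord x).2| <= M * e.
Proof.
have d0 := basis_det_neq0; have d0' : 0 < `|basis_det| by rewrite normr_gt0.
pose S := `|l1.1| + `|l1.2| + `|l2.1| + `|l2.2| + 1.
have S0 : 0 < S by rewrite ltr_wpDl// !addr_ge0.
exists (S / `|basis_det|); first by rewrite divr_gt0.
move=> x e x1 x2.
have n1 := normr_ge0 l1.1; have n2 := normr_ge0 l1.2.
have n3 := normr_ge0 l2.1; have n4 := normr_ge0 l2.2.
have key (u v : R) : `|u| + `|v| <= S -> `|x.1 * u - x.2 * v| <= S * e.
  move=> uv; apply: le_trans (ler_normB _ _) _; rewrite !normrM.
  have : `|x.1| * `|u| <= e * `|u| by rewrite ler_wpM2r.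
  have : `|x.2| * `|v| <= e * `|v| by rewrite ler_wpM2r.
  have : e * (`|u| + `|v|) <= e * S by rewrite ler_wpM2l// (le_trans (normr_ge0 _) x1).
  by lra.
rewrite /basis_coord /= !normrM normfV mulrAC; split; rewrite ler_wpM2r ?invr_ge0//.
  by apply: key; rewrite /S; lra.
by rewrite distrC mulrC [l1.1 * _]mulrC; apply: key; rewrite /S; lra.
Qed.

Lemma measurable_basis_coord :
  measurable_fun setT (fun x => (basis_coord x).1) /\
  measurable_fun setT (fun x => (basis_coord x).2).
Proof.
have m1 : measurable_fun [set: R * R] (fun x : R * R => x.1) by exact: measurable_fst.
have m2 : measurable_fun [set: R * R] (fun x : R * R => x.2) by exact: measurable_snd.
by split; apply: measurable_funM => //; apply: measurable_funB; apply: measurable_funM.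
Qed.

Lemma torus_cellE : cell (FlatTorus l1 l2) =
  [set x | 0 <= (basis_coord x).1 < 1 /\ 0 <= (basis_coord x).2 < 1].
Proof.
apply/seteqP; split => x; first by move=> [a [b [ha hb ->]]]; split; rewrite basis_coordE.
move=> [h1 h2]; exists (basis_coord x).1, (basis_coord x).2.
by rewrite basis_coordK.
Qed.

Lemma measurable_torus_cell : measurable (cell (FlatTorus l1 l2)).
Proof.
have [m1 m2] := measurable_basis_coord.
have m0 : measurable_fun [set: R * R] (cst (0 : R)) by [].
have m01 : measurable_fun [set: R * R] (cst (1 : R)) by [].
have := measurable_set_ler measurableT m0 m1.
have := measurable_set_ler measurableT m0 m2.
have := measurable_set_ltr measurableT m1 m01.
have := measurable_set_ltr measurableT m2 m01.
rewrite !setTI => h1 h2 h3 h4.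
have := measurableI _ _ (measurableI _ _ h4 h2) (measurableI _ _ h3 h1).
congr measurable; rewrite torus_cellE; apply/seteqP; split => x /=.
  by move=> [[-> ->] [-> ->]].
by move=> [/andP[-> ->] /andP[-> ->]].
Qed.

Lemma convex_torus_cell : convex_plane (cell (FlatTorus l1 l2)).
Proof.
move=> x y t [a [b [/andP[a0 a1] /andP[b0 b1] ->]]].
move=> [a' [b' [/andP[a'0 a'1] /andP[b'0 b'1] ->]]] /andP[t0 t1].
have key (u w : R) : 0 <= u -> u < 1 -> 0 <= w -> w < 1 -> 0 <= t * u + (1 - t) * w < 1.
  move=> u0 u1 w0 w1; have tu : 0 <= t * u by rewrite mulr_ge0.
  have tw : 0 <= (1 - t) * w by rewrite mulr_ge0// subr_ge0.
  apply/andP; split; first by rewrite addr_ge0.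
  have [uw|wu] := leP u w.
    by have := ler_wpM2l t0 uw; lra.
  have t1' : 0 <= 1 - t by rewrite subr_ge0.
  by have := ler_wpM2l t1' (ltW wu); lra.
exists (t * a + (1 - t) * a'), (t * b + (1 - t) * b'); split.
- exact: key.
- exact: key.
- by apply: plane_eqP; rewrite /= /GRing.scale /=; ring.
Qed.

Lemma torus_cell_in_square : exists2 r : R, 0 < r & in_square (cell (FlatTorus l1 l2)) r.
Proof.
exists (`|l1.1| + `|l1.2| + `|l2.1| + `|l2.2| + 1); first by rewrite ltr_wpDl// !addr_ge0.
move=> x [a [b [/andP[a0 a1] /andP[b0 b1] ->]]] /=; rewrite /GRing.scale /=.
have n1 := normr_ge0 l1.1; have n2 := normr_ge0 l1.2.
have n3 := normr_ge0 l2.1; have n4 := normr_ge0 l2.2.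
have key (u v : R) : `|a * u + b * v| <= `|u| + `|v|.
  apply: le_trans (ler_normD _ _) _; rewrite !normrM (ger0_norm a0) (ger0_norm b0).
  by apply: lerD; rewrite ler_piMl// ltW.
by have := key l1.1 l2.1; have := key l1.2 l2.2; split; lra.
Qed.

Lemma torus_cell_box : exists (p : R * R) (s : R), 0 < s /\
  box (p.1 - s) (p.1 + s) (p.2 - s) (p.2 + s) `<=` cell (FlatTorus l1 l2).
Proof.
have [M M0 bM] := basis_coord_bound.
pose p := (2^-1 : R) *: l1 + (2^-1 : R) *: l2.
(* The coordinates of p are 1 / 2, and they vary by at most 1 / 4 in the box. *)
exists p, (4 * M)^-1; split; first by rewrite invr_gt0 mulr_gt0.
rewrite torus_cellE => -[x1 x2] [] /=; rewrite !in_itv/= => /andP[h1 h2] /andP[h3 h4].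
set x := (x1, x2).
have [] := bM (x - p) (4 * M)^-1.
- by rewrite /= ler_norml; apply/andP; split; move: h1 h2; rewrite /p /=; lra.
- by rewrite /= ler_norml; apply/andP; split; move: h3 h4; rewrite /p /=; lra.
rewrite invfM mulrCA mulfV ?gt_eqF// mulr1.
rewrite basis_coordB {1 2}/p basis_coordE /= !ler_norml => /andP[? ?] /andP[? ?].
by split; apply/andP; split; lra.
Qed.

Lemma torus_latticeE (k : R * R) : lattice (FlatTorus l1 l2) k <->
  exists m n : int, basis_coord k = (m%:~R, n%:~R).
Proof.
split=> [[m [n ->]]|[m [n E]]].
  by exists m, n; rewrite -(scaler_int m l1) -(scaler_int n l2) basis_coordE.
by exists m, n; rewrite -[LHS]basis_coordK E /= !scaler_int.
Qed.

Lemma torus_tiling (x : R * R) : exists2 k, lattice (FlatTorus l1 l2) k &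
  cell (FlatTorus l1 l2) (x - k).
Proof.
pose m := Num.floor (basis_coord x).1; pose n := Num.floor (basis_coord x).2.
exists (l1 *~ m + l2 *~ n); first by exists m, n.
rewrite torus_cellE /mkset basis_coordB -(scaler_int m l1) -(scaler_int n l2) basis_coordE.
have := floor_le (basis_coord x).1; have := floorD1_gt (basis_coord x).1.
have := floor_le (basis_coord x).2; have := floorD1_gt (basis_coord x).2.
rewrite -/m -/n !intrD; clearbody m n; move: (basis_coord x) => c h1 h2 h3 h4 /=.
by split; apply/andP; split; lra.
Qed.

Lemma torus_tiling_uniq (x k : R * R) : lattice (FlatTorus l1 l2) k ->
  cell (FlatTorus l1 l2) x -> cell (FlatTorus l1 l2) (x - k) -> k = 0.
Proof.
move=> /torus_latticeE [m [n kE]].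
rewrite torus_cellE /mkset basis_coordB kE => hx hxk.
suff [m0 n0] : m = 0 /\ n = 0.
  by rewrite -[LHS]basis_coordK kE m0 n0 !mulr0z !scale0r addr0.
move: (basis_coord x) hx hxk => c [/andP[a0 a1] /andP[b0 b1]] /= [/andP[a0' a1'] /andP[b0' b1']].
have int0 (z : int) (u : R) : 0 <= u -> u < 1 -> 0 <= u - z%:~R -> u - z%:~R < 1 -> z = 0.
  move=> u0 u1 uz0 uz1.
  have : (z%:~R : R) < 1%:~R by lra.
  have : ((-1)%:~R : R) < z%:~R by rewrite mulrN1z; lra.
  rewrite !ltr_int -lezD1 addNr => z0 z1; apply/eqP.
  by rewrite eq_le z0 andbT -ltzD1 add0r.
by rewrite (int0 m _ a0)// (int0 n _ b0).
Qed.

Lemma torus_lattice_countable : countable (lattice (FlatTorus l1 l2)).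
Proof.
have -> : lattice (FlatTorus l1 l2) =
   (fun z : int * int => l1 *~ z.1 + l2 *~ z.2) @` setT.
  by apply/seteqP; split => k; [move=> [m [n ->]]; exists (m, n)|move=> [[m n] _ <-]; exists m, n].
by apply: sub_countable (card_image_le _ _) _; exact: countableP.
Qed.

Lemma torus_lattice_ball_finite (M : R) :
  finite_set (lattice (FlatTorus l1 l2) `&` [set k | enorm k <= M]).
Proof.
have [C C0 bC] := basis_coord_bound.
pose B := `|Num.ceil (C * M)|%N.+1.
have fI : finite_set [set z : int | (`|z| < B)%N].
  apply: (@sub_finite_set _ _ ((Posz @` `I_B) `|` ((fun n : nat => - Posz n) @` `I_B))).
    move=> z /= zB; case: (intP z) zB => [|n|n] zB; [left|left|right].
    - by exists 0%N.
    - by exists n.+1.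
    - by exists n.+1 => //; move: zB; rewrite abszN.
  by rewrite finite_setU; split; apply: finite_image; exact: finite_II.
apply: (@sub_finite_set _ _ ((fun z : int * int => l1 *~ z.1 + l2 *~ z.2) @`
  ([set z : int | (`|z| < B)%N] `*` [set z : int | (`|z| < B)%N]))); last first.
  by apply: finite_image; exact: finite_setX.
move=> k [/torus_latticeE [m [n kE]] /= kM]; exists (m, n) => /=; last first.
  by rewrite -[RHS]basis_coordK kE /= !scaler_int.
have [k1 k2] := coord_le_enorm k.
have [] := bC k M (le_trans k1 kM) (le_trans k2 kM); rewrite kE /=.
have key (z : int) : `|z%:~R : R| <= C * M -> (`|z| < B)%N.
  move=> zCM; rewrite /B ltnS -lez_nat !abszE.
  have : (`|z|%:~R : R) <= (Num.ceil (C * M))%:~R.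
    by rewrite intr_norm (le_trans zCM)// ceil_ge.
  by rewrite ler_int => h; apply: le_trans h _; exact: ler_norm.
by move=> /key ? /key ?; split.
Qed.

End torus.

Section domain.
Variables (R : realType) (Om : planar_domain R).
Hypothesis hOm : admissible_domain Om.

Lemma bounded_in_square (D : set (R * R)) : bounded_set D ->
  exists2 r, 0 < r & in_square D r.
Proof.
move=> [M [_ hM]]; exists (`|M| + 1); first by rewrite ltr_wpDl.
move=> x Dx; have M1 : M < `|M| + 1 by rewrite (le_lt_trans (ler_norm _))// ltrDl.
have /= := hM _ M1 x Dx; rewrite prod_normE => h.
by split; apply: le_trans h; rewrite le_max lexx ?orbT.
Qed.

Lemma convex_set_plane (D : set (R * R)) : convex_set D -> convex_plane D.
Proof.
move=> cD x y t Dx Dy /andP[t0 t1].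
have := cD x y (Itv01 t0 t1); rewrite !inE => /(_ Dx Dy).
by [].
Qed.

Lemma cell_measurable : measurable (cell Om).
Proof.
case: Om hOm => [D [oD _ _ _ _]|l1 l2 f]; first exact: open_plane_measurable.
exact: measurable_torus_cell.
Qed.

Lemma cell_convex : convex_plane (cell Om).
Proof.
case: Om hOm => [D [_ _ _ cD _]|l1 l2 f]; first exact: convex_set_plane.
exact: convex_torus_cell.
Qed.

Lemma cell_in_square : exists2 r, 0 < r & in_square (cell Om) r.
Proof.
case: Om hOm => [D [_ _ bD _ _]|l1 l2 f]; first exact: bounded_in_square.
exact: torus_cell_in_square.
Qed.

Lemma cell_box : exists (p : R * R) (s : R), 0 < s /\
  box (p.1 - s) (p.1 + s) (p.2 - s) (p.2 + s) `<=` cell Om.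
Proof.
case: Om hOm => [D [oD [p Dp] _ _ _]|l1 l2 f]; last exact: torus_cell_box.
by have [e e0 he] := nbhs_plane_box oD Dp; exists p, e.
Qed.

Lemma cell_sub_carrier : cell Om `<=` carrier Om.
Proof. by case: Om => [D|l1 l2] x. Qed.

Lemma carrier_open : open (carrier Om).
Proof. by case: Om hOm => [D []//|l1 l2 _]; exact: openT. Qed.

Lemma carrier_measurable : measurable (carrier Om).
Proof. exact: open_plane_measurable carrier_open. Qed.

Lemma carrierD x k : carrier Om x -> lattice Om k -> carrier Om (x + k).
Proof. by case: Om => [D Dx ->|//]; rewrite addr0. Qed.

Lemma carrierB x k : carrier Om x -> lattice Om k -> carrier Om (x - k).
Proof. by move=> Ox Lk; apply: carrierD => //; exact: latticeN. Qed.

Lemma lattice_countable : countable (lattice Om).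
Proof.
case: Om hOm => [D _|l1 l2 f]; last exact: torus_lattice_countable.
by apply: finite_set_countable; exact: finite_set1.
Qed.

Lemma tiling x : carrier Om x -> exists2 k, lattice Om k & cell Om (x - k).
Proof.
case: Om hOm => [D _ Dx|l1 l2 f _]; last exact: torus_tiling.
by exists 0 => //; rewrite subr0.
Qed.

Lemma tiling_uniq x k : lattice Om k -> cell Om x -> cell Om (x - k) -> k = 0.
Proof. by case: Om hOm => [D _ //|l1 l2 f]; exact: torus_tiling_uniq. Qed.

Lemma lattice_ball_finite M : finite_set (lattice Om `&` [set k | enorm k <= M]).
Proof.
case: Om hOm => [D _|l1 l2 f]; last exact: torus_lattice_ball_finite.
by apply: (@sub_finite_set _ _ [set 0]) => // k [].
Qed.

Lemma finite_argmin (T : eqType) (f : T -> R) (s : seq T) (x : T) : x \in s ->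
  exists2 y, y \in s & forall z, z \in s -> f y <= f z.
Proof.
elim: s x => // a s IH x _; case: s IH => [|b s] IH.
  by exists a => [|z]; rewrite ?inE // => /eqP ->.
have [y ys hy] := IH b (mem_head _ _).
have [fa|fa] := leP (f a) (f y).
  exists a => [|z]; first exact: mem_head.
  by rewrite inE => /orP[/eqP ->//|zs]; exact: le_trans fa (hy _ zs).
exists y => [|z]; first by rewrite inE ys orbT.
by rewrite inE => /orP[/eqP ->|zs]; [exact: ltW|exact: hy].
Qed.

(** A lattice vector longer than twice enorm (x - y) does worse than 0, which
    leaves finitely many candidates. *)
Lemma dist_domain_attained x y : exists2 k, lattice Om k &
  dist_domain Om x y = enorm (x - y - k).
Proof.
pose M := enorm (x - y) + enorm (x - y).
have /finite_seqP [s sE] := lattice_ball_finite M.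
have in_s k : k \in s <-> lattice Om k /\ enorm k <= M.
  have -> : (k \in s) = ([set` s] k) :> Prop by [].
  by rewrite -sE.
have s0 : (0 : R * R) \in s.
  by apply/in_s; split; [exact: lattice0|rewrite enorm0 addr_ge0 ?enorm_ge0].
have [k /in_s [Lk _] hk] := finite_argmin (fun k => enorm (x - y - k)) s0.
exists k => //; apply/eqP; rewrite eq_le dist_domain_le//=.
apply: lb_le_inf; first by case: (dist_domain_has_inf Om x y).
move=> _ [k' Lk' <-]; have [k'M|k'M] := leP (enorm k') M.
  by apply: hk; apply/in_s.
apply: le_trans (hk _ s0) _; rewrite subr0.
have := enormD (x - y - k') (- (x - y)); rewrite addrAC subrr add0r !enormN.
by move: k'M; rewrite /M; lra.
Qed.

Lemma dist_domain_eq0 x y : carrier Om x -> carrier Om y ->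
  dist_domain Om x y = 0 -> lattice Om (x - y).
Proof.
move=> Ox Oy d0; have [k Lk] := dist_domain_attained x y; rewrite d0.
move/esym/eqP; rewrite enormE sqrtr_eq0 => h.
have k0 : x - y - k = 0.
  have h1 : (x - y - k).1 ^+ 2 <= 0.
    by apply: le_trans h; rewrite lerDl sqr_ge0.
  have h2 : (x - y - k).2 ^+ 2 <= 0.
    by apply: le_trans h; rewrite lerDr sqr_ge0.
  apply/eqP; rewrite [x - y - k]surjective_pairing xpair_eqE.
  by apply/andP; split; rewrite -sqrf_eq0 eq_le ?h1 ?h2 sqr_ge0.
by move/eqP: k0; rewrite subr_eq0 => /eqP ->.
Qed.

Lemma dist_domain_shiftl x y k : lattice Om k ->
  dist_domain Om (x + k) y = dist_domain Om x y.
Proof.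
move=> Lk; have H u l : lattice Om l -> dist_domain Om (u + l) y <= dist_domain Om u y.
  move=> Ll; have [k' Lk' ->] := dist_domain_attained u y.
  have -> : u - y - k' = u + l - y - (l + k').
    by rewrite opprD addrA [u + l - y]addrAC addrK.
  by apply: dist_domain_le; exact: latticeD.
apply/eqP; rewrite eq_le H//=; have := H (x + k) (- k) (latticeN Lk).
by rewrite addrK.
Qed.

Lemma dist_domain_shiftr x y k : lattice Om k ->
  dist_domain Om x (y + k) = dist_domain Om x y.
Proof. by move=> Lk; rewrite dist_domainC dist_domain_shiftl// dist_domainC. Qed.

Lemma dist_domain_le_enorm x y : dist_domain Om x y <= enorm (x - y).
Proof. by have := dist_domain_le x y (lattice0 Om); rewrite subr0. Qed.

Lemma dist_domain_lipschitz x y z :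
  `|dist_domain Om x z - dist_domain Om y z| <= enorm (x - y).
Proof.
have := dist_domain_triangle Om y x z; have := dist_domain_triangle Om x y z.
have := dist_domain_le_enorm x y; rewrite (dist_domainC Om y x) ler_norml => h1 h2 h3.
by apply/andP; split; lra.
Qed.

Lemma measurable_dist_domain z : measurable_fun [set: R * R] (fun x => dist_domain Om x z).
Proof.
apply: (@lipschitz_measurable R setT _ 1) => [|x y _ _]; first exact: openT.
by rewrite mul1r dist_domain_lipschitz.
Qed.

Lemma measurable_enorm z : measurable_fun [set: R * R] (fun x : R * R => enorm (x - z)).
Proof.
apply: (@lipschitz_measurable R setT _ 1) => [|x y _ _]; first exact: openT.
have := enormD (x - y) (y - z); rewrite addrA subrK.
have := enormD (y - x) (x - z); rewrite addrA subrK -(enormN (y - x)) opprB => h1 h2.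
by rewrite mul1r ler_norml; apply/andP; split; lra.
Qed.

Lemma leb2_cell_lty : (leb2 R (cell Om) < +oo)%E.
Proof.
have [r r0 hr] := cell_in_square.
have sub : cell Om `<=` box (- (r + 1)) (r + 1) (- (r + 1)) (r + 1).
  move=> [x y] /hr /= [h1 h2]; split; rewrite /= in_itv/= -ltr_norml; lra.
apply: (@le_lt_trans _ _ (leb2 R (box (- (r + 1)) (r + 1) (- (r + 1)) (r + 1)))).
  by apply: le_measure => //; rewrite inE; [exact: cell_measurable|exact: measurable_box].
by rewrite leb2_box ?ltry//; lra.
Qed.

Lemma leb2_cell : leb2 R (cell Om) = (area (cell Om))%:E.
Proof. by rewrite /area fineK// ge0_fin_numE ?leb2_cell_lty. Qed.

Lemma area_cell_gt0 : 0 < area (cell Om).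
Proof.
rewrite -lte_fin -leb2_cell; have [p [s [s0 ps]]] := cell_box.
apply: (@lt_le_trans _ _ (leb2 R (box (p.1 - s) (p.1 + s) (p.2 - s) (p.2 + s)))).
  by rewrite leb2_box ?lte_fin ?mulr_gt0//; lra.
by apply: le_measure => //; rewrite inE; [exact: measurable_box|exact: cell_measurable].
Qed.

End domain.

(** * Unfolding of periodic integrals *)

(** An enumeration without repetition; the option type covers finite sets,
    such as the trivial lattice, along with infinite ones. *)
Lemma countable_enum (T : Type) (S : set T) : countable S ->
  exists e : nat -> option T, [/\ forall n a, e n = Some a -> S a,
    forall a, S a -> exists n, e n = Some a &
    forall n m a, e n = Some a -> e m = Some a -> n = m].
Proof.
move=> /countable_injP [f finj].
pose e n := match pselect (exists a, S a /\ f a = n) with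
  | left h => Some (projT1 (cid h)) | right _ => None end.
have eP n a : e n = Some a -> S a /\ f a = n.
  by rewrite /e; case: pselect => // h [<-]; exact: (projT2 (cid h)).
exists e; split => [n a /eP[]//|a Sa|n m a /eP[_ <-] /eP[_ <-]//].
exists (f a); rewrite /e; case: pselect => [h|]; last by case; exists a.
case: (cid h) => b /= [Sb fb]; congr Some.
by apply: finj; rewrite ?inE.
Qed.

Lemma measurable_forall d (T : measurableType d) (I : Type) (F : I -> set T) :
  countable [set: I] -> (forall i, measurable (F i)) ->
  measurable [set x | forall i, F i x].
Proof.
move=> cI mF; have -> : [set x | forall i, F i x] = ~` (\bigcup_i ~` F i).
  apply/seteqP; split => [x Fx [i _]|x Fx i]; first by apply.
  by apply: contrapT => nF; apply: Fx; exists i.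
by apply: measurableC; apply: countable_bigcupT_measurable => // i; exact: measurableC.
Qed.

Lemma countable_bigcup_null d (T : measurableType d) (R : realType)
    (mu : {measure set T -> \bar R}) (I : Type) (S : set I) (F : I -> set T) :
  countable S -> (forall i, S i -> measurable (F i) /\ mu (F i) = 0%E) ->
  measurable (\bigcup_(i in S) F i) /\ mu (\bigcup_(i in S) F i) = 0%E.
Proof.
move=> cS mF; have [e [eS Se _]] := countable_enum cS.
pose G n := if e n is Some a then F a else set0.
have E : \bigcup_(i in S) F i = \bigcup_n G n.
  apply/seteqP; split => x.
    by move=> [i Si Fx]; have [n en] := Se _ Si; exists n => //; rewrite /G en.
  by move=> [n _]; rewrite /G; case en: (e n) => [a|//] Fx; exists a => //; exact: eS en.
have mG n : measurable (G n) /\ mu (G n) = 0%E.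
  rewrite /G; case en: (e n) => [a|]; first by apply: mF; exact: eS en.
  by split; [exact: measurable0|exact: measure0].
rewrite E; split; first by apply: bigcup_measurable => n _; exact: (mG n).1.
apply/eqP; rewrite eq_le measure_ge0 andbT.
apply: le_trans (measure_sigma_subadditive mu (fun n => (mG n).1) _ (@subset_refl _ _)) _.
  by apply: bigcup_measurable => n _; exact: (mG n).1.
by rewrite eseries0// => n _ _; exact: (mG n).2.
Qed.

Section unfolding.
Variables (R : realType) (Om : planar_domain R).
Hypothesis hOm : admissible_domain Om.

(** The image of P in the quotient by the lattice, read in the fundamental
    cell. *)
Definition folded (P : set (R * R)) : set (R * R) :=
  cell Om `&` [set x | exists2 k, lattice Om k & P (x + k)].

Let enum_lattice := countable_enum (lattice_countable hOm).

(** P is cut along the translates F n of the fundamental cell, and the pieces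
    are brought back to the cell as G n. The G n are disjoint as soon as no
    two points of P are equivalent. *)
Lemma folded_pieces (P : set (R * R)) : measurable P -> P `<=` carrier Om ->
  exists F G : (set (R * R))^nat, [/\
    forall n, measurable (F n) /\ measurable (G n),
    P = \bigcup_n F n, trivIset setT F, folded P = \bigcup_n G n &
    (forall n, F n = set0 /\ G n = set0 \/ exists2 k, lattice Om k &
      F n = P `&` [set x | cell Om (x - k)] /\ G n = cell Om `&` [set x | P (x + k)]) /\
    ((forall x k, lattice Om k -> P x -> P (x + k) -> k = 0) -> trivIset setT G)].
Proof.
move=> mP PO; have [e [eS Se einj]] := enum_lattice.
have mc := cell_measurable hOm.
exists (fun n => if e n is Some k then P `&` [set x | cell Om (x - k)] else set0).
exists (fun n => if e n is Some k then cell Om `&` [set x | P (x + k)] else set0).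
split.
- move=> n; case: (e n) => [k|]; last by split; exact: measurable0.
  by split; apply: measurableI => //; [exact: (measurable_preimage_addr (- k) mc)|
    exact: (measurable_preimage_addr k mP)].
- apply/seteqP; split => [x Px|x [n _]]; last by case: (e n) => [k []|].
  have [k Lk ck] := tiling hOm (PO _ Px); have [n en] := Se _ Lk.
  by exists n => //; rewrite en.
- apply/trivIsetP => n m _ _ nm; apply/seteqP; split => // x.
  case en: (e n) => [k|] [] //; case em: (e m) => [l|//] [_ /= ck] [_ /= cl].
  have Lk := eS _ _ en; have Ll := eS _ _ em.
  have : l - k = 0.
    apply: (tiling_uniq hOm _ ck); first by apply: latticeD => //; exact: latticeN.
    by rewrite opprB addrA subrK.
  by move/eqP; rewrite subr_eq0 => /eqP lk; move: nm; rewrite lk in em; rewrite (einj _ _ _ en em) eqxx.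
- apply/seteqP; split => [x [cx [k Lk Px]]|x [n _]].
    by have [n en] := Se _ Lk; exists n => //; rewrite en.
  by case en: (e n) => [k|//] [cx Px]; split => //; exists k => //; exact: eS en.
split.
  move=> n; case en: (e n) => [k|]; last by left.
  by right; exists k => //; exact: eS en.
move=> Pinj; apply/trivIsetP => n m _ _ nm; apply/seteqP; split => // x.
case en: (e n) => [k|] [] //; case em: (e m) => [l|//] [_ /= Pk] [_ /= Pl].
have Lk := eS _ _ en; have Ll := eS _ _ em.
have : l - k = 0.
  apply: (Pinj (x + k)) => //; first by apply: latticeD => //; exact: latticeN.
  by rewrite addrA addrAC addrK.
by move/eqP; rewrite subr_eq0 => /eqP lk; move: nm; rewrite lk in em; rewrite (einj _ _ _ en em) eqxx.
Qed.

Lemma folded_measurable P : measurable P -> P `<=` carrier Om -> measurable (folded P).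
Proof.
move=> mP PO; have [F [G [mFG _ _ -> _]]] := folded_pieces mP PO.
by apply: bigcup_measurable => n _; exact: (mFG n).2.
Qed.

Lemma leb2_folded_le P : measurable P -> P `<=` carrier Om ->
  (leb2 R (folded P) <= leb2 R P)%E.
Proof.
move=> mP PO; have := folded_measurable mP PO.
have [F [G [mFG PE tF fE [FG _]]]] := folded_pieces mP PO.
rewrite fE => mfP; apply: le_trans (measure_sigma_subadditive (leb2 R)
  (fun n => (mFG n).2) mfP (@subset_refl _ _)) _.
have -> : leb2 R P = (\sum_(0 <= n <oo | n \in setT) leb2 R (F n))%E.
  by rewrite {1}PE; apply: measure_bigcup => // n _; exact: (mFG n).1.
rewrite le_eqVlt; apply/orP; left; apply/eqP.
transitivity (\sum_(0 <= n <oo) leb2 R (F n))%E; last first.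
  by apply: eq_eseriesl => n; rewrite in_setT.
apply: eq_eseriesr => n _.
have [[-> ->]//|[k Lk [-> ->]]] := FG n.
rewrite -[RHS](leb2_translation k); last first.
  by apply: measurableI => //; exact: (measurable_preimage_addr (- k) (cell_measurable hOm)).
congr (leb2 R _); apply/seteqP; split => x /= [h1 h2]; split => //.
  by rewrite /= addrK.
by move: h2; rewrite /= addrK.
Qed.

(** Translation of each piece of folded_pieces; g is the same at equivalent
    points. *)
Lemma integral_folded (P : set (R * R)) (g : R * R -> \bar R) :
  measurable P -> P `<=` carrier Om ->
  (forall x k, lattice Om k -> P x -> P (x + k) -> k = 0) ->
  measurable_fun (carrier Om) g -> (forall x, carrier Om x -> 0 <= g x)%E ->
  (forall x k, lattice Om k -> carrier Om x -> g (x + k) = g x) ->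
  (\int[leb2 R]_(x in P) g x = \int[leb2 R]_(x in folded P) g x)%E.
Proof.
move=> mP PO Pinj mg g0 gper.
have cO := @cell_sub_carrier R Om; have mO := carrier_measurable hOm.
have [F [G [mFG PE tF fE [FG tG]]]] := folded_pieces mP PO.
have GO n : G n `<=` carrier Om.
  by have [[_ ->]//|[k Lk [_ ->]]] := FG n; move=> x [/cO].
have FO n : F n `<=` carrier Om.
  by have [[-> _]//|[k Lk [-> _]]] := FG n; move=> x [/PO].
rewrite fE {1}PE !ge0_integral_bigcup//; last first.
- by move=> x [n _ /FO]; exact: g0.
- by apply: measurable_funS mg => // x [n _ /FO].
- by move=> n; exact: (mFG n).1.
- exact: tG.
- by move=> x [n _ /GO]; exact: g0.
- by apply: measurable_funS mg => // x [n _ /GO].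
- by move=> n; exact: (mFG n).2.
apply: eq_eseriesr => n _.
have [[-> ->]//|[k Lk [FE GE]]] := FG n.
rewrite (@ge0_integral_translation R k); last first.
- by move=> x /FO; exact: g0.
- by apply: measurable_funS mg => //; exact: FO.
- exact: (mFG n).1.
have -> : (fun x => x + k) @^-1` F n = G n.
  rewrite FE GE; apply/seteqP; split => x /= [h1 h2]; split => //.
    by move: h2; rewrite /= addrK.
  by rewrite /= addrK.
apply: eq_integral => x /set_mem /GO Ox; exact: gper.
Qed.

(** The ball is contained in the folding of a box of side 2 * rho, and folding
    does not increase areas. *)
Lemma cell_ball_area_le (a : R * R) (rho : R) : 0 <= rho ->
  measurable (cell Om `&` [set x | dist_domain Om x a < rho]) /\
  (leb2 R (cell Om `&` [set x | dist_domain Om x a < rho]%R) <= (4 * rho ^+ 2)%:E)%E.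
Proof.
move=> rho0; have mc := cell_measurable hOm.
have mB : measurable (cell Om `&` [set x | dist_domain Om x a < rho]).
  by apply: measurable_set_ltr => //; apply: (measurable_funS measurableT) => //;
    exact: measurable_dist_domain.
split => //.
pose B := box (a.1 - rho) (a.1 + rho) (a.2 - rho) (a.2 + rho).
have mbox : measurable B by exact: measurable_box.
have mO := carrier_measurable hOm.
have mP : measurable (carrier Om `&` B) by exact: measurableI.
have -> : (4 * rho ^+ 2)%:E = leb2 R B.
  by rewrite leb2_box; [congr EFin; ring|lra|lra].
apply: (@le_trans _ _ (leb2 R (folded (carrier Om `&` B)))).
  apply: le_measure; rewrite ?inE//.
    by apply: folded_measurable => // x [].
  move=> x [cx /=]; have [k Lk ->] := dist_domain_attained hOm x a => h.
  split => //; exists (- k); first exact: latticeN.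
  split; first by apply: carrierB => //; exact: cell_sub_carrier.
  have [] := coord_le_enorm (x - a - k); move: h; case: x {cx} => x1 x2 h /= h1 h2.
  have := le_lt_trans h1 h; have := le_lt_trans h2 h; rewrite !ltr_norml => /andP[? ?] /andP[? ?].
  by split; rewrite /= in_itv/=; apply/andP; split; lra.
apply: le_trans (leb2_folded_le mP _) _; first by move=> x [].
by apply: le_measure; rewrite ?inE.
Qed.

End unfolding.

(** * Voronoi cells *)

Section voronoi_cells.
Variables (R : realType) (Om : planar_domain R) (N : nat) (X : conf Om N).
Hypothesis hOm : admissible_domain Om.
Hypothesis dX : distinct_generators X.

(** The points equidistant from two distinct representatives of generators.
    They form a countable union of lines, and elsewhere strict and weak
    inequalities between distances agree. *)
Definition ties : set (R * R) :=
  [set x | exists i j k l, [/\ lattice Om k, lattice Om l, X i + k != X j + l &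
    enorm (x - (X i + k)) = enorm (x - (X j + l))]].

(** Up to a null set, a set of plane representatives of the Voronoi cell of
    X i that surrounds X i itself, so that no lattice translation is needed to
    compare its points with X i. *)
Definition vcell (i : 'I_N) : set (R * R) :=
  (carrier Om `&` planar_polygon X i) `\` ties.

(** A countable union of bisectors. *)
Lemma ties_null : measurable ties /\ leb2 R ties = 0%E.
Proof.
pose S : set (('I_N * 'I_N) * ((R * R) * (R * R))) :=
  [set: 'I_N * 'I_N] `*` (lattice Om `*` lattice Om).
have cS : countable S.
  by apply: countableX; [exact: countableP|apply: countableX; exact: lattice_countable].
pose F (z : ('I_N * 'I_N) * ((R * R) * (R * R))) : set (R * R) :=
  if X z.1.1 + z.2.1 == X z.1.2 + z.2.2 then set0 else
  [set x | enorm (x - (X z.1.1 + z.2.1)) = enorm (x - (X z.1.2 + z.2.2))].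
have -> : ties = \bigcup_(z in S) F z.
  apply/seteqP; split => x.
    move=> [i [j [k [l [Lk Ll ne E]]]]]; exists ((i, j), (k, l)) => //.
    by rewrite /F /= (negbTE ne).
  move=> [[[i j] [k l]] [_ [/= Lk Ll]]]; rewrite /F /=; case: ifPn => // ne E.
  by exists i, j, k, l.
apply: (@countable_bigcup_null _ _ R (leb2 R) _ S F cS) => // -[[i j] [k l]] _; rewrite /F /=.
case: ifPn => [_|ne]; first by split; [exact: measurable0|exact: measure0].
exact: bisector_null.
Qed.

Lemma tiesD x k : lattice Om k -> ties (x + k) <-> ties x.
Proof.
have H y m : lattice Om m -> ties y -> ties (y + m).
  move=> Lm [i [j [k' [l [Lk Ll ne E]]]]]; exists i, j, (k' + m), (l + m).
  split; [exact: latticeD|exact: latticeD|by rewrite !addrA (inj_eq (addIr _))|].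
  have E2 (z w : R * R) : y + m - (z + (w + m)) = y - (z + w).
    by rewrite addrA opprD addrACA subrr addr0.
  by rewrite !E2.
move=> Lk; split; last exact: H.
by move=> /(H _ _ (latticeN Lk)); rewrite addrK.
Qed.

Lemma vcell_dist i y : vcell i y ->
  enorm (y - X i) = dist_domain Om y (X i) /\
  forall j, j != i -> dist_domain Om y (X i) < dist_domain Om y (X j).
Proof.
move=> [[Oy Py] nt]; have E : enorm (y - X i) = dist_domain Om y (X i).
  apply/eqP; rewrite eq_le dist_domain_le_enorm andbT.
  by have [k Lk ->] := dist_domain_attained hOm y (X i); exact: Py.
split => // j ji; rewrite -E; have [k Lk ->] := dist_domain_attained hOm y (X j).
rewrite lt_neqAle Py// andbT; apply/eqP => EE; apply: nt.
exists i, j, 0, k; split => //; first exact: lattice0.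
  apply/eqP => XX; have := dX ji; have := dist_domain_le (X j) (X i) (latticeN Lk).
  rewrite addr0 in XX; rewrite XX opprK opprD addrA subrr add0r addNr enorm0.
  by rewrite ltNge => ->.
by rewrite addr0 EE opprD addrA.
Qed.

Lemma vcell_sub_carrier i : vcell i `<=` carrier Om.
Proof. by move=> y [[]]. Qed.

Lemma vcell_sub_voronoi i : vcell i `<=` voronoi X i.
Proof. by move=> y vy; split; [exact: vcell_sub_carrier vy|exact: (vcell_dist vy).2]. Qed.

Lemma measurable_polygon i : measurable (planar_polygon X i).
Proof.
have [e [eS Se _]] := countable_enum (lattice_countable hOm).
pose F (z : 'I_N * nat) : set (R * R) := if e z.2 is Some k then
  [set y | enorm (y - X i) <= enorm (y - (X z.1 + k))] else setT.
have -> : planar_polygon X i = [set y | forall z, F z y].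
  apply/seteqP; split => y /=.
    move=> Py [j n]; rewrite /F /=; case en: (e n) => [k|//] /=.
    by rewrite opprD addrA; apply: Py; exact: eS en.
  move=> Fy j k Lk; have [n en] := Se _ Lk; have := Fy (j, n).
  by rewrite /F /= en /= opprD addrA.
apply: measurable_forall => [|[j n]]; first exact: countableP.
rewrite /F /=; case: (e n) => [k|]; last exact: measurableT.
by have := measurable_set_ler measurableT (measurable_enorm (X i)) (measurable_enorm (X j + k));
  rewrite setTI.
Qed.

Lemma measurable_vcell i : measurable (vcell i).
Proof.
apply: measurableD; last exact: ties_null.1.
by apply: measurableI; [exact: carrier_measurable|exact: measurable_polygon].
Qed.

(** If x and x + k are both closest to X i, then x is equidistant from X i and
    from X i - k, which makes it a tie unless k = 0. *)
Lemma vcell_inj i x k : lattice Om k -> vcell i x -> vcell i (x + k) -> k = 0.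
Proof.
move=> Lk [[Ox Px] nt] [[Oxk Pxk] ntk].
have h1 := Px i _ (latticeN Lk); have := Pxk i _ Lk.
have -> : x + k - X i - k = x - X i by rewrite addrAC addrK.
move=> h2; apply/eqP/negPn/negP => k0; apply: nt; exists i, i, 0, (- k); split.
- exact: lattice0.
- exact: latticeN.
- by rewrite (inj_eq (addrI _)) eq_sym oppr_eq0.
- rewrite addr0; apply/eqP; rewrite eq_le opprD opprK addrA; apply/andP; split.
    by move: h1; rewrite opprK.
  by move: h2; rewrite addrAC.
Qed.

(** A lattice translation that brings a point of a Voronoi cell as close to
    X i as possible puts it in the polygon. *)
Lemma folded_vcell i : folded Om (vcell i) = (voronoi X i `&` cell Om) `\` ties.
Proof.
apply/seteqP; split => x.
  move=> [cx [k Lk vx]]; split; last by case: vx => _ nt /tiesD - /(_ _ Lk).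
  split => //; split; first exact: cell_sub_carrier.
  by move=> j ji; have := (vcell_dist vx).2 j ji; rewrite !dist_domain_shiftl.
move=> [[[Ox vx] cx] nt]; split => //.
have [k Lk E] := dist_domain_attained hOm x (X i).
exists (- k); first exact: latticeN.
split; last by move=> /tiesD; apply: contra_not nt; apply; exact: latticeN.
split; first exact: carrierB.
move=> j l Ll; rewrite addrAC -E.
apply: (@le_trans _ _ (dist_domain Om x (X j))).
  by have [->//|ji] := eqVneq j i; exact/ltW/vx.
have -> : x - k - X j - l = x - X j - (k + l) by rewrite opprD addrA [x - k - _]addrAC.
by apply: dist_domain_le; exact: latticeD.
Qed.

Lemma measurable_voronoi i : measurable (voronoi X i).
Proof.
have -> : voronoi X i = carrier Om `&`
   [set x | forall j : 'I_N, (if j == i then setT else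
     [set x | dist_domain Om x (X i) < dist_domain Om x (X j)]) x].
  apply/seteqP; split => x [Ox h]; split => // j; first by case: eqVneq => // ji; exact: h.
  by have := h j; case: eqVneq.
apply: measurableI; first exact: carrier_measurable.
apply: measurable_forall => [|j]; first exact: countableP.
case: eqVneq => _; first exact: measurableT.
by have := measurable_set_ltr measurableT (measurable_dist_domain Om (X i))
  (measurable_dist_domain Om (X j)); rewrite setTI.
Qed.

Section integrals.
Variable g : R * R -> \bar R.
Hypothesis mg : measurable_fun (carrier Om) g.
Hypothesis g0 : (forall x, carrier Om x -> 0 <= g x)%E.
Hypothesis gper : forall x k, lattice Om k -> carrier Om x -> g (x + k) = g x.

Lemma integral_vcell_voronoi i :
  (\int[leb2 R]_(x in vcell i) g x = \int[leb2 R]_(x in voronoi X i `&` cell Om) g x)%E.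
Proof.
rewrite (integral_folded hOm (measurable_vcell i) (@vcell_sub_carrier i)) //; last first.
  by move=> x k; exact: vcell_inj.
rewrite folded_vcell; have [mt t0] := ties_null.
rewrite [RHS](@ge0_negligible_integral _ _ R (leb2 R) _ _ g mt)//.
- by apply: measurableI; [exact: measurable_voronoi|exact: cell_measurable].
- by apply: measurable_funS mg; [exact: carrier_measurable|move=> x [[]]].
- by move=> x [[Ox _] _]; exact: g0.
Qed.

(** Outside of the ties each point has exactly one closest generator. *)
Lemma integral_cell_vcells : (0 < N)%N ->
  (\int[leb2 R]_(x in cell Om) g x = \sum_(i < N) \int[leb2 R]_(x in vcell i) g x)%E.
Proof.
move=> N0; have [mt t0] := ties_null; have mc := cell_measurable hOm.
have mO := carrier_measurable hOm.
rewrite (@ge0_negligible_integral _ _ R (leb2 R) _ _ g mt mc)//; last 2 first.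
- by apply: measurable_funS mg => //; exact: cell_sub_carrier.
- by move=> x /cell_sub_carrier; exact: g0.
have mf i : measurable (folded Om (vcell i)).
  by apply: folded_measurable => //; [exact: measurable_vcell|exact: vcell_sub_carrier].
have fO i : folded Om (vcell i) `<=` carrier Om by move=> x [/cell_sub_carrier].
have -> : cell Om `\` ties = \big[setU/set0]_(i <- enum 'I_N) folded Om (vcell i).
  rewrite -bigcup_seq; apply/seteqP; split => x; last first.
    by move=> [i _]; rewrite folded_vcell => -[[_ cx] nt].
  move=> [cx nt].
  have [i _ hi] := finite_argmin (fun i : 'I_N => dist_domain Om x (X i))
    (mem_index_enum (Ordinal N0)).
  exists i; first by rewrite /= mem_enum.
  split => //; have [k Lk E] := dist_domain_attained hOm x (X i).
  exists (- k); first exact: latticeN.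
  split; last by move=> /tiesD; apply: contra_not nt; apply; exact: latticeN.
  split; first by apply: carrierB => //; exact: cell_sub_carrier.
  move=> j l Ll; rewrite addrAC -E; apply: le_trans (hi j _) _; first by rewrite mem_index_enum.
  have -> : x - k - X j - l = x - X j - (k + l) by rewrite opprD addrA [x - k - _]addrAC.
  by apply: dist_domain_le; exact: latticeD.
have UO : \big[setU/set0]_(i <- enum 'I_N) folded Om (vcell i) `<=` carrier Om.
  by move=> x; rewrite -bigcup_seq => -[i _ /fO].
rewrite ge0_integral_bigsetU//=.
- rewrite big_enum /=; apply: eq_bigr => i _.
  rewrite (integral_folded hOm (measurable_vcell i) (@vcell_sub_carrier i)) //.
  by move=> x k; exact: vcell_inj.
- exact: enum_uniq.
- move=> i j _ _ [x []]; rewrite !folded_vcell => -[[[_ h1] _] _] [[[_ h2] _] _].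
  have [//|ij] := eqVneq i j; have := h1 j; have := h2 i; rewrite ij eq_sym ij => /(_ isT) a /(_ isT) b.
  by have := lt_trans a b; rewrite ltxx.
- by apply: measurable_funS mg.
- by move=> x /UO; exact: g0.
Qed.

End integrals.

End voronoi_cells.

(** * Volumes and centroids of the cells *)

Lemma bounded_integrable (R : realType) (D : set (R * R)) (f : R * R -> R) (M : R) :
  measurable D -> (leb2 R D < +oo)%E -> measurable_fun D f ->
  (forall x, D x -> `|f x| <= M) -> (leb2 R).-integrable D (EFin \o f).
Proof.
move=> mD Doo mf fM; apply: measurable_bounded_integrable => //.
exists M; split; first exact: num_real.
by move=> M' MM' x Dx /=; rewrite (le_trans (fM _ Dx))// ltW.
Qed.

Lemma EFin_Rintegral (R : realType) (D : set (R * R)) (f : R * R -> R) :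
  measurable D -> (leb2 R).-integrable D (EFin \o f) ->
  (\int[leb2 R]_(x in D) (f x)%:E)%E = (\int[leb2 R]_(x in D) f x)%:E.
Proof.
by move=> mD intf; rewrite /Rintegral fineK//; exact: integrable_fin_num intf.
Qed.

Section domain_bound.
Variables (R : realType) (Om : planar_domain R).
Hypothesis hOm : admissible_domain Om.

Lemma dist_domain_bound : exists2 K : R, 0 < K &
  forall x y, carrier Om x -> carrier Om y -> dist_domain Om x y <= K.
Proof.
have [r r0 hr] := cell_in_square hOm; exists (4 * r); first by rewrite mulr_gt0.
move=> x y Ox Oy; have [k Lk ck] := tiling hOm Ox; have [l Ll cl] := tiling hOm Oy.
rewrite -(dist_domain_shiftl hOm x y (latticeN Lk)) -(dist_domain_shiftr hOm _ y (latticeN Ll)).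
apply: le_trans (dist_domain_le_enorm _ _ _) _; apply: le_trans (enorm_le_coord _) _.
have [a1 a2] := hr _ ck; have [b1 b2] := hr _ cl.
have := ler_normB (x - k).1 (y - l).1; have := ler_normB (x - k).2 (y - l).2.
by rewrite /=; lra.
Qed.

End domain_bound.

(** Either the lattice is trivial or the carrier is the whole plane; this is
    all that has to be known about the two kinds of domain to treat their
    centroids together. *)
Lemma displacement_cases (R : realType) (Om : planar_domain R) (N : nat) (X : conf Om N) i :
  lattice Om = [set 0] /\ displacement X i =
    (volume X i)^-1 *: vector_integral (voronoi X i) (fun x => x) - X i \/
  carrier Om = setT /\ displacement X i =
    (volume X i)^-1 *: vector_integral (planar_polygon X i) (fun y => y - X i).
Proof. by case: Om X => [D|l1 l2] X; [left|right]. Qed.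

Section voronoi_volumes.
Variables (R : realType) (Om : planar_domain R) (N : nat) (X : conf Om N).
Hypothesis hOm : admissible_domain Om.
Hypothesis hX : conf_in Om N X.
Hypothesis dX : distinct_generators X.

Lemma leb2_voronoi_lty i : (leb2 R (voronoi X i `&` cell Om) < +oo)%E.
Proof.
apply: le_lt_trans (leb2_cell_lty hOm); apply: le_measure; rewrite ?inE//.
- by apply: measurableI; [exact: measurable_voronoi|exact: cell_measurable].
- exact: cell_measurable.
Qed.

Lemma leb2_voronoi i : leb2 R (voronoi X i `&` cell Om) = (volume X i)%:E.
Proof. by rewrite /volume /area fineK// ge0_fin_numE// leb2_voronoi_lty. Qed.

Lemma leb2_vcell i : leb2 R (vcell X i) = (volume X i)%:E.
Proof.
have mv := @measurable_vcell _ _ _ X hOm i.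
have mV := measurableI _ _ (@measurable_voronoi _ _ _ X hOm i) (cell_measurable hOm).
rewrite -leb2_voronoi -[LHS]mul1e -[RHS]mul1e.
rewrite -(integral_cst (leb2 R) mv) -(integral_cst (leb2 R) mV).
exact: (@integral_vcell_voronoi _ _ _ X hOm dX (cst 1%E)).
Qed.

Lemma volume_ge0 i : 0 <= volume X i.
Proof. by rewrite -lee_fin -leb2_voronoi. Qed.

Lemma leb2_vcell_lty i : (leb2 R (vcell X i) < +oo)%E.
Proof. by rewrite leb2_vcell ltry. Qed.

Lemma integrable_vcell i (f : R * R -> R) (M : R) : measurable_fun (vcell X i) f ->
  (forall y, vcell X i y -> `|f y| <= M) -> (leb2 R).-integrable (vcell X i) (EFin \o f).
Proof.
move=> mf fM; apply: bounded_integrable fM => //; first exact: measurable_vcell.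
exact: leb2_vcell_lty.
Qed.

Lemma Rintegral_cell_vcells (f : R * R -> R) (M : R) : (0 < N)%N ->
  measurable_fun (carrier Om) f -> (forall x, carrier Om x -> 0 <= f x <= M) ->
  (forall x k, lattice Om k -> carrier Om x -> f (x + k) = f x) ->
  \int[leb2 R]_(x in cell Om) f x = \sum_(i < N) \int[leb2 R]_(x in vcell X i) f x.
Proof.
move=> N0 mf f0 fper; have mO := carrier_measurable hOm; have mc := cell_measurable hOm.
have fM x : carrier Om x -> `|f x| <= M.
  by move=> /f0 /andP[a b]; rewrite ger0_norm.
apply: EFin_inj; rewrite -EFin_Rintegral//; last first.
  apply: (@bounded_integrable _ _ _ M) => //; first exact: leb2_cell_lty.
    by apply: measurable_funS mf => //; exact: cell_sub_carrier.
  by move=> x /cell_sub_carrier; exact: fM.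
rewrite (@integral_cell_vcells _ _ _ X hOm dX (EFin \o f))//.
- rewrite -sumEFin; apply: eq_bigr => i _; rewrite -EFin_Rintegral//.
    exact: measurable_vcell.
  apply: (@integrable_vcell _ _ M).
    by apply: measurable_funS mf => //; exact: vcell_sub_carrier.
  by move=> x /vcell_sub_carrier; exact: fM.
- exact/measurable_EFinP.
- by move=> x /f0 /andP[a _]; rewrite lee_fin.
- by move=> x k Lk Ox; rewrite /= fper.
Qed.

Lemma sum_volume : (0 < N)%N -> \sum_(i < N) volume X i = area (cell Om).
Proof.
move=> N0; apply: EFin_inj; rewrite -(leb2_cell hOm) -[RHS]mul1e.
rewrite -(integral_cst (leb2 R) (cell_measurable hOm)).
rewrite (@integral_cell_vcells _ _ _ X hOm dX (cst 1%E))// -sumEFin.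
apply: eq_bigr => i _; rewrite integral_cst ?mul1e ?leb2_vcell//.
exact: measurable_vcell.
Qed.

Lemma diameter_has_sup i : has_sup [set d | exists x y,
  [/\ voronoi X i x, voronoi X i y & d = dist_domain Om x y]].
Proof.
have [K K0 hK] := dist_domain_bound hOm; split; last first.
  by exists K => _ [x [y [[Ox _] [Oy _] ->]]]; exact: hK.
have vi : voronoi X i (X i).
  by split; [exact: hX|move=> j ji; rewrite dist_domainxx dist_domainC; exact: dX].
by exists (dist_domain Om (X i) (X i)), (X i), (X i).
Qed.

Lemma voronoi_dist_le i y : voronoi X i y -> dist_domain Om y (X i) <= max_diameter X.
Proof.
move=> vy; apply: (@le_trans _ _ (diameter Om (voronoi X i))).
  apply: sup_ubound; first by case: (diameter_has_sup i).
  exists y, (X i); split => //; split; first exact: hX.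
  by move=> j ji; rewrite dist_domainxx dist_domainC; exact: dX.
exact: le_bigmax.
Qed.

Lemma vcell_enorm_le i y : vcell X i y -> enorm (y - X i) <= max_diameter X.
Proof.
move=> vy; rewrite (vcell_dist hOm dX vy).1; apply: voronoi_dist_le.
exact: (vcell_sub_voronoi hOm dX vy).
Qed.

Lemma measurable_coord (a : R * R) (D : set (R * R)) :
  measurable_fun D (fun y : R * R => y.1 - a.1) /\
  measurable_fun D (fun y : R * R => y.2 - a.2).
Proof.
by split; apply: measurable_funTS; apply: measurable_funB.
Qed.

Lemma integrable_coord i :
  (leb2 R).-integrable (vcell X i) (EFin \o (fun y : R * R => y.1 - (X i).1)) /\
  (leb2 R).-integrable (vcell X i) (EFin \o (fun y : R * R => y.2 - (X i).2)).
Proof.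
have [m1 m2] := measurable_coord (X i) (vcell X i).
split; apply: (@integrable_vcell _ _ (max_diameter X)) => // y vy.
  by apply: le_trans (vcell_enorm_le vy); have [] := coord_le_enorm (y - X i).
by apply: le_trans (vcell_enorm_le vy); have [] := coord_le_enorm (y - X i).
Qed.

Lemma Rintegral_vcell_null i (A : set (R * R)) (f : R * R -> R) :
  measurable A -> A `\` ties X = vcell X i -> measurable_fun A f ->
  (exists M, forall x, A x -> `|f x| <= M) ->
  \int[leb2 R]_(y in A) f y = \int[leb2 R]_(y in vcell X i) f y.
Proof.
move=> mA AE mf [M fM]; have [mt t0] := ties_null X hOm.
have Aoo : (leb2 R A < +oo)%E.
  apply: (@le_lt_trans _ _ (leb2 R (vcell X i `|` ties X))).
    apply: le_measure; rewrite ?inE//.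
      by apply: measurableU => //; exact: measurable_vcell.
    by move=> x Ax; have [t|t] := pselect (ties X x); [right|left; rewrite -AE].
  apply: (@le_lt_trans _ _ (leb2 R (vcell X i) + leb2 R (ties X))%E).
    by apply: measureU2 => //; exact: measurable_vcell.
  by rewrite [X in (_ + X)%E]t0 adde0 leb2_vcell_lty.
rewrite /Rintegral (@negligible_integral _ _ R (leb2 R) _ _ _ mt mA _ t0) ?AE//.
exact: bounded_integrable fM.
Qed.

(** Both definitions of the centroid amount to an integral over the same set
    vcell, on which the energy is computed as well. *)
Lemma volume_displacement i : 0 < volume X i ->
  volume X i * (displacement X i).1 = \int[leb2 R]_(y in vcell X i) (y.1 - (X i).1) /\
  volume X i * (displacement X i).2 = \int[leb2 R]_(y in vcell X i) (y.2 - (X i).2).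
Proof.
move=> V0; have Vn : volume X i != 0 by rewrite gt_eqF.
have mO := carrier_measurable hOm.
have [K K0 hK] := dist_domain_bound hOm.
have mv := @measurable_vcell _ _ _ X hOm i.
have [m1 m2] := measurable_coord (X i) (carrier Om).
have [i1 i2] := integrable_coord i.
have PB y : (carrier Om `&` planar_polygon X i) y -> enorm (y - X i) <= K.
  move=> [Oy Py]; apply: le_trans (hK _ _ Oy (hX i)).
  by have [k Lk ->] := dist_domain_attained hOm y (X i); exact: Py.
have mP : measurable (carrier Om `&` planar_polygon X i).
  by apply: measurableI => //; exact: measurable_polygon.
have key (A : set (R * R)) : measurable A -> A `\` ties X = vcell X i ->
    A `<=` carrier Om -> (exists M, forall y, A y -> enorm (y - X i) <= M) ->
    \int[leb2 R]_(y in A) (y.1 - (X i).1) = \int[leb2 R]_(y in vcell X i) (y.1 - (X i).1) /\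
    \int[leb2 R]_(y in A) (y.2 - (X i).2) = \int[leb2 R]_(y in vcell X i) (y.2 - (X i).2).
  move=> mA AE AO [M AM]; split; apply: Rintegral_vcell_null => //.
  - exact: measurable_funS m1.
  - by exists M => y /AM; apply: le_trans; have [] := coord_le_enorm (y - X i).
  - exact: measurable_funS m2.
  - by exists M => y /AM; apply: le_trans; have [] := coord_le_enorm (y - X i).
have [kP1 kP2] : \int[leb2 R]_(y in carrier Om `&` planar_polygon X i) (y.1 - (X i).1) =
    \int[leb2 R]_(y in vcell X i) (y.1 - (X i).1) /\
    \int[leb2 R]_(y in carrier Om `&` planar_polygon X i) (y.2 - (X i).2) =
    \int[leb2 R]_(y in vcell X i) (y.2 - (X i).2).
  by apply: key => //; exists K.
have [[L0 ->]|[OT ->]] := displacement_cases X i; last first.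
  rewrite /vector_integral /= !mulrA mulfV// !mul1r.
  by move: kP1 kP2; rewrite OT !setTI => -> ->.
have dE x y : dist_domain Om x y = enorm (x - y).
  by have [k] := dist_domain_attained hOm x y; rewrite L0 => -> ->; rewrite subr0.
have VE : voronoi X i `\` ties X = vcell X i.
  apply/seteqP; split => y; last first.
    by move=> vy; split; [exact: (vcell_sub_voronoi hOm dX vy)|case: vy].
  move=> [[Oy vy] nt]; split => //; split => // j k; rewrite L0 => ->; rewrite subr0 -!dE.
  by have [->//|ji] := eqVneq j i; exact/ltW/vy.
have mV := @measurable_voronoi _ _ _ X hOm i.
have VK y : voronoi X i y -> enorm (y - X i) <= K.
  by move=> [Oy _]; rewrite -dE; exact: hK.
rewrite /vector_integral /= !mulrBr !mulrA mulfV// !mul1r.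
have coordE (f : R * R -> R) : measurable_fun [set: R * R] f ->
    (forall y a, `|f y - f a| <= enorm (y - a)) ->
    \int[leb2 R]_(y in voronoi X i) f y - volume X i * f (X i) =
    \int[leb2 R]_(y in vcell X i) (f y - f (X i)).
  move=> mf fE; have fK y : voronoi X i y -> `|f y| <= K + `|f (X i)|.
    move=> vy; have := VK _ vy; have := fE y (X i).
    by have := ler_normD (f y - f (X i)) (f (X i)); rewrite subrK; lra.
  rewrite (Rintegral_vcell_null mV VE); last 2 first.
  - exact: measurable_funTS.
  - by exists (K + `|f (X i)|).
  rewrite RintegralB//.
  - congr (_ - _).
    by rewrite Rintegral_cst// leb2_vcell mulrC.
  - apply: (@integrable_vcell _ _ (K + `|f (X i)|)); first exact: measurable_funTS.
    by move=> y vy; apply: fK; exact: (vcell_sub_voronoi hOm dX vy).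
  - by apply: (@integrable_vcell _ _ `|f (X i)|).
split; apply: coordE => //.
- by move=> y a; have [] := coord_le_enorm (y - a).
- by move=> y a; have [] := coord_le_enorm (y - a).
Qed.

End voronoi_volumes.

(** * The energy and its minimizers *)

Definition cost (R : realType) (Om : planar_domain R) (N : nat) (X : conf Om N)
    (x : R * R) : R :=
  inf [set dist_domain Om x (X i) ^+ 2 | i in [set: 'I_N]].

Section energy.
Variables (R : realType) (Om : planar_domain R) (N : nat).
Hypothesis hOm : admissible_domain Om.
Hypothesis N0 : (0 < N)%N.
Implicit Types X Y : conf Om N.

Lemma cost_le X x i : cost X x <= dist_domain Om x (X i) ^+ 2.
Proof.
apply: ge_inf; last by exists i.
by exists 0 => _ [j _ <-]; exact: sqr_ge0.
Qed.

Lemma cost_attained X x : exists i, cost X x = dist_domain Om x (X i) ^+ 2 /\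
  forall j, dist_domain Om x (X i) <= dist_domain Om x (X j).
Proof.
have [i _ hi] := finite_argmin (fun i : 'I_N => dist_domain Om x (X i))
  (mem_index_enum (Ordinal N0)).
have {}hi j : dist_domain Om x (X i) <= dist_domain Om x (X j) by apply: hi; rewrite mem_index_enum.
exists i; split => //; apply/eqP; rewrite eq_le cost_le /=; apply: lb_le_inf.
  by exists (dist_domain Om x (X i) ^+ 2), i.
by move=> _ [j _ <-]; rewrite lerXn2r ?nnegrE ?dist_domain_ge0.
Qed.

Lemma cost_ge0 X x : 0 <= cost X x.
Proof. by have [i [-> _]] := cost_attained X x; exact: sqr_ge0. Qed.

Lemma costD X x k : lattice Om k -> cost X (x + k) = cost X x.
Proof.
move=> Lk; rewrite /cost; congr inf; apply/seteqP; split => _ [i _ <-]; exists i => //;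
  by rewrite dist_domain_shiftl.
Qed.

Lemma measurable_cost X : measurable_fun [set: R * R] (cost X).
Proof.
pose m x := Num.sqrt (cost X x).
have -> : cost X = (fun x => m x ^+ 2).
  by apply/funext => x; rewrite sqr_sqrtr// cost_ge0.
apply: measurable_funX; apply: (@lipschitz_measurable R setT _ 1) => [|x y _ _]; first exact: openT.
have H u w : m u <= m w + enorm (u - w).
  have [i [Ew _]] := cost_attained X w; have [j [Eu hj]] := cost_attained X u.
  rewrite /m Ew Eu !sqrtr_sqr !ger0_norm ?dist_domain_ge0//.
  apply: le_trans (hj i) _; have := dist_domain_lipschitz Om u w (X i).
  by have := ler_norm (dist_domain Om u (X i) - dist_domain Om w (X i)); lra.
have := H x y; have := H y x; rewrite -[enorm (y - x)]enormN opprB => h1 h2.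
by rewrite mul1r ler_norml; apply/andP; split; lra.
Qed.

Lemma cost_bound X : conf_in Om N X -> exists M, forall x, carrier Om x -> cost X x <= M.
Proof.
move=> hX; have [K K0 hK] := dist_domain_bound hOm; exists (K ^+ 2) => x Ox.
apply: le_trans (cost_le X x (Ordinal N0)) _.
by rewrite lerXn2r ?nnegrE ?dist_domain_ge0 ?hK// ltW.
Qed.

Lemma integrable_cost X : conf_in Om N X -> (leb2 R).-integrable (cell Om) (EFin \o cost X).
Proof.
move=> /cost_bound [M hM]; apply: (@bounded_integrable _ _ _ M).
- exact: cell_measurable.
- exact: leb2_cell_lty.
- by apply: measurable_funTS; exact: measurable_cost.
- by move=> x /cell_sub_carrier Ox; rewrite ger0_norm ?cost_ge0 ?hM.
Qed.

Lemma EFin_energy X : conf_in Om N X ->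
  (energy X)%:E = (\int[leb2 R]_(x in cell Om) (cost X x)%:E)%E.
Proof. by move=> hX; rewrite EFin_Rintegral//; [exact: cell_measurable|exact: integrable_cost]. Qed.

Lemma energy_vcells X Y : conf_in Om N Y -> distinct_generators X ->
  energy Y = \sum_(i < N) \int[leb2 R]_(x in vcell X i) cost Y x.
Proof.
move=> hY dX; have [M hM] := cost_bound hY.
apply: (Rintegral_cell_vcells hOm dX (M := M)) => //.
- by apply: measurable_funTS; exact: measurable_cost.
- by move=> x Ox; rewrite cost_ge0 hM.
- by move=> x k Lk Ox; exact: costD.
Qed.

Lemma cost_vcell X i y : distinct_generators X -> vcell X i y ->
  cost X y = enorm (y - X i) ^+ 2.
Proof.
move=> dX vy; have [E h] := vcell_dist hOm dX vy.
have [j [-> hj]] := cost_attained X y; rewrite E.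
have [->//|ji] := eqVneq j i.
by have := h j ji; rewrite ltNge hj.
Qed.

Lemma enorm_sqr (x : R * R) : enorm x ^+ 2 = x.1 ^+ 2 + x.2 ^+ 2.
Proof. by rewrite enormE sqr_sqrtr ?addr_ge0 ?sqr_ge0. Qed.

(** On the cell of X i, the cost of Y is at most the squared distance to Y i;
    expanding this square around X i makes the centroid appear. *)
Lemma energy_semiconcave X Y : conf_in Om N X -> conf_in Om N Y -> distinct_generators X ->
  (forall i, 0 < volume X i) ->
  energy Y - energy X <= \sum_(i < N) volume X i *
    (enorm (Y i - X i) ^+ 2 - 2 * dot (Y i - X i) (displacement X i)).
Proof.
move=> hX hY dX V0; rewrite (energy_vcells hX dX) (energy_vcells hY dX) -sumrB.
apply: ler_sum => i _; have mv := @measurable_vcell _ _ _ X hOm i.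
have [M1 hM1] := cost_bound hY; have [M2 hM2] := cost_bound hX.
have iY : (leb2 R).-integrable (vcell X i) (EFin \o cost Y).
  apply: (integrable_vcell hOm dX (M := M1)); first by apply: measurable_funTS; exact: measurable_cost.
  by move=> y /vcell_sub_carrier Oy; rewrite ger0_norm ?cost_ge0 ?hM1.
have iX : (leb2 R).-integrable (vcell X i) (EFin \o cost X).
  apply: (integrable_vcell hOm dX (M := M2)); first by apply: measurable_funTS; exact: measurable_cost.
  by move=> y /vcell_sub_carrier Oy; rewrite ger0_norm ?cost_ge0 ?hM2.
rewrite -RintegralB//.
have [i1 i2] := integrable_coord hOm hX dX i.
have [d1 d2] := volume_displacement hOm hX dX (V0 i).
pose a := Y i - X i.
have ic : (leb2 R).-integrable (vcell X i) (EFin \o (fun=> enorm a ^+ 2)).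
  by apply: (integrable_vcell hOm dX (M := `|enorm a ^+ 2|)).
have iZ1 : (leb2 R).-integrable (vcell X i) (EFin \o (fun y => (2 * a.1) * (y.1 - (X i).1))).
  exact: (@integrableZl _ _ _ (leb2 R) _ mv (2 * a.1) _ i1).
have iZ2 : (leb2 R).-integrable (vcell X i) (EFin \o (fun y => (2 * a.2) * (y.2 - (X i).2))).
  exact: (@integrableZl _ _ _ (leb2 R) _ mv (2 * a.2) _ i2).
have -> : volume X i * (enorm a ^+ 2 - 2 * dot a (displacement X i)) =
    \int[leb2 R]_(y in vcell X i) (enorm a ^+ 2 - (2 * a.1) * (y.1 - (X i).1) - (2 * a.2) * (y.2 - (X i).2)).
  rewrite RintegralB//; last exact: (@integrableB _ _ _ (leb2 R) _ mv _ _ ic iZ1).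
  rewrite RintegralB// Rintegral_cst// !RintegralZl// -d1 -d2 leb2_vcell// /dot.
  by rewrite /=; ring.
apply: le_Rintegral => //.
- exact: (@integrableB _ _ _ (leb2 R) _ mv _ _ iY iX).
- exact: (@integrableB _ _ _ (leb2 R) _ mv _ _ (@integrableB _ _ _ (leb2 R) _ mv _ _ ic iZ1) iZ2).
move=> y vy; rewrite (cost_vcell dX vy).
have := cost_le Y y i; have := dist_domain_le_enorm Om y (Y i).
have := dist_domain_ge0 Om y (Y i); move=> h0 h1 h2.
have h3 : dist_domain Om y (Y i) ^+ 2 <= enorm (y - Y i) ^+ 2.
  by rewrite lerXn2r ?nnegrE// enorm_ge0.
have : cost Y y <= enorm (y - Y i) ^+ 2 by exact: le_trans h2 h3.
by rewrite !enorm_sqr /a /=; lra.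
Qed.

(** The constant comes from convex_area_near after moving a into the
    fundamental cell. *)
Lemma cell_area_near (rho0 : R) : 0 < rho0 -> exists2 c : R, 0 < c &
  forall a rho, carrier Om a -> 0 < rho -> rho <= rho0 ->
    ((c * rho ^+ 2)%:E <= leb2 R (cell Om `&` [set x | dist_domain Om x a < rho]%R))%E.
Proof.
move=> rho00; have [r r0 hr] := cell_in_square hOm; have [p [s [s0 ps]]] := cell_box hOm.
have mc := cell_measurable hOm.
have [c c0 hc] := convex_area_near mc (cell_convex hOm) hr s0 rho00 ps.
exists c => // a rho Oa h0 h1; have [k Lk ck] := tiling hOm Oa.
apply: le_trans (hc _ _ ck h0 h1) _; apply: le_measure; rewrite ?inE//.
- by apply: measurable_set_ltr => //; apply: (measurable_funS measurableT) => //; exact: measurable_enorm.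
- by have [] := cell_ball_area_le hOm a (ltW h0).
- move=> x [cx /= h]; split => //=; rewrite -(dist_domain_shiftr hOm _ _ (latticeN Lk)).
  exact: le_lt_trans (dist_domain_le_enorm _ _ _) h.
Qed.

Lemma mesh_size_gt0 : 0 < mesh_size Om N.
Proof. by rewrite /mesh_size sqrtr_gt0 divr_gt0 ?area_cell_gt0// ltr0n. Qed.

Lemma mesh_size_sqr : mesh_size Om N ^+ 2 * N%:R = area (cell Om).
Proof.
rewrite /mesh_size sqr_sqrtr; last by rewrite divr_ge0// ltW// area_cell_gt0.
by rewrite divfK// pnatr_eq0 -lt0n.
Qed.

Lemma mesh_size_le : mesh_size Om N <= Num.sqrt (area (cell Om)).
Proof.
apply: ler_wsqrtr; rewrite ler_pdivrMr ?ltr0n//.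
by rewrite ler_peMr ?ler1n// ltW// area_cell_gt0.
Qed.

(** The N balls of radius h / 3 around the generators have total area at most
    4 / 9 of that of the domain. *)
Lemma exists_far_point X : exists2 z, cell Om z &
  forall i, mesh_size Om N / 3 <= dist_domain Om z (X i).
Proof.
set h := mesh_size Om N; have h0 : 0 < h := mesh_size_gt0.
apply: contrapT => H.
pose B i := cell Om `&` [set x | dist_domain Om x (X i) < h / 3].
have h3 : 0 <= h / 3 by rewrite divr_ge0// ltW.
have sub : cell Om `<=` \big[setU/set0]_(i <- index_enum 'I_N) B i.
  move=> x cx; rewrite -bigcup_seq; apply: contrapT => nB; apply: H; exists x => // i.
  rewrite leNgt; apply/negP => lt; apply: nB; exists i => //=; exact: mem_index_enum.
have mB i : measurable (B i) by have [] := cell_ball_area_le hOm (X i) h3.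
have mU : measurable (\big[setU/set0]_(i <- index_enum 'I_N) B i).
  by apply: bigsetU_measurable => i _.
have : (leb2 R (cell Om) <= \sum_(i < N) leb2 R (B i))%E.
  apply: le_trans (_ : leb2 R (\big[setU/set0]_(i <- index_enum 'I_N) B i) <= _)%E.
    by apply: le_measure; rewrite ?inE//; exact: cell_measurable.
  elim: (index_enum _) => [|i s IH]; first by rewrite !big_nil measure0.
  have mbs : measurable (\big[setU/set0]_(i <- s) B i) by apply: bigsetU_measurable => j _.
  rewrite !big_cons; apply: (@le_trans _ _ (leb2 R (B i) + leb2 R (\big[setU/set0]_(i <- s) B i))%E).
    by apply: measureU2 => //; exact: mB.
  exact: leeD.
rewrite leNgt => /negP; apply.
apply: (@le_lt_trans _ _ (\sum_(i < N) (4 * (h / 3) ^+ 2)%:E)%E).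
  by apply: lee_sum => i _; have [] := cell_ball_area_le hOm (X i) h3.
rewrite sumEFin leb2_cell// lte_fin sumr_const card_ord -(mulr_natr (4 * (h / 3) ^+ 2) N).
have := mesh_size_sqr; rewrite -/h => hN; have := area_cell_gt0 hOm.
have -> : 4 * (h / 3) ^+ 2 * N%:R = 4 / 9 * (h ^+ 2 * N%:R) by field.
by rewrite hN => a0; lra.
Qed.

End energy.

(** * Separation of the generators of a minimizer *)

Section separation.
Variables (R : realType) (Om : planar_domain R) (N : nat).
Hypothesis hOm : admissible_domain Om.
Hypothesis N0 : (0 < N)%N.
Variable C1 : R.
Hypothesis C1_gt0 : 0 < C1.
Let h := mesh_size Om N.
Let h_gt0 : 0 < h := mesh_size_gt0 hOm N0.
Implicit Types X Y : conf Om N.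

Lemma volume_le Y i : conf_in Om N Y -> distinct_generators Y -> max_diameter Y <= C1 * h ->
  volume Y i <= 16 * C1 ^+ 2 * h ^+ 2.
Proof.
move=> hY dY DY; have Ch : 0 < C1 * h by rewrite mulr_gt0.
rewrite -lee_fin -(leb2_voronoi Y hOm).
(* The balls of cell_ball_area_le are open, whence the factor 2. *)
have r0 : 0 <= 2 * (C1 * h) by rewrite mulr_ge0// ltW.
have [mB le] := cell_ball_area_le hOm (Y i) r0.
have -> : 16 * C1 ^+ 2 * h ^+ 2 = 4 * (2 * (C1 * h)) ^+ 2 by ring.
apply: le_trans le; apply: le_measure; rewrite ?inE//.
  by apply: measurableI; [exact: measurable_voronoi|exact: cell_measurable].
move=> x [vx cx]; split => //=.
by apply: le_lt_trans (voronoi_dist_le hOm hY dY vx) _; lra.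
Qed.

Lemma integral_cell_indic (A : set (R * R)) (k : R) : 0 <= k -> measurable A -> A `<=` cell Om ->
  (\int[leb2 R]_(x in cell Om) (k * \1_A x)%:E = k%:E * leb2 R A)%E.
Proof.
move=> k0 mA Ac; have mc := cell_measurable hOm.
transitivity (\int[leb2 R]_(x in cell Om) (k%:E * (\1_A x)%:E))%E.
  by apply: eq_integral => x _; rewrite EFinM.
rewrite ge0_integralZl_EFin//; last exact/measurable_EFinP.
by rewrite integral_indic// (setIidl Ac).
Qed.

Variable c : R.
Hypothesis c_gt0 : 0 < c.
Hypothesis area_near : forall a rho, carrier Om a -> 0 < rho ->
  rho <= Num.sqrt (area (cell Om)) ->
  ((c * rho ^+ 2)%:E <= leb2 R (cell Om `&` [set x | dist_domain Om x a < rho]%R))%E.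

(** The distance, in units of h, below which the relocation analysed in
    relocated_cost_le is profitable. The factors 18 and 144 come from the gain
    and the radius of the ball where it takes place, 16 * C1 ^+ 2 from
    volume_le; the minimum with 1 settles the case of distances larger than h. *)
Definition separation_const : R := Num.min 1 (c / (18 * 144 * 16 * C1 ^+ 2 * (2 * C1 + 1))).

Lemma separation_const_gt0 : 0 < separation_const.
Proof.
rewrite lt_min ltr01 /= divr_gt0// mulr_gt0 ?mulr_gt0 ?exprn_gt0//.
by rewrite addr_gt0// mulr_gt0.
Qed.

(** Near z the new generator, at distance at most h / 12, replaces one at
    distance at least h / 4. On the cell of Y i the points may be assigned to
    Y j, whose distance exceeds that of Y i by at most the distance between
    the two. Elsewhere the closest generator is still there. *)
Lemma relocated_cost_le Y i j z x : conf_in Om N Y -> distinct_generators Y ->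
  max_diameter Y <= C1 * h -> j != i ->
  (forall l, h / 3 <= dist_domain Om z (Y l)) -> cell Om x ->
  cost ((fun l => if l == i then z else Y l) : conf Om N) x +
    h ^+ 2 / 18 * \1_(cell Om `&` [set x | dist_domain Om x z < h / 12]) x <=
  cost Y x + (2 * (C1 * h) * dist_domain Om (Y i) (Y j) + dist_domain Om (Y i) (Y j) ^+ 2) *
    \1_(voronoi Y i `&` cell Om) x.
Proof.
move=> hY dY DY ji hz cx; set Z : conf Om N := fun l => _.
set d := dist_domain Om (Y i) (Y j).
have Ch : 0 < C1 * h by rewrite mulr_gt0.
have d0 : 0 <= d by exact: dist_domain_ge0.
have K0 : 0 <= 2 * (C1 * h) * d + d ^+ 2.
  by rewrite addr_ge0 ?sqr_ge0// !mulr_ge0// ltW.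
have [l [El hl]] := cost_attained N0 Y x.
rewrite !indicE; have [xB|xB] := boolP (x \in cell Om `&` _).
  have {}xB : dist_domain Om x z < h / 12 by move: xB; rewrite inE => -[].
  have := cost_le Z x i; rewrite /Z /= eqxx -/Z => hZ.
  have dxz := dist_domain_ge0 Om x z.
  have hf : h / 4 <= dist_domain Om x (Y l).
    have := dist_domain_triangle Om x z (Y l); rewrite (dist_domainC Om z x).
    by have := hz l; lra.
  have s1 : dist_domain Om x z ^+ 2 <= (h / 12) ^+ 2.
    by rewrite lerXn2r ?nnegrE ?(ltW xB)// divr_ge0// ltW.
  have s2 : (h / 4) ^+ 2 <= dist_domain Om x (Y l) ^+ 2.
    by rewrite lerXn2r ?nnegrE ?dist_domain_ge0// divr_ge0// ltW.
  rewrite mulr1 El; apply: (@le_trans _ _ (dist_domain Om x (Y l) ^+ 2)); last first.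
    by rewrite lerDl; case: (_ \in _); rewrite ?mulr1 ?mulr0.
  have E1 : (h / 12) ^+ 2 = h ^+ 2 / 144 by field.
  have E2 : (h / 4) ^+ 2 = h ^+ 2 / 16 by field.
  by rewrite E1 in s1; rewrite E2 in s2; lra.
rewrite mulr0 addr0.
have other m : m != i -> dist_domain Om x (Y m) <= dist_domain Om x (Y l) ->
    cost Z x <= cost Y x.
  move=> mi ml; apply: le_trans (cost_le Z x m) _; rewrite /Z (negbTE mi) El.
  by rewrite lerXn2r ?nnegrE ?dist_domain_ge0.
have [li|li] := eqVneq l i; last first.
  apply: le_trans (other l li (lexx _)) _.
  by rewrite lerDl; case: (_ \in _); rewrite ?mulr1 ?mulr0.
have [xV|xV] := boolP (x \in voronoi Y i `&` cell Om).
  have {}xV : voronoi Y i x by move: xV; rewrite inE => -[].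
  have xi := voronoi_dist_le hOm hY dY xV.
  apply: le_trans (cost_le Z x j) _; rewrite /Z (negbTE ji) mulr1 El li.
  have tri := dist_domain_triangle Om (Y i) x (Y j); rewrite -/d in tri.
  have := dist_domain_ge0 Om x (Y i); have := dist_domain_ge0 Om x (Y j).
  move: (dist_domain Om x (Y i)) (dist_domain Om x (Y j)) xi tri => u w xi tri w0 u0.
  have s1 : w ^+ 2 <= (u + d) ^+ 2 by rewrite lerXn2r ?nnegrE// addr_ge0.
  have s2 : u * d <= C1 * h * d by rewrite ler_wpM2r// (le_trans xi).
  have E : (u + d) ^+ 2 = u ^+ 2 + 2 * (u * d) + d ^+ 2 by ring.
  by rewrite E in s1; lra.
rewrite mulr0 addr0; apply: contrapT => /negP; rewrite -ltNge => lt.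
move/negP: xV; apply; rewrite inE; split => //; split; first exact: cell_sub_carrier.
move=> m mi; rewrite ltNge; apply/negP => mle.
by move: lt; rewrite ltNge (other m mi) ?li.
Qed.

(** Moving Y i to a point far from all generators does not lower the energy.
    Integrating relocated_cost_le, the gain is at least of order h ^+ 4 and
    the loss at most of order h ^+ 3 times the distance of Y i and Y j. *)
Lemma minimizer_separation Y i j : minimizers Om N Y -> distinct_generators Y ->
  max_diameter Y <= C1 * h -> i != j ->
  separation_const * h <= dist_domain Om (Y i) (Y j).
Proof.
move=> [hY minY] dY DY ij; set d := dist_domain Om (Y i) (Y j).
have d0 : 0 <= d by exact: dist_domain_ge0.
have [dh|hd] := leP h d.
  apply: le_trans dh; apply: ler_piMl; [exact: ltW|by rewrite /separation_const ge_min lexx].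
have [z cz hz] := exists_far_point hOm N0 Y.
have ji : j != i by rewrite eq_sym.
pose Z : conf Om N := fun l => if l == i then z else Y l.
have hZ : conf_in Om N Z.
  by move=> l; rewrite /Z; case: ifP => _; [exact: cell_sub_carrier|exact: hY].
pose B := cell Om `&` [set x | dist_domain Om x z < h / 12].
pose V := voronoi Y i `&` cell Om.
pose K := 2 * (C1 * h) * d + d ^+ 2.
have K0 : 0 <= K by rewrite addr_ge0 ?sqr_ge0// !mulr_ge0// ltW.
have h12 : 0 < h / 12 by rewrite divr_gt0.
have mc := cell_measurable hOm.
have mB : measurable B by have [] := cell_ball_area_le hOm z (ltW h12).
have mV : measurable V by apply: measurableI => //; exact: measurable_voronoi.
have h2 : 0 <= h ^+ 2 / 18 by rewrite divr_ge0// sqr_ge0.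
have mcost (W : conf Om N) : measurable_fun (cell Om) (fun x => (cost W x)%:E).
  by apply/measurable_EFinP; apply: measurable_funTS; apply: measurable_cost.
have mind (A : set (R * R)) (k : R) : measurable A -> measurable_fun (cell Om) (fun x => (k * \1_A x)%:E).
  by move=> mA; apply/measurable_EFinP; apply: measurable_funM.
have ge0ind (A : set (R * R)) (k : R) x : 0 <= k -> (0 <= (k * \1_A x)%:E)%E.
  by move=> k0; rewrite lee_fin mulr_ge0.
have ge0cost (W : conf Om N) x : (0 <= (cost W x)%:E)%E by rewrite lee_fin cost_ge0.
have [eZ [eY [eYZ EZ EY]]] : exists eZ eY : R, [/\ eY <= eZ,
    eZ%:E = (\int[leb2 R]_(x in cell Om) (cost Z x)%:E)%E &
    eY%:E = (\int[leb2 R]_(x in cell Om) (cost Y x)%:E)%E].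
  by exists (energy Z), (energy Y); split; [exact: minY|exact: EFin_energy|exact: EFin_energy].
have main : (eZ%:E + (h ^+ 2 / 18)%:E * leb2 R B <= eY%:E + K%:E * leb2 R V)%E.
  have Bc : B `<=` cell Om by move=> x [].
  have Vc : V `<=` cell Om by move=> x [].
  rewrite EZ EY.
  rewrite -(integral_cell_indic h2 mB Bc) -(integral_cell_indic K0 mV Vc).
  have sumE (W : conf Om N) (A : set (R * R)) k : 0 <= k -> measurable A ->
      (\int[leb2 R]_(x in cell Om) (cost W x)%:E + \int[leb2 R]_(x in cell Om) (k * \1_A x)%:E =
       \int[leb2 R]_(x in cell Om) ((cost W x)%:E + (k * \1_A x)%:E))%E.
    move=> k0 mA; rewrite ge0_integralD//; first exact: mcost.
      by move=> x _; exact: ge0ind.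
    exact: mind.
  have eqle (u w : \bar R) : u = w -> (u <= w)%E by move=> ->.
  apply: le_trans (eqle _ _ (sumE Z B _ h2 mB)) _.
  apply: le_trans _ (eqle _ _ (esym (sumE Y V _ K0 mV))).
  apply: (@ge0_le_integral _ _ R (leb2 R) _ mc).
  - by move=> x _; apply: adde_ge0; [exact: ge0cost|exact: ge0ind].
  - by apply: emeasurable_funD; [exact: mcost|exact: (mind B _ mB)].
  - by apply: emeasurable_funD; [exact: mcost|exact: (mind V _ mV)].
  - by move=> x cx; rewrite -!EFinD lee_fin; exact: relocated_cost_le.
rewrite leb2_voronoi// -EFinM -EFinD in main.
have VY := volume_le i hY dY DY.
have lower : ((c * (h / 12) ^+ 2)%:E <= leb2 R B)%E.
  apply: area_near => //; first exact: cell_sub_carrier.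
  by apply: le_trans (mesh_size_le hOm N0); rewrite -/h; have := h_gt0; lra.
have : (eZ%:E + (h ^+ 2 / 18)%:E * (c * (h / 12) ^+ 2)%:E <= (eY + K * volume Y i)%:E)%E.
  by apply: le_trans main; apply: leeD2l => //; apply: lee_wpmul2l.
rewrite -EFinM -EFinD lee_fin => ineq.
have ineq2 : h ^+ 2 / 18 * (c * (h / 12) ^+ 2) <= K * (16 * C1 ^+ 2 * h ^+ 2).
  by apply: (@le_trans _ _ (K * volume Y i)); [lra|exact: ler_wpM2l].
have Kd : K <= (2 * C1 + 1) * h * d.
  rewrite /K expr2; have : d * d <= h * d by rewrite ler_wpM2r// ltW.
  by lra.
have ineq3 : K * (16 * C1 ^+ 2 * h ^+ 2) <= (2 * C1 + 1) * h * d * (16 * C1 ^+ 2 * h ^+ 2).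
  apply: ler_wpM2r => //; apply: mulr_ge0; last exact: sqr_ge0.
  by apply: mulr_ge0; [|exact: sqr_ge0].
have D0 : 0 < 18 * 144 * 16 * C1 ^+ 2 * (2 * C1 + 1).
  by rewrite !mulr_gt0 ?exprn_gt0// addr_gt0// mulr_gt0.
apply: (@le_trans _ _ (c / (18 * 144 * 16 * C1 ^+ 2 * (2 * C1 + 1)) * h)).
  by apply: ler_wpM2r; [exact: ltW|rewrite /separation_const ge_min lexx orbT].
rewrite mulrAC ler_pdivrMr//.
have h3 : 0 < h ^+ 3 by exact: exprn_gt0.
rewrite -(ler_pM2l h3).
have := le_trans ineq2 ineq3.
have -> : h ^+ 2 / 18 * (c * (h / 12) ^+ 2) = h ^+ 3 * (c * h) / (18 * 144) by field.
have -> : (2 * C1 + 1) * h * d * (16 * C1 ^+ 2 * h ^+ 2) =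
  h ^+ 3 * (d * (18 * 144 * 16 * C1 ^+ 2 * (2 * C1 + 1))) / (18 * 144) by field.
by rewrite ler_pM2r.
Qed.

(** By the triangle inequality, the ball of radius r around X i is in its
    cell. *)
Lemma volume_ge X i r : conf_in Om N X -> 0 < r -> r <= Num.sqrt (area (cell Om)) ->
  (forall j, j != i -> 2 * r <= dist_domain Om (X i) (X j)) ->
  c * r ^+ 2 <= volume X i.
Proof.
move=> hX r0 rle sep; rewrite -lee_fin -(leb2_voronoi X hOm).
apply: le_trans (area_near (hX i) r0 rle) _; apply: le_measure; rewrite ?inE//.
- by have [] := cell_ball_area_le hOm (X i) (ltW r0).
- by apply: measurableI; [exact: measurable_voronoi|exact: cell_measurable].
move=> x [cx /= xr]; split => //; split; first exact: cell_sub_carrier.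
move=> j ji; have := sep j ji; have := dist_domain_triangle Om x (X i) (X j).
by rewrite (dist_domainC Om (X i) x); lra.
Qed.

End separation.

(** * Flux of a Lipschitz field against the centroid displacements *)

Lemma dot_le_enorm (R : realType) (x y : R * R) : `|dot x y| <= enorm x * enorm y.
Proof.
rewrite -(@ler_pXn2r _ 2) ?nnegrE ?mulr_ge0 ?enorm_ge0//.
rewrite exprMn !enorm_sqr real_normK ?num_real// /dot.
have := sqr_ge0 (x.1 * y.2 - x.2 * y.1); lra.
Qed.

Lemma ge0_integral_le_cst (R : realType) (A : set (R * R)) (g : R * R -> \bar R) (M a : R) :
  measurable A -> measurable_fun A g -> (forall x, A x -> 0 <= g x <= M%:E)%E ->
  0 <= M -> (leb2 R A <= a%:E)%E -> (\int[leb2 R]_(x in A) g x <= (M * a)%:E)%E.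
Proof.
move=> mA mg gM M0 Aa.
apply: (@le_trans _ _ (\int[leb2 R]_(x in A) (cst M%:E x))%E).
  apply: ge0_le_integral => //.
  - by move=> x /gM /andP[].
  - by move=> x /gM /andP[].
by rewrite integral_cst// EFinM lee_wpmul2l.
Qed.

Section shift_estimate.
Variables (R : realType) (D : set (R * R)) (r L M : R) (f w : R * R -> R).
Hypothesis mD : measurable D.
Hypothesis cD : convex_plane D.
Hypothesis bD : in_square D r.
Hypothesis r_ge0 : 0 <= r.
Hypothesis Doo : (leb2 R D < +oo)%E.
Hypothesis mf : measurable_fun [set: R * R] f.
Hypothesis mw : measurable_fun D w.
Hypothesis fM : forall x, 0 <= f x <= M.
Hypothesis wL : forall x, D x -> 0 <= w x <= L.
Hypothesis wlip : forall x y, D x -> D y -> `|w x - w y| <= L * enorm (x - y).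
Hypothesis L_ge0 : 0 <= L.

(** Summation by parts for the difference quotients of f in a coordinate
    direction: moving the translation from f to the Lipschitz weight w costs L
    times its length on the whole of D, and the points that the translation
    takes out of D or into it form a layer of width at most the length of the
    translation. *)
Lemma shift_estimate (d : R) (e : R * R) : e = (d, 0) \/ e = (0, d) ->
  (\int[leb2 R]_(x in D) (f x * w x)%:E <=
   \int[leb2 R]_(x in D) (f (x + e)%R * w x)%:E +
   (L * M * `|d| * (fine (leb2 R D) + 2 * r))%:E)%E.
Proof.
move=> he; have M0 : 0 <= M by have /andP[a b] := fM 0; exact: le_trans a b.
have ee : enorm e = `|d|.
  by case: he => ->; rewrite enormE /= expr0n ?addr0 ?add0r /= sqrtr_sqr.
pose P : set (R * R) := (fun x => x + - e) @^-1` D.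
pose Q : set (R * R) := (fun x => x + e) @^-1` D.
have mP : measurable P by exact: measurable_preimage_addr.
have mQ : measurable Q by exact: measurable_preimage_addr.
have mDP : measurable (D `&` P) by exact: measurableI.
have mDQ : measurable (D `&` Q) by exact: measurableI.
have mDmP : measurable (D `\` P) by exact: measurableD.
have mfs : measurable_fun [set: R * R] (fun x : R * R => f (x + e)).
  by apply: measurableT_comp => //; exact: measurable_plane_addr.
have mfw : measurable_fun D (fun x : R * R => (f x * w x)%:E).
  by apply/measurable_EFinP; apply: measurable_funM => //; exact: measurable_funTS.
have mfsw : measurable_fun D (fun x : R * R => (f (x + e) * w x)%:E).
  by apply/measurable_EFinP; apply: measurable_funM => //; exact: measurable_funTS.
have fw0 (x y : R * R) : D y -> (0 <= (f x * w y)%:E <= (M * L)%:E)%E.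
  move=> Dy; have /andP[f0 f1] := fM x; have /andP[w0 w1] := wL Dy.
  by rewrite !lee_fin mulr_ge0//= ler_pM.
have fw0' (x y : R * R) : D y -> (0 <= (f x * w y)%:E)%E by move=> /(fw0 x) /andP[].
have layer : (\int[leb2 R]_(x in D `\` P) (f x * w x)%:E <= (M * L * (2 * r * `|d|))%:E)%E.
  apply: ge0_integral_le_cst => //.
  - by apply: measurable_funS mfw => // x [].
  - by move=> x [Dx _]; exact: fw0.
  - exact: mulr_ge0.
  - exact: (@shift_layer _ _ _ d e).
have split : (\int[leb2 R]_(x in D) (f x * w x)%:E =
    \int[leb2 R]_(x in D `&` P) (f x * w x)%:E + \int[leb2 R]_(x in D `\` P) (f x * w x)%:E)%E.
  rewrite -{1}(setUIDK D P) ge0_integral_setU//.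
  - by rewrite setUIDK.
  - by rewrite setUIDK => x; exact: fw0'.
  - by apply/disj_setPS => x [[_ h1] [_ h2]].
have shift : (\int[leb2 R]_(x in D `&` P) (f x * w x)%:E =
    \int[leb2 R]_(x in D `&` Q) (f (x + e)%R * w (x + e)%R)%:E)%E.
  rewrite (@ge0_integral_translation R e)//.
  - congr (integral _ _ _); apply/seteqP; split => x /= [h1 h2]; split => //.
      by move: h2; rewrite /P /= addrK.
    by rewrite /P /= addrK.
  - by apply: measurable_funS mfw => // x [].
  - by move=> x [Dx _]; exact: fw0'.
have lip : (\int[leb2 R]_(x in D `&` Q) (f (x + e)%R * w (x + e)%R)%:E <=
    \int[leb2 R]_(x in D `&` Q) (f (x + e)%R * w x)%:E + (M * (L * `|d|) * fine (leb2 R D))%:E)%E.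
  apply: (@le_trans _ _ (\int[leb2 R]_(x in D `&` Q)
      ((f (x + e)%R * w x)%:E + (M * (L * `|d|))%:E))%E).
    apply: ge0_le_integral => //.
    - by move=> x [Dx Qx]; exact: fw0'.
    - apply/measurable_EFinP; apply: measurable_funM; first exact: measurable_funTS.
      apply: (@measurable_comp _ _ _ _ _ _ D) => //; first by move=> _ [x [_ ?] <-].
      by apply: measurable_funTS; exact: measurable_plane_addr.
    - by apply: emeasurable_funD => //; apply: measurable_funS mfsw => // x [].
    - move=> x [Dx Qx]; rewrite -EFinD lee_fin.
      have /andP[f0 f1] := fM (x + e); have := wlip Qx Dx.
      rewrite addrAC subrr add0r ee => h.
      have h' : w (x + e) <= w x + L * `|d|.
        by have := ler_norm (w (x + e) - w x); lra.
      apply: (@le_trans _ _ (f (x + e) * (w x + L * `|d|))); first exact: ler_wpM2l.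
      by rewrite mulrDr lerD2l ler_wpM2r// mulr_ge0.
  rewrite ge0_integralD//.
  - apply: leeD => //; apply: ge0_integral_le_cst => //.
    + by move=> x _; rewrite lexx andbT lee_fin !mulr_ge0.
    + by rewrite !mulr_ge0.
    + rewrite fineK ?ge0_fin_numE//; apply: le_measure; rewrite ?inE//.
  - by move=> x [Dx _]; exact: fw0'.
  - by apply: measurable_funS mfsw => // x [].
  - by move=> x _; rewrite lee_fin !mulr_ge0.
have sub : (\int[leb2 R]_(x in D `&` Q) (f (x + e)%R * w x)%:E <=
    \int[leb2 R]_(x in D) (f (x + e)%R * w x)%:E)%E.
  by apply: ge0_subset_integral => // x; exact: fw0'.
rewrite split shift; apply: le_trans (leeD (le_trans lip (leeD sub (lexx _))) layer) _.
by rewrite -addeA -EFinD; apply: leeD => //; rewrite lee_fin; lra.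
Qed.

End shift_estimate.

Section plane_integral_algebra.
Variables (R : realType) (D : set (R * R)).
Hypothesis mD : measurable D.
Implicit Types f g : R * R -> R.
Notation int f := ((leb2 R).-integrable D (EFin \o f)).

Lemma plane_integrableZl k f : int f -> int (fun x => k * f x).
Proof. by move=> h; exact: (@integrableZl _ _ _ (leb2 R) _ mD k _ h). Qed.

Lemma plane_integrableD f g : int f -> int g -> int (fun x => f x + g x).
Proof. by move=> h h'; exact: (@integrableD _ _ _ (leb2 R) _ mD _ _ h h'). Qed.

Lemma plane_RintegralZl k f : int f ->
  \int[leb2 R]_(x in D) (k * f x) = k * \int[leb2 R]_(x in D) f x.
Proof. by move=> h; rewrite RintegralZl. Qed.

Lemma plane_RintegralD f g : int f -> int g -> \int[leb2 R]_(x in D) (f x + g x) =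
  \int[leb2 R]_(x in D) f x + \int[leb2 R]_(x in D) g x.
Proof. by move=> h h'; rewrite RintegralD. Qed.

End plane_integral_algebra.

Lemma ler_sum_lincomb (R : realType) (n : nat) (a b u v : 'I_n -> R) (k m : R) :
  (forall i, a i <= b i + k * u i + m * v i) ->
  \sum_i a i <= \sum_i b i + k * \sum_i u i + m * \sum_i v i.
Proof.
move=> h; rewrite [k * _]mulr_sumr [m * _]mulr_sumr -big_split -big_split /=.
by apply: ler_sum => i _; exact: h.
Qed.

Lemma weighted_quadratic_le (R : realType) (a b q w d L : R) :
  a <= b + 2 * d * q + d ^+ 2 -> 0 <= w -> w <= L ->
  a * w <= b * w + 2 * d * (q * w) + d ^+ 2 * L.
Proof.
move=> h w0 wL; have := ler_wpM2r w0 h; have := ler_wpM2l (sqr_ge0 d) wL; lra.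
Qed.

Section flux.
Variables (R : realType) (Om : planar_domain R) (N : nat) (X : conf Om N).
Hypothesis hOm : admissible_domain Om.
Hypothesis N0 : (0 < N)%N.
Hypothesis hX : conf_in Om N X.
Hypothesis dX : distinct_generators X.
Variables (D L r : R).
Hypothesis D_ge0 : 0 <= D.
Hypothesis L_ge0 : 0 <= L.
Hypothesis r_ge0 : 0 <= r.
Hypothesis cell_r : in_square (cell Om) r.
Hypothesis XD : max_diameter X <= D.
Let S := area (cell Om).

Lemma measurable_dot_coord i (e : R * R) :
  measurable_fun [set: R * R] (fun y : R * R => dot (y - X i) e).
Proof.
have [m1 m2] := measurable_coord (X i) [set: R * R].
by apply: measurable_funD; apply: measurable_funM.
Qed.

Lemma lipschitz_weight_measurable (w : R * R -> R) :
  (forall x y, carrier Om x -> carrier Om y -> `|w x - w y| <= L * enorm (x - y)) ->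
  measurable_fun (carrier Om) w.
Proof. by move=> wlip; apply: (lipschitz_measurable (carrier_open hOm) wlip). Qed.

(** Up to a factor 2, the sum is the integral of w against the derivative of
    the cost in the direction e. The difference quotients of the cost are
    controlled from below by shift_estimate, because the cost is at most
    D ^+ 2, and from above by semiconcavity: the second order remainder d ^+ 2
    disappears in the limit. *)
Lemma directional_estimate (s : R) (e : R * R) (w : R * R -> R) :
  `|s| = 1 -> e = (s, 0) \/ e = (0, s) ->
  (forall x, carrier Om x -> 0 <= w x <= L) ->
  (forall x y, carrier Om x -> carrier Om y -> `|w x - w y| <= L * enorm (x - y)) ->
  (forall x k, lattice Om k -> carrier Om x -> w (x + k) = w x) ->
  - (L * D ^+ 2 * (S + 2 * r)) <=
    2 * \sum_(i < N) \int[leb2 R]_(y in vcell X i) (dot (y - X i) e * w y).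
Proof.
move=> s1 he wL wlip wper; have mw := lipschitz_weight_measurable wlip.
have mc := cell_measurable hOm; have mO := carrier_measurable hOm.
have cO := @cell_sub_carrier R Om.
pose M := D ^+ 2; have M0 : 0 <= M by exact: sqr_ge0.
(* On the cells the cost is at most D ^+ 2; the truncation keeps this bound
   for the translates of their points outside of the domain. *)
pose f x := Num.min (cost X x) M.
have mf : measurable_fun [set: R * R] f by apply: measurable_minr => //; exact: measurable_cost.
have fM x : 0 <= f x <= M by rewrite /f le_min cost_ge0//= M0 ge_min lexx orbT.
have fper x k : lattice Om k -> f (x + k) = f x by move=> Lk; rewrite /f costD.
pose K := L * M * (S + 2 * r).
set J := \sum_(i < N) _.
have dot_bd i y : vcell X i y -> `|dot (y - X i) e * w y| <= D * L.
  move=> vy; have Oy := vcell_sub_carrier vy; have /andP[w0 w1] := wL _ Oy.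
  rewrite normrM (ger0_norm w0); apply: ler_pM => //.
  apply: le_trans (dot_le_enorm _ _) _.
  have -> : enorm e = 1 by case: he => ->; rewrite enormE /= expr0n ?addr0 ?add0r /= sqrtr_sqr.
  by rewrite mulr1 (le_trans (vcell_enorm_le hOm hX dX vy)).
have mdot i : measurable_fun (vcell X i) (fun y => dot (y - X i) e * w y).
  apply: measurable_funM; first by apply: measurable_funTS; exact: measurable_dot_coord.
  by apply: measurable_funS mw => //; exact: vcell_sub_carrier.
have idot i : (leb2 R).-integrable (vcell X i) (EFin \o (fun y => dot (y - X i) e * w y)).
  exact: (integrable_vcell hOm dX (mdot i) (dot_bd i)).
have fw0 x y : carrier Om y -> 0 <= f x * w y <= M * L.
  move=> Oy; have /andP[f0 f1] := fM x; have /andP[w0 w1] := wL _ Oy.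
  by rewrite mulr_ge0//= ler_pM.
have step (d : R) : 0 < d -> 0 <= 2 * d * J + d ^+ 2 * (L * S) + d * K.
  move=> d0; pose v := d *: e.
  have hv : v = (d * s, 0) \/ v = (0, d * s).
    by case: he => he; [left|right]; rewrite /v he [LHS]surjective_pairing; congr pair;
      rewrite /= /GRing.scale /= ?mulr0.
  have nd : `|d * s| = d by rewrite normrM s1 mulr1 gtr0_norm.
  have ee : dot e e = 1.
    have := congr1 (fun z => z ^+ 2) s1; rewrite real_normK ?num_real// expr1n => ss.
    by case: he => ->; rewrite /dot /= ?mulr0 ?addr0 ?add0r -expr2.
  have mfv : measurable_fun [set: R * R] (fun x : R * R => f (x + v)).
    by apply: measurableT_comp => //; exact: measurable_plane_addr.
  have mf1 : measurable_fun (carrier Om) (fun x => f x * w x).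
    by apply: measurable_funM => //; exact: measurable_funTS.
  have mf2 : measurable_fun (carrier Om) (fun x => f (x + v) * w x).
    by apply: measurable_funM => //; exact: measurable_funTS.
  have abs x y : carrier Om y -> `|f x * w y| <= M * L.
    by move=> Oy; have /andP[a b] := fw0 x y Oy; rewrite ger0_norm.
  have := @shift_estimate R (cell Om) r L M f w mc (cell_convex hOm) cell_r r_ge0
    (leb2_cell_lty hOm) mf (measurable_funS mO cO mw) fM (fun x cx => wL x (cO _ cx))
    (fun x y cx cy => wlip x y (cO _ cx) (cO _ cy)) L_ge0 _ v hv.
  rewrite nd !EFin_Rintegral//; last 2 first.
  - apply: (bounded_integrable (M := M * L)) => //; first exact: leb2_cell_lty.
      exact: measurable_funS mf2.
    by move=> x /cO; exact: abs.
  - apply: (bounded_integrable (M := M * L)) => //; first exact: leb2_cell_lty.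
      exact: measurable_funS mf1.
    by move=> x /cO; exact: abs.
  rewrite -/(area (cell Om)) -/S -EFinD lee_fin.
  rewrite (Rintegral_cell_vcells hOm dX (M := M * L))//; last 2 first.
  - by move=> x Ox; exact: fw0.
  - by move=> x k Lk Ox; rewrite fper// wper.
  rewrite (Rintegral_cell_vcells hOm dX (M := M * L))//; last 2 first.
  - by move=> x Ox; exact: fw0.
  - by move=> x k Lk Ox; rewrite addrAC (fper (x + v) k Lk) (wper x k Lk Ox).
  move=> main.
  have cellwise i : \int[leb2 R]_(y in vcell X i) (f (y + v) * w y) <=
     \int[leb2 R]_(y in vcell X i) (f y * w y) +
     2 * d * \int[leb2 R]_(y in vcell X i) (dot (y - X i) e * w y) + d ^+ 2 * L * volume X i.
    have mv := @measurable_vcell _ _ _ X hOm i.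
    have vO : vcell X i `<=` carrier Om by exact: vcell_sub_carrier.
    have i1 : (leb2 R).-integrable (vcell X i) (EFin \o (fun y => f y * w y)).
      apply: (integrable_vcell hOm dX (M := M * L)); first exact: measurable_funS mf1.
      by move=> y /vO; exact: abs.
    have i2 : (leb2 R).-integrable (vcell X i) (EFin \o (fun y => f (y + v) * w y)).
      apply: (integrable_vcell hOm dX (M := M * L)); first exact: measurable_funS mf2.
      by move=> y /vO; exact: abs.
    have i3 : (leb2 R).-integrable (vcell X i) (EFin \o (fun y => 2 * d * (dot (y - X i) e * w y))).
      exact: (plane_integrableZl mv (2 * d) (idot i)).
    have i4 : (leb2 R).-integrable (vcell X i) (EFin \o (fun=> d ^+ 2 * L)).
      by apply: (integrable_vcell hOm dX (M := `|d ^+ 2 * L|)).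
    have i13 := plane_integrableD mv i1 i3.
    have -> : d ^+ 2 * L * volume X i = \int[leb2 R]_(y in vcell X i) (d ^+ 2 * L).
      by rewrite Rintegral_cst// leb2_vcell.
    rewrite -(plane_RintegralZl mv (2 * d) (idot i)) -(plane_RintegralD mv i1 i3).
    rewrite -(plane_RintegralD mv i13 i4); apply: le_Rintegral => //.
      exact: (plane_integrableD mv i13 i4).
    move=> y vy; have /andP[w0 w1] := wL _ (vO _ vy).
    have cy := cost_vcell hOm N0 dX vy.
    have fy : f y = enorm (y - X i) ^+ 2.
      rewrite /f cy min_l// /M lerXn2r ?nnegrE ?enorm_ge0//.
      by rewrite (le_trans (vcell_enorm_le hOm hX dX vy)).
    have fyv : f (y + v) <= enorm (y + v - X i) ^+ 2.
      rewrite /f ge_min (le_trans (cost_le X _ i))//.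
      by rewrite lerXn2r ?nnegrE ?enorm_ge0 ?dist_domain_ge0// dist_domain_le_enorm.
    have E : enorm (y + v - X i) ^+ 2 = f y + 2 * d * dot (y - X i) e + d ^+ 2.
      transitivity (f y + 2 * d * dot (y - X i) e + d ^+ 2 * dot e e); last by rewrite ee mulr1.
      by rewrite fy !enorm_sqr /v /dot /= /GRing.scale /=; ring.
    rewrite E in fyv.
    exact: weighted_quadratic_le.
  have sums : \sum_(i < N) \int[leb2 R]_(y in vcell X i) (f (y + v) * w y) <=
      \sum_(i < N) \int[leb2 R]_(y in vcell X i) (f y * w y) + 2 * d * J + d ^+ 2 * L * S.
    have -> : S = \sum_(i < N) volume X i by exact/esym/(sum_volume hOm dX N0).
    exact: (ler_sum_lincomb cellwise).
  have := le_trans main (lerD sums (lexx (L * M * d * (S + 2 * r)))).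
  clear; rewrite /K; set I := \sum_(i < N) _; clearbody I J S M; lra.
rewrite -/M -/K; apply/ler_addgt0Pl => eps e0; rewrite -subr_ge0.
have LS : 0 <= L * S by rewrite mulr_ge0// ltW// area_cell_gt0.
(* step is divided by d, small enough for the quadratic remainder to be less
   than eps. *)
pose d := eps / (L * S + 1).
have d0 : 0 < d by rewrite divr_gt0// ltr_wpDl.
have dLS : d * (L * S) <= eps.
  rewrite /d mulrAC ler_pdivrMr ?ltr_wpDl//; nra.
have := step d d0.
have -> : 2 * d * J + d ^+ 2 * (L * S) + d * K = d * (2 * J + d * (L * S) + K) by ring.
by rewrite pmulr_rge0//; lra.
Qed.

End flux.

(** The expansion in the four directions of the half axes, with nonnegative
    weights as required by directional_estimate. *)
Lemma dot_pos_parts (R : realType) (z u : R * R) :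
  dot z u = dot z (1, 0) * Num.max 0 (dot u (1, 0)) + dot z (-1, 0) * Num.max 0 (dot u (-1, 0)) +
    dot z (0, 1) * Num.max 0 (dot u (0, 1)) + dot z (0, -1) * Num.max 0 (dot u (0, -1)).
Proof.
rewrite /dot /= !mulr0 !addr0 !add0r !mulr1 !mulrN1.
have H (b : R) : b = Num.max 0 b - Num.max 0 (- b).
  have [b0|b0] := leP 0 b; first by rewrite (max_l (_ : - b <= 0)) ?oppr_le0// subr0.
  by rewrite (max_r (_ : 0 <= - b)) ?oppr_ge0 ?ltW// opprK add0r.
by rewrite [in LHS](H u.1) [in LHS](H u.2); ring.
Qed.

Lemma four_halves (R : realType) (a1 a2 a3 a4 b c s r : R) :
  - (c * (s + 2 * r)) <= 2 * a1 -> - (c * (s + 2 * r)) <= 2 * a2 ->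
  - (c * (s + 2 * r)) <= 2 * a3 -> - (c * (s + 2 * r)) <= 2 * a4 ->
  a1 + a2 + a3 + a4 - c * s <= b -> - (c * (3 * s + 4 * r)) <= b.
Proof. by lra. Qed.

Section flux_bound.
Variables (R : realType) (Om : planar_domain R) (N : nat) (X : conf Om N).
Hypothesis hOm : admissible_domain Om.
Hypothesis N0 : (0 < N)%N.
Hypothesis hX : conf_in Om N X.
Hypothesis dX : distinct_generators X.
Variables (D L r : R).
Hypothesis D_ge0 : 0 <= D.
Hypothesis L_ge0 : 0 <= L.
Hypothesis r_ge0 : 0 <= r.
Hypothesis cell_r : in_square (cell Om) r.
Hypothesis XD : max_diameter X <= D.
Hypothesis V_gt0 : forall i, 0 < volume X i.
Variable u : R * R -> R * R.
Hypothesis uL : forall x, carrier Om x -> enorm (u x) <= L.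
Hypothesis ulip : forall x y, carrier Om x -> carrier Om y ->
  enorm (u x - u y) <= L * enorm (x - y).
Hypothesis uper : forall x k, lattice Om k -> carrier Om x -> u (x + k) = u x.
Let S := area (cell Om).

Let w (e : R * R) (y : R * R) : R := Num.max 0 (dot (u y) e).

Let unit_bound (e z : R * R) : enorm e = 1 -> `|dot z e| <= enorm z.
Proof. by move=> e1; have := dot_le_enorm z e; rewrite e1 mulr1. Qed.

Let wL e x : enorm e = 1 -> carrier Om x -> 0 <= w e x <= L.
Proof.
move=> e1 Ox; rewrite /w le_max lexx /= ge_max L_ge0 /=.
by apply: le_trans (ler_norm _) _; apply: le_trans (unit_bound _ e1) _; exact: uL.
Qed.

Let wlip e x y : enorm e = 1 -> carrier Om x -> carrier Om y ->
  `|w e x - w e y| <= L * enorm (x - y).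
Proof.
move=> e1 Ox Oy; apply: le_trans (ulip Ox Oy).
apply: le_trans (unit_bound _ e1); rewrite /w.
have -> : dot (u x - u y) e = dot (u x) e - dot (u y) e by rewrite /dot /=; ring.
move: (dot (u x) e) (dot (u y) e) => a b; rewrite /Num.max.
case: ltP => a0; case: ltP => b0.
- by [].
- rewrite subr0 gtr0_norm// ger0_norm; lra.
- rewrite sub0r normrN gtr0_norm// ler0_norm; lra.
- by rewrite subrr normr0.
Qed.

Let mwe e : enorm e = 1 -> measurable_fun (carrier Om) (w e).
Proof.
move=> e1; apply: (lipschitz_weight_measurable hOm (L := L)) => x y; exact: wlip.
Qed.

Let J (e : R * R) (i : 'I_N) := \int[leb2 R]_(y in vcell X i) (dot (y - X i) e * w e y).

Let integrable_J e i : enorm e = 1 ->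
  (leb2 R).-integrable (vcell X i) (EFin \o (fun y => dot (y - X i) e * w e y)).
Proof.
move=> e1; apply: (integrable_vcell hOm dX (M := D * L)).
  apply: measurable_funM; first by apply: measurable_funTS; exact: measurable_dot_coord.
  by apply: measurable_funS (mwe e1) => //; [exact: carrier_measurable|exact: vcell_sub_carrier].
move=> y vy; have /andP[w0 w1] := wL e1 (vcell_sub_carrier vy).
rewrite normrM (ger0_norm w0); apply: ler_pM => //.
by apply: le_trans (unit_bound _ e1) _; apply: le_trans (vcell_enorm_le hOm hX dX vy) _.
Qed.

Let J_ge (s : R) e : `|s| = 1 -> e = (s, 0) \/ e = (0, s) -> enorm e = 1 ->
  - (L * D ^+ 2 * (S + 2 * r)) <= 2 * \sum_(i < N) J e i.
Proof.
move=> s1 he e1; apply: (directional_estimate hOm N0 hX dX D_ge0 L_ge0 r_ge0 cell_r XD s1 he).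
- by move=> x; exact: wL.
- by move=> x y; exact: wlip.
- by move=> x k Lk Ox; rewrite /w uper.
Qed.

Let cellwise i : J (1, 0) i + J (-1, 0) i + J (0, 1) i + J (0, -1) i - L * D ^+ 2 * volume X i <=
  volume X i * dot (displacement X i) (u (X i)).
Proof.
have n1 : enorm ((1, 0) : R * R) = 1 by rewrite enormE /= expr0n addr0 expr1n sqrtr1.
have n2 : enorm ((-1, 0) : R * R) = 1 by rewrite enormE /= expr0n addr0 sqrrN expr1n sqrtr1.
have n3 : enorm ((0, 1) : R * R) = 1 by rewrite enormE /= expr0n add0r expr1n sqrtr1.
have n4 : enorm ((0, -1) : R * R) = 1 by rewrite enormE /= expr0n add0r sqrrN expr1n sqrtr1.
have mv := @measurable_vcell _ _ _ X hOm i.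
have i1 := integrable_J i n1; have i2 := integrable_J i n2.
have i3 := integrable_J i n3; have i4 := integrable_J i n4.
have i12 := plane_integrableD mv i1 i2; have i123 := plane_integrableD mv i12 i3.
have i1234 := plane_integrableD mv i123 i4.
have ic : (leb2 R).-integrable (vcell X i) (EFin \o (fun=> - (L * D ^+ 2))).
  by apply: (integrable_vcell hOm dX (M := `|- (L * D ^+ 2)|)).
have [k1 k2] := integrable_coord hOm hX dX i.
have [d1 d2] := volume_displacement hOm hX dX (V_gt0 i).
have l1 := plane_integrableZl mv (u (X i)).1 k1.
have l2 := plane_integrableZl mv (u (X i)).2 k2.
have -> : volume X i * dot (displacement X i) (u (X i)) =
    \int[leb2 R]_(y in vcell X i) ((u (X i)).1 * (y.1 - (X i).1) + (u (X i)).2 * (y.2 - (X i).2)).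
  rewrite (plane_RintegralD mv l1 l2) (plane_RintegralZl mv _ k1) (plane_RintegralZl mv _ k2).
  by rewrite -d1 -d2 /dot; ring.
have -> : J (1, 0) i + J (-1, 0) i + J (0, 1) i + J (0, -1) i - L * D ^+ 2 * volume X i =
    \int[leb2 R]_(y in vcell X i) (dot (y - X i) (1, 0) * w (1, 0) y +
      dot (y - X i) (-1, 0) * w (-1, 0) y + dot (y - X i) (0, 1) * w (0, 1) y +
      dot (y - X i) (0, -1) * w (0, -1) y + - (L * D ^+ 2)).
  rewrite (plane_RintegralD mv i1234 ic) (plane_RintegralD mv i123 i4).
  rewrite (plane_RintegralD mv i12 i3) (plane_RintegralD mv i1 i2).
  by rewrite Rintegral_cst// leb2_vcell//= mulNr.
apply: le_Rintegral => //.
- exact: (plane_integrableD mv i1234 ic).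
- exact: (plane_integrableD mv l1 l2).
move=> y vy; rewrite -dot_pos_parts.
have Oy := vcell_sub_carrier vy.
have h1 := dot_le_enorm (y - X i) (u (X i) - u y).
have h2 := ulip (hX i) Oy; rewrite -(enormN (X i - y)) opprB in h2.
have h3 : enorm (y - X i) <= D by exact: le_trans (vcell_enorm_le hOm hX dX vy) XD.
have h4 : enorm (y - X i) * enorm (u (X i) - u y) <= L * D ^+ 2.
  have -> : L * D ^+ 2 = D * (L * D) by ring.
  apply: ler_pM => //; rewrite ?enorm_ge0//.
  by apply: le_trans h2 _; rewrite ler_wpM2l.
have := le_trans h1 h4; rewrite ler_norml => /andP[h5 _].
have -> : (u (X i)).1 * (y.1 - (X i).1) + (u (X i)).2 * (y.2 - (X i).2) =
  dot (y - X i) (u y) + dot (y - X i) (u (X i) - u y) by rewrite /dot /=; ring.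
by rewrite lerD2l.
Qed.

(** Replacing u (X i) by the values of u on the cell costs L * D ^+ 2 per unit
    of area, after which directional_estimate applies to the positive parts of
    the components of u. What matters is the factor D ^+ 2, where the size of
    the displacements alone would give D. *)
Lemma flux_bound : - (L * D ^+ 2 * (3 * S + 4 * r)) <=
  \sum_(i < N) volume X i * dot (displacement X i) (u (X i)).
Proof.
have n1 : enorm ((1, 0) : R * R) = 1 by rewrite enormE /= expr0n addr0 expr1n sqrtr1.
have n2 : enorm ((-1, 0) : R * R) = 1 by rewrite enormE /= expr0n addr0 sqrrN expr1n sqrtr1.
have n3 : enorm ((0, 1) : R * R) = 1 by rewrite enormE /= expr0n add0r expr1n sqrtr1.
have n4 : enorm ((0, -1) : R * R) = 1 by rewrite enormE /= expr0n add0r sqrrN expr1n sqrtr1.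
have a1 : `|1 : R| = 1 by rewrite normr1.
have a2 : `|-1 : R| = 1 by rewrite normrN1.
have j1 := J_ge a1 (or_introl erefl) n1; have j2 := J_ge a2 (or_introl erefl) n2.
have j3 := J_ge a1 (or_intror erefl) n3; have j4 := J_ge a2 (or_intror erefl) n4.
have : \sum_(i < N) (J (1, 0) i + J (-1, 0) i + J (0, 1) i + J (0, -1) i - L * D ^+ 2 * volume X i) <=
  \sum_(i < N) volume X i * dot (displacement X i) (u (X i)) by apply: ler_sum => i _; exact: cellwise.
rewrite sumrB !big_split /= -mulr_sumr (sum_volume hOm dX N0) -/S.
exact: (four_halves j1 j2 j3 j4).
Qed.

End flux_bound.

(** * Absolutely continuous functions *)

Definition ac_on (R : realType) (T : R) (f : R -> R) : Prop :=
  forall e : R, 0 < e -> exists2 d : R, 0 < d &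
    forall (n : nat) (a b : 'I_n -> R),
      (forall i, 0 <= a i <= b i /\ b i <= T) ->
      trivIset setT (fun i => `]a i, b i[%classic) ->
      \sum_(i < n) (b i - a i) < d ->
      \sum_(i < n) `|f (b i) - f (a i)| < e.

Lemma ac_on_uniform (R : realType) (T : R) (f : R -> R) (e : R) : ac_on T f -> 0 < e ->
  exists2 d : R, 0 < d & forall s t, 0 <= s -> s <= t -> t <= T -> t - s < d ->
    `|f t - f s| < e.
Proof.
move=> acf e0; have [d d0 h] := acf e e0; exists d => // s t s0 st tT std.
have := h 1%N (fun=> s) (fun=> t); rewrite !big_ord1; apply => //.
  by move=> _; rewrite s0 st.
by apply/trivIsetP => i j _ _; rewrite !ord1 eqxx.
Qed.

Lemma sum_length_le (R : realType) (O : set R) (n : nat) (a b : 'I_n -> R) (d : R) :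
  open O -> (@lebesgue_measure R O < d%:E)%E -> (forall i, a i <= b i) ->
  (forall i, `]a i, b i[%classic `<=` O) ->
  trivIset setT (fun i => `]a i, b i[%classic) -> \sum_(i < n) (b i - a i) < d.
Proof.
move=> oO Od ab abO tab; rewrite -lte_fin; apply: le_lt_trans Od.
have L i : @lebesgue_measure R `]a i, b i[%classic = (b i - a i)%:E.
  rewrite lebesgue_measure_itv/= lte_fin; case: ltP => [//|ba].
  by rewrite (le_anti (introT andP (conj (ab i) ba))) subrr.
pose F (k : nat) : set R := if insub k is Some i then `]a i, b i[%classic else set0.
have FE (i : 'I_n) : F i = `]a i, b i[%classic by rewrite /F valK.
have mF k : measurable (F k).
  by rewrite /F; case: insubP => [i _ _|_]; [exact: measurable_itv|exact: measurable0].
have tF : trivIset setT F.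
  move=> k l _ _ [x0]; rewrite /F.
  case: insubP => [i _ <-|_]; case: insubP => [j _ <-|_] [h1 h2] //.
  by congr val; apply: tab => //; exists x0.
have -> : (\sum_(i < n) (b i - a i))%:E = (\sum_(i < n) @lebesgue_measure R (F i))%E.
  by rewrite -sumEFin; apply: eq_bigr => i _; rewrite FE L.
rewrite -(measure_bigsetU (@lebesgue_measure R) mF tF).
apply: le_measure; rewrite ?inE.
- by apply: bigsetU_measurable => i _; exact: mF.
- exact: open_measurable.
- by move=> x; rewrite -bigcup_mkord => -[k /= kn]; rewrite (FE (Ordinal kn)) => /abO.
Qed.

Section creeping.
Variables (R : realType) (T : R) (f : R -> R) (O : set R).

(** The sums of increments of f over disjoint intervals contained in O and in
    [0, s]; their supremum pays for the increase of f inside O. *)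
Definition variation_values (s : R) : set R :=
  [set x | exists n (a b : 'I_n -> R), [/\ forall i, 0 <= a i <= b i /\ b i <= s,
    trivIset setT (fun i => `]a i, b i[%classic), forall i, `[a i, b i]%classic `<=` O &
    x = \sum_(i < n) `|f (b i) - f (a i)|]].

Lemma variation_append (s t x : R) : 0 <= s -> s <= t -> `[s, t]%classic `<=` O ->
  variation_values s x -> variation_values t (x + `|f t - f s|).
Proof.
move=> s0 st stO [n [a [b [ab tab abO ->]]]].
pose ext (c : 'I_n -> R) (z : R) (i : 'I_n.+1) := if unlift ord0 i is Some j then c j else z.
exists n.+1, (ext a s), (ext b t); split.
- move=> i; rewrite /ext; case: unliftP => [j _|_]; last by rewrite s0 st lexx.
  by have [/andP[-> ->] bs] := ab j; split => //; exact: le_trans bs st.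
- have key j x0 : `]a j, b j[%classic x0 -> `]s, t[%classic x0 -> False.
    rewrite /= !in_itv/= => /andP[_ h1] /andP[h2 _]; have [_ h3] := ab j.
    by have := lt_le_trans (lt_trans h2 h1) h3; rewrite ltxx.
  move=> i j _ _ [x0]; rewrite /ext.
  case: unliftP => [i' ->|->]; case: unliftP => [j' ->|->] [h1 h2] //.
  + by congr (lift ord0 _); apply: tab => //; exists x0.
  + by case: (key i' x0).
  + by case: (key j' x0).
- by move=> i; rewrite /ext; case: unliftP => [j _|_].
- rewrite big_ord_recl /ext unlift_none addrC; congr (_ + _).
  by apply: eq_bigr => i _; rewrite liftK.
Qed.

Lemma variation_mono (s t x : R) : s <= t -> variation_values s x -> variation_values t x.
Proof.
move=> st [n [a [b [ab tab abO ->]]]]; exists n, a, b; split => // i.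
by have [h1 h2] := ab i; split => //; exact: le_trans h2 st.
Qed.

Lemma variation0 (s : R) : variation_values s 0.
Proof.
by exists 0%N, (fun=> 0), (fun=> 0); split => //; [case|case|case|rewrite big_ord0].
Qed.

(** Let V be the supremum of the variation_values, and c the last time s at
    which f s <= f 0 + e * s + V s. If c < T, the inequality extends beyond c:
    by the hypothesis on f if c is not in O, and by the definition of V
    otherwise. Hence c = T, and V T <= e because O is short. *)
Lemma creeping (e d : R) : 0 < T -> 0 < e -> open O ->
  (@lebesgue_measure R O < d%:E)%E ->
  (forall (n : nat) (a b : 'I_n -> R),
      (forall i, 0 <= a i <= b i /\ b i <= T) ->
      trivIset setT (fun i => `]a i, b i[%classic) ->
      \sum_(i < n) (b i - a i) < d -> \sum_(i < n) `|f (b i) - f (a i)| < e) ->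
  ac_on T f ->
  (forall t, 0 <= t -> t < T -> ~ O t -> exists2 h, 0 < h & t + h <= T /\ f (t + h) <= f t + e * h) ->
  f T <= f 0 + e * T + e.
Proof.
move=> T0 e0 oO Od dP acf good.
have vle s x : s <= T -> variation_values s x -> x <= e.
  move=> sT [n [a [b [ab tab abO ->]]]]; apply/ltW/dP => //.
    by move=> i; have [h1 h2] := ab i; split => //; exact: le_trans h2 sT.
  apply: sum_length_le oO Od _ _ tab => i; first by have [/andP[]] := ab i.
  by apply: subset_trans (abO i); apply: subset_itvW.
pose V s := sup (variation_values s).
have hsV s : s <= T -> has_sup (variation_values s).
  move=> sT; split; first by exists 0; exact: variation0.
  by exists e => x; exact: vle.
have Vge s x : s <= T -> variation_values s x -> x <= V s.
  by move=> sT vx; apply: sup_ubound vx; case: (hsV s sT).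
have Vmono s t : s <= t -> t <= T -> V s <= V t.
  move=> st tT; apply: ge_sup; first by exists 0; exact: variation0.
  by move=> x vx; apply: Vge => //; exact: variation_mono vx.
have Vadd s t : 0 <= s -> s <= t -> t <= T -> `[s, t]%classic `<=` O ->
    V s + `|f t - f s| <= V t.
  move=> s0 st tT stO; rewrite -lerBrDr; apply: ge_sup; first by exists 0; exact: variation0.
  by move=> x vx; rewrite lerBrDr; apply: Vge => //; exact: variation_append vx.
pose S := [set s | 0 <= s <= T /\ f s <= f 0 + e * s + V s].
have S0 : S 0.
  split; first by rewrite lexx (ltW T0).
  by rewrite mulr0 addr0 lerDl; apply: Vge; [exact: ltW|exact: variation0].
have hS : has_sup S by split; [exists 0|exists T => s [/andP[]]].
pose c := sup S; have c0 : 0 <= c by apply: sup_ubound S0; case: hS.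
have cT : c <= T by apply: ge_sup; [exists 0|move=> s [/andP[]]].
have Sc : S c.
  split; first by rewrite c0.
  apply/ler_addgt0Pr => eta eta0.
  have [d' d'0 hd'] := ac_on_uniform acf eta0.
  have [s [/andP[s0 sT] fs] cs] := sup_adherent d'0 hS.
  have sc : s <= c by apply: sup_ubound; [case: hS|split; rewrite ?s0].
  have := hd' s c s0 sc cT; rewrite -/c in cs.
  have -> : c - s < d' by lra.
  move=> /(_ isT) h; have := ler_norm (f c - f s); have := Vmono _ _ sc cT.
  have : e * s <= e * c by rewrite ler_pM2l.
  by lra.
have [ceT|ncT] := eqVneq c T.
  have [_ h] := Sc; rewrite ceT in h; apply: le_trans h _; rewrite lerD2l.
  by apply: ge_sup; [exists 0; exact: variation0|move=> x; exact: vle].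
have ltcT : c < T by rewrite lt_neqAle ncT.
have [_ fc] := Sc.
have noS t : c < t -> t <= T -> f t <= f 0 + e * t + V t -> False.
  move=> ct tT ft; have : t <= c.
    by apply: sup_ubound; [case: hS|split => //; rewrite tT (le_trans c0 (ltW ct))].
  by rewrite leNgt ct.
exfalso; have [Oc|nOc] := pselect (O c).
  have : nbhs c O by exact: open_nbhs_nbhs.
  rewrite -nbhs_ballE => -[rho /= rho0 hrho].
  pose t := Num.min (c + rho / 2) T.
  have ct : c < t by rewrite lt_min ltcT ltrDl divr_gt0.
  have tT : t <= T by rewrite ge_min lexx orbT.
  have tr : t <= c + rho / 2 by rewrite ge_min lexx.
  have sub : `[c, t]%classic `<=` O.
    move=> x; rewrite /= in_itv/= => /andP[h1 h2]; apply: hrho.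
    by rewrite /ball/= ltr_norml; apply/andP; split; lra.
  apply: (noS t ct tT); have := Vadd c t c0 (ltW ct) tT sub.
  have := ler_norm (f t - f c); have : e * c <= e * t by rewrite ler_pM2l// ltW.
  by lra.
have [hh hh0 [chT fch]] := good c c0 ltcT nOc.
apply: (noS (c + hh)) => //; first by rewrite ltrDl.
have := Vmono c (c + hh); rewrite lerDl (ltW hh0) => /(_ isT chT).
by rewrite mulrDr; lra.
Qed.

End creeping.

(** The exceptional set, together with the endpoint 0, is contained in an open
    set so short that f varies by less than e on it, to which creeping
    applies. *)
Lemma ac_nonincreasing (R : realType) (T : R) (f : R -> R) (N : set R) : 0 < T -> ac_on T f ->
  measurable N -> @lebesgue_measure R N = 0%E ->
  (forall t, 0 < t -> t < T -> ~ N t -> forall eta, 0 < eta ->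
     exists2 h0, 0 < h0 & forall h, 0 < h -> h < h0 -> f (t + h) <= f t + eta * h) ->
  f T <= f 0.
Proof.
move=> T0 acf mN N0 good; apply/ler_addgt0Pr => eps eps0.
(* creeping loses e * T + e in total. *)
pose e := eps / (T + 1); have T1 : 0 < T + 1 by rewrite addr_gt0.
have e0 : 0 < e by rewrite divr_gt0.
have [d d0 hd] := acf e e0.
have mN0 : measurable (N `|` [set 0]) by apply: measurableU.
have N0' : @lebesgue_measure R (N `|` [set (0 : R)%R]) = 0%E.
  apply/eqP; rewrite eq_le measure_ge0 andbT.
  apply: (@le_trans _ _ (@lebesgue_measure R N + @lebesgue_measure R [set (0 : R)%R])%E).
    by apply: measureU2.
  by rewrite N0 lebesgue_measure_set1 adde0.
have Noo : (@lebesgue_measure R (N `|` [set (0 : R)%R]) < +oo)%E by rewrite N0'.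
have [U [oU NU Ud]] := lebesgue_regularity_outer mN0 Noo d0.
have mU := open_measurable oU.
have Ud' : (@lebesgue_measure R U < d%:E)%E.
  apply: le_lt_trans Ud; rewrite -{1}(setDUK NU).
  apply: (@le_trans _ _ (@lebesgue_measure R (N `|` [set (0 : R)%R]) +
    @lebesgue_measure R (U `\` (N `|` [set (0 : R)%R])))%E).
    by apply: measureU2 => //; exact: measurableD.
  by rewrite [X in (X + _)%E]N0' add0e.
apply: le_trans (creeping T0 e0 oU Ud' hd acf _) _; last first.
  have -> : eps = e * (T + 1) by rewrite /e divfK// gt_eqF.
  by lra.
move=> t t0 tT nUt; have Nt : ~ N t by move=> Nt; apply: nUt; apply: NU; left.
have {}t0 : 0 < t.
  rewrite lt_neqAle t0 andbT; apply/eqP => t00.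
  by apply: nUt; apply: NU; right; rewrite -t00.
have [h0 h00 hh] := good t t0 tT Nt e e0.
pose h := Num.min (h0 / 2) (T - t).
have hp : 0 < h by rewrite lt_min divr_gt0//= subr_gt0.
have hh0 : h <= h0 / 2 by rewrite ge_min lexx.
have hT : h <= T - t by rewrite ge_min lexx orbT.
by exists h => //; split; [lra|apply: hh => //; lra].
Qed.

Lemma ac_onB (R : realType) (T : R) (f g : R -> R) : ac_on T f -> ac_on T g ->
  ac_on T (fun t => f t - g t).
Proof.
move=> acf acg e e0; have e2 : 0 < e / 2 by rewrite divr_gt0.
have [d1 d10 h1] := acf _ e2; have [d2 d20 h2] := acg _ e2.
exists (Num.min d1 d2); first by rewrite lt_min d10.
move=> n a b ab tab; rewrite lt_min => /andP[s1 s2].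
apply: (@le_lt_trans _ _ (\sum_(i < n) `|f (b i) - f (a i)| + \sum_(i < n) `|g (b i) - g (a i)|)).
  rewrite -big_split; apply: ler_sum => i _ /=.
  have -> : f (b i) - g (b i) - (f (a i) - g (a i)) = (f (b i) - f (a i)) - (g (b i) - g (a i)) by ring.
  exact: ler_normB.
by have := h1 n a b ab tab s1; have := h2 n a b ab tab s2; lra.
Qed.

Lemma is_derive_estimate (R : realType) (V : normedModType R) (F : R -> V) (t : R) (l : V)
    (eta : R) : is_derive t 1 F l -> 0 < eta ->
  exists2 h0 : R, 0 < h0 & forall h, 0 < h -> h < h0 -> `|F (t + h) - F t - h *: l| <= eta * h.
Proof.
move=> dF eta0.
have cv : (fun h : R => h^-1 *: ((F \o shift t) (h *: 1) - F t)) @ 0^' --> l.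
  by rewrite -(@derive_val _ _ _ _ _ _ _ dF); exact: (@ex_derive _ _ _ _ _ _ _ dF).
have : \forall h \near 0^', `|l - h^-1 *: ((F \o shift t) (h *: 1) - F t)| < eta.
  by move/cvgrPdist_lt : cv; apply.
rewrite /dnbhs /within /= -nbhs_ballE => -[h0 /= h00 hh].
exists h0 => // h hp hh0; have hn : h != 0 by rewrite gt_eqF.
have := hh h; rewrite /ball/= sub0r normrN gtr0_norm// => /(_ hh0 hn) H.
have -> : F (t + h) - F t - h *: l = - (h *: (l - h^-1 *: (F (t + h) - F t))).
  by rewrite scalerBr scalerA mulfV// scale1r opprB.
rewrite normrN normrZ gtr0_norm// mulrC; apply/ltW; rewrite ltr_pM2r//.
have <- : (F \o shift t) (h *: 1) = F (t + h).
  by rewrite /= /shift addrC; congr (F (_ + _)); exact: mulr1.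
exact: H.
Qed.

Section primitive.
Variables (R : realType) (T : R) (g : R -> R).
Hypothesis T_gt0 : 0 < T.
Notation mu := (@lebesgue_measure R).
Hypothesis ig : mu.-integrable `]0, T[ (EFin \o g).

Let gT : R -> R := g \_ `]0, T[.

Let igT : mu.-integrable setT (EFin \o gT).
Proof. by rewrite /gT -restrict_EFin; apply/integrable_restrict => //=; rewrite setTI. Qed.

Definition primitive (x : R) : R := \int[mu]_(t in [set` Interval (BLeft 0) (BRight x)]) gT t.

Lemma primitive_ae : {ae mu, forall x : R, 0 < x -> is_derive (x : R^o) (1 : R^o) (primitive : R^o -> R^o) (gT x)}.
Proof.
have int y : mu.-integrable [set` Interval (BLeft 0) (BRight y)] (EFin \o gT).
  by apply: integrableS igT.
have := FTC1 int (integrable_locally _ ig : locally_integrable setT gT).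
move=> /(_ (measurable_itv _)); apply: filterS; first exact: (ae_filter_ringOfSetsType mu).
move=> x h x0.
have [h1 h2] : derivable (primitive : R -> R^o) x 1 /\ derive1 (primitive : R -> R^o) x = gT x.
  by apply: h; rewrite lte_fin.
by apply: (DeriveDef h1); rewrite -h2 derive1E.
Qed.

Lemma primitive0 : primitive 0 = 0.
Proof. by rewrite /primitive set_itv1 Rintegral_set1. Qed.

Lemma primitiveT : primitive T = \int[mu]_(t in `]0, T[) g t.
Proof.
rewrite /primitive /gT -Rintegral_mkcondr; congr (Rintegral _ _ _).
apply/seteqP; split => x /=; rewrite !in_itv/=; first by case.
by move=> /andP[h1 h2]; split; apply/andP; split => //; exact: ltW.
Qed.

Lemma primitive_ac : ac_on T primitive.
Proof.
move=> e e0; have [d [d0 hd]] := integral_normr_continuous igT e0.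
exists d => // n a b ab tab sd.
pose F i : set R := `]a i, b i[%classic.
have mF i : measurable (F i) by exact: measurable_itv.
have ableq i : a i <= b i by have [/andP[]] := ab i.
have LF i : mu (F i) = (b i - a i)%:E.
  rewrite /F lebesgue_measure_itv/= lte_fin; case: ltP => [//|ba].
  by rewrite (le_anti (introT andP (conj (ableq i) ba))) subrr.
have tF : trivIset [set` index_enum 'I_n] F by apply: sub_trivIset tab.
pose U := \big[setU/set0]_(i <- index_enum 'I_n) F i.
have mU : measurable U by apply: bigsetU_measurable => i _; exact: mF.
have igabs A : measurable A -> mu.-integrable A (EFin \o (fun x => `|gT x|)).
  move=> mA; have := integrable_norm igT; exact: integrableS.
have mabs A : measurable A -> measurable_fun A (fun x => `|gT x|%:E).
  by move=> mA; exact: measurable_int (igabs A mA).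
have muU : (mu U < d%:E)%E.
  apply: (@le_lt_trans _ _ (\sum_(i < n) (b i - a i)%:E)%E); last by rewrite sumEFin lte_fin.
  rewrite /U; elim: (index_enum _) => [|i s IH]; first by rewrite !big_nil measure0.
  have ms : measurable (\big[setU/set0]_(i <- s) F i) by apply: bigsetU_measurable => j _; exact: mF.
  rewrite !big_cons; apply: (@le_trans _ _ (mu (F i) + mu (\big[setU/set0]_(i <- s) F i))%E).
    by apply: measureU2; [exact: mF|exact: ms].
  by rewrite LF; apply: leeD.
have incr i : `|primitive (b i) - primitive (a i)| <= \int[mu]_(x in F i) `|gT x|.
  have [/andP[a0 _] _] := ab i.
  rewrite /primitive Rintegral_itvB; last 3 first.
  - by apply: integrableS igT.
  - by rewrite bnd_simp.
  - by rewrite bnd_simp.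
  rewrite -Rintegral_itv_bndo_bndc; last by apply: integrableS igT.
  by apply: le_normr_Rintegral => //; apply: integrableS igT.
apply: le_lt_trans (hd U mU muU); apply: le_trans (ler_sum _ (fun i _ => incr i)) _.
rewrite le_eqVlt; apply/orP; left; apply/eqP; apply: EFin_inj.
rewrite /U {2}/Rintegral fineK; last by apply: integrable_fin_num; [exact: mU|exact: igabs].
rewrite ge0_integral_bigsetU//; last 2 first.
- exact: index_enum_uniq.
- exact: mabs.
rewrite -sumEFin; apply: eq_bigr => i _.
by rewrite /Rintegral fineK//; apply: integrable_fin_num; [exact: mF|exact: (igabs _ (mF i))].
Qed.

(** The difference between f and a primitive of g has a nonpositive upper Dini
    derivative almost everywhere. *)
Lemma ac_le_integral (f : R -> R) : ac_on T f ->
  {ae mu, forall t, t \in `]0, T[ -> forall eta, 0 < eta ->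
     exists2 h0, 0 < h0 & forall h, 0 < h -> h < h0 -> f (t + h) - f t <= h * (g t + eta)} ->
  f T - f 0 <= \int[mu]_(t in `]0, T[) g t.
Proof.
move=> acf aef; rewrite -primitiveT.
have [N1 [mN1 N10 sN1]] := aef; have [N2 [mN2 N20 sN2]] := primitive_ae.
suff : f T - primitive T <= f 0 - primitive 0 by rewrite primitive0; lra.
apply: (@ac_nonincreasing _ _ (fun t => f t - primitive t) (N1 `|` N2)) => //.
- exact: ac_onB acf primitive_ac.
- exact: measurableU.
- apply/eqP; rewrite eq_le measure_ge0 andbT.
  apply: (@le_trans _ _ (mu N1 + mu N2)%E); first exact: measureU2.
  by rewrite N10 N20 adde0.
move=> t t0 tT nN eta eta0.
have tI : t \in `]0, T[ by rewrite in_itv/= t0.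
have dP : is_derive t 1 primitive (g t).
  have -> : g t = gT t by rewrite /gT patchE mem_set.
  by apply: contrapT => h; apply: nN; right; apply: sN2 => /= /(_ t0).
have eta2 : 0 < eta / 2 by rewrite divr_gt0.
have [h1 h10 fh] : exists2 h0, 0 < h0 & forall h, 0 < h -> h < h0 -> f (t + h) - f t <= h * (g t + eta / 2).
  by apply: contrapT => hh; apply: nN; left; apply: sN1 => /= /(_ tI _ eta2).
have [h2 h20 Ph] := is_derive_estimate dP eta2.
exists (Num.min h1 h2); first by rewrite lt_min h10.
move=> h h0; rewrite lt_min => /andP[hh1 hh2].
have := fh h h0 hh1; have := Ph h h0 hh2; rewrite ler_norml => /andP[+ _].
by rewrite /GRing.scale /=; lra.
Qed.

End primitive.

(** * Integrals of functions that are not known to be measurable *)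

Section lower_integrals.
Import HBNNSimple.

(** No measurability is needed of f, since its integral is defined by simple
    functions. *)
Lemma integral_le_simple d (T : measurableType d) (R : realType)
    (mu : {measure set T -> \bar R}) (D : set T) (f : T -> \bar R) (B : \bar R) :
  (forall h : {nnsfun T >-> R},
     (forall x, (h x)%:E <= (f \_ D)^\+ x)%E -> (sintegral mu h <= B)%E) ->
  (\int[mu]_(x in D) f x <= B)%E.
Proof.
move=> H; rewrite /integral.
have p : (ereal_sup [set sintegral mu h | h in
    [set h : {nnsfun T >-> R} | forall x, ((h x)%:E <= (f \_ D)^\+ x)%E]] <= B)%E.
  by apply: ge_ereal_sup => _ [h /= hf <-]; exact: H.
apply: le_trans p; rewrite -[leRHS]sube0; apply: leeB => //.
apply: ereal_sup_ubound; exists nnsfun0; last exact: sintegral0.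
by move=> x /=; rewrite funenegE le_max lexx orbT.
Qed.

Lemma ge0_le_integral_nonmeasurable d (T : measurableType d) (R : realType)
    (mu : {measure set T -> \bar R}) (f g : T -> \bar R) :
  (forall x, 0 <= f x)%E -> (forall x, f x <= g x)%E ->
  (\int[mu]_x f x <= \int[mu]_x g x)%E.
Proof.
move=> f0 fg; apply: integral_le_simple => h hf.
rewrite ge0_integralTE; last by move=> x; exact: le_trans (f0 x) (fg x).
apply: ereal_sup_ubound; exists h => // x /=; apply: le_trans (hf x) _.
by rewrite patch_setT funeposE max_l.
Qed.

Section interval.
Variables (R : realType) (T : R).
Notation mu := (@lebesgue_measure R).

Lemma lebesgue_itv_lty : (mu `]0%R, T[%classic < +oo)%E.
Proof. by rewrite lebesgue_measure_itv/=; case: ifP => _; rewrite ?ltry. Qed.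

(** A bounded measurable u below the integrand is integrable, so that
    differential inequalities can be integrated with u as right-hand side. *)
Lemma integral_itv_le (f : R -> \bar R) (B : R) :
  (forall u : R -> R, measurable_fun setT u -> (forall t, 0 <= u t) ->
     mu.-integrable `]0, T[ (EFin \o u) ->
     (forall t, t \in `]0, T[ -> ((u t)%:E <= maxe (f t) 0)%E) ->
     \int[mu]_(t in `]0, T[) u t <= B) ->
  (\int[mu]_(t in `]0%R, T[) f t <= B%:E)%E.
Proof.
move=> H; apply: integral_le_simple => h hf.
have mI : measurable (`]0, T[%classic : set R) by exact: measurable_itv.
have ih : mu.-integrable `]0, T[ (EFin \o h).
  apply: measurable_bounded_integrable => //; first exact: lebesgue_itv_lty.
    exact: measurable_funTS.
  have [M [Mr hM]] := simple_bounded h.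
  by exists M; split => // M' MM' x _; apply: hM.
have hD : (fun x => (h x)%:E) \_ `]0, T[ = (fun x => (h x)%:E).
  apply/funext => x; rewrite patchE; case: ifPn => // xD.
  have := hf x; rewrite funeposE patchE (negbTE xD) maxxx => h0.
  by apply/eqP; rewrite eq_le h0 lee_fin andbT.
rewrite -integralT_nnsfun -hD -integral_mkcond.
have -> : (\int[mu]_(x in `]0%R, T[) (h x)%:E)%E = (\int[mu]_(x in `]0, T[) h x)%:E.
  by rewrite /Rintegral fineK//; apply: integrable_fin_num ih.
have mh := @measurable_funP _ _ _ _ setT h.
rewrite lee_fin; apply: (H h mh) => // t tI.
by have := hf t; rewrite funeposE patchE mem_set.
Qed.

End interval.

End lower_integrals.

(** * Fields with finite Lipschitz norm *)

Section C01.
Variables (R : realType) (Om : planar_domain R).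
Hypothesis hOm : admissible_domain Om.
Implicit Types f g : R * R -> R * R.

Let supC f : \bar R := ereal_sup [set (enorm (f x))%:E | x in carrier Om].
Let supL f : \bar R := ereal_sup [set q | exists x y, [/\ carrier Om x, carrier Om y,
     0 < dist_domain Om x y & q = (enorm (f x - f y) / dist_domain Om x y)%:E]].

(** Keeps the second supremum in the definition of C01_norm from ranging over
    the empty set, where it would be -oo. *)
Lemma exists_distinct_points : exists x y, [/\ carrier Om x, carrier Om y &
  0 < dist_domain Om x y].
Proof.
have [p [s [s0 ps]]] := cell_box hOm.
have c1 : cell Om p by apply: ps; case: p => p1 p2; split; rewrite /= in_itv/=; apply/andP; split; lra.
pose q := (p.1 + s / 2, p.2).
have c2 : cell Om q by apply: ps; split; rewrite /= in_itv/=; apply/andP; split; lra.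
exists p, q; split; [exact: cell_sub_carrier|exact: cell_sub_carrier|].
rewrite lt_neqAle dist_domain_ge0 andbT; apply/eqP => /esym d0.
have Lk := dist_domain_eq0 hOm (cell_sub_carrier c1) (cell_sub_carrier c2) d0.
have : p - q = 0 by apply: (tiling_uniq hOm Lk c1); rewrite opprB addrC subrK.
move/(congr1 fst); rewrite /q /= => h; lra.
Qed.

Lemma supC_ge0 f : (0 <= supC f)%E.
Proof.
have [x [_ [Ox _ _]]] := exists_distinct_points.
by apply: le_trans (ereal_sup_ubound _); [|exists x; [exact: Ox|reflexivity]]; rewrite lee_fin enorm_ge0.
Qed.

Lemma supL_ge0 f : (0 <= supL f)%E.
Proof.
have [x [y [Ox Oy d0]]] := exists_distinct_points.
apply: le_trans (ereal_sup_ubound _); last by exists x, y; split; [exact: Ox|exact: Oy|exact: d0|reflexivity].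
by rewrite lee_fin divr_ge0// ?enorm_ge0// ltW.
Qed.

Lemma C01_norm_ge0 f : (0 <= C01_norm Om f)%E.
Proof. by apply: adde_ge0; [exact: supC_ge0|exact: supL_ge0]. Qed.

Lemma C01_normD f g : (C01_norm Om (fun x => f x + g x)%R <= C01_norm Om f + C01_norm Om g)%E.
Proof.
rewrite /C01_norm -!/(supC _) -!/(supL _) addeACA; apply: leeD.
  apply: ge_ereal_sup => _ [x Ox <-].
  apply: (@le_trans _ _ ((enorm (f x))%:E + (enorm (g x))%:E)%E).
    by rewrite -EFinD lee_fin enormD.
  by apply: leeD; apply: ereal_sup_ubound; exists x.
apply: ge_ereal_sup => _ [x [y [Ox Oy d0 ->]]].
apply: (@le_trans _ _ ((enorm (f x - f y) / dist_domain Om x y)%:E +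
   (enorm (g x - g y) / dist_domain Om x y)%:E)%E).
  rewrite -EFinD lee_fin -mulrDl ler_pM2r ?invr_gt0//.
  by rewrite opprD addrACA enormD.
by apply: leeD; apply: ereal_sup_ubound; exists x, y.
Qed.

Lemma C01_normN f : C01_norm Om (fun x => - f x) = C01_norm Om f.
Proof.
rewrite /C01_norm; congr (_ + _)%E; congr ereal_sup; apply/seteqP; split => q.
- by move=> [x Ox <-]; exists x => //; rewrite enormN.
- by move=> [x Ox <-]; exists x => //; rewrite enormN.
- by move=> [x [y [Ox Oy d0 ->]]]; exists x, y; split => //; rewrite -opprD enormN.
- by move=> [x [y [Ox Oy d0 ->]]]; exists x, y; split => //; rewrite -opprD enormN.
Qed.

Lemma C01_bounds f : C01 Om f -> let L := fine (C01_norm Om f) in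
  [/\ 0 <= L, forall x, carrier Om x -> enorm (f x) <= L,
    forall x y, carrier Om x -> carrier Om y -> enorm (f x - f y) <= L * enorm (x - y) &
    forall x k, lattice Om k -> carrier Om x -> f (x + k) = f x].
Proof.
move=> [per fin] L; have nL : C01_norm Om f = L%:E.
  by rewrite /L fineK// ge0_fin_numE// C01_norm_ge0.
have L0 : 0 <= L by rewrite -lee_fin -nL C01_norm_ge0.
split => //.
- move=> x Ox; rewrite -lee_fin -nL; apply: (@le_trans _ _ (supC f)).
    by apply: ereal_sup_ubound; exists x.
  by rewrite /C01_norm -/(supL f) -/(supC f) leeDl// supL_ge0.
- move=> x y Ox Oy; have [d0|] := ltP 0 (dist_domain Om x y).
    apply: (@le_trans _ _ (L * dist_domain Om x y)); last first.
      by rewrite ler_wpM2l// dist_domain_le_enorm.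
    rewrite -ler_pdivrMr// -lee_fin -nL; apply: (@le_trans _ _ (supL f)).
      by apply: ereal_sup_ubound; exists x, y.
    by rewrite /C01_norm -/(supL f) -/(supC f) leeDr// supC_ge0.
  move=> d0; have {}d0 : dist_domain Om x y = 0.
    by apply/eqP; rewrite eq_le d0 dist_domain_ge0.
  have Lk := dist_domain_eq0 hOm Ox Oy d0.
  have -> : f x = f y by rewrite -(per _ Lk y) addrC subrK.
  by rewrite subrr enorm0 mulr_ge0// enorm_ge0.
- by move=> x k Lk _; exact: per.
Qed.

End C01.

Section bochner.
Variables (R : realType) (Om : planar_domain R).
Hypothesis hOm : admissible_domain Om.
Notation mu := (@lebesgue_measure R).

(** The field s t, hence its norm, depends only on the set of indices i such
    that t belongs to E i, and there are finitely many of them. *)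
Lemma measurable_C01_norm_simple (s : R -> R * R -> R * R) : C01_simple Om s ->
  measurable_fun [set: R] (fun t => C01_norm Om (s t)).
Proof.
move=> [n [E [f [mE _ sE]]]].
pose g (a : {ffun 'I_n -> bool}) : \bar R :=
  C01_norm Om (fun x => \sum_(i < n) ((a i)%:R : R) *: f i x).
have gE t : C01_norm Om (s t) = g [ffun i => t \in E i].
  rewrite /g; congr (C01_norm Om _); apply/funext => x; rewrite sE.
  by apply: eq_bigr => i _; rewrite ffunE indicE.
move=> _ Y mY; rewrite setTI.
have -> : (fun t => C01_norm Om (s t)) @^-1` Y =
    \bigcup_(a in [set: {ffun 'I_n -> bool}])
      (if `[< Y (g a) >] then [set t | forall i : 'I_n, (if a i then E i else ~` E i) t] else set0).
  apply/seteqP; split => t.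
    rewrite /preimage /= gE => Yt; exists [ffun i => t \in E i] => //.
    case: ifPn => [_ i|/asboolP //]; rewrite ffunE.
    by case: ifPn => [/set_mem//|/negP tE]; move=> Et; apply: tE; exact: mem_set.
  move=> [a _]; case: ifPn => // /asboolP Ya at_; rewrite /preimage /= gE.
  have <- // : a = [ffun i => t \in E i].
  apply/ffunP => i; rewrite ffunE; have := at_ i.
  by case: (a i) => [/mem_set ->//|nE]; apply/esym/negbTE/negP => /set_mem.
apply: countable_bigcupT_measurable => [|a]; first exact: countableP.
case: ifPn => _; last exact: measurable0.
apply: measurable_forall => [|i]; first exact: countableP.
by case: (a i) => //; apply: measurableC.
Qed.

Lemma C01_norm_cvg (v : R * R -> R * R) (s : nat -> R * R -> R * R) : C01 Om v ->
  (C01_norm Om (fun x => v x - s k x)%R @[k --> \oo] --> 0)%E ->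
  C01_norm Om (s k) @[k --> \oo] --> C01_norm Om v.
Proof.
move=> [_ fin] cv; set n := C01_norm Om v.
have nfin : n \is a fin_num by rewrite ge0_fin_numE// C01_norm_ge0.
pose e k := C01_norm Om (fun x => v x - s k x).
have up k : (C01_norm Om (s k) <= n + e k)%E.
  have -> : C01_norm Om (s k) = C01_norm Om (fun x => v x + - (v x - s k x)).
    by congr (C01_norm Om _); apply/funext => x; rewrite opprB addrC subrK.
  by apply: le_trans (C01_normD _ _ _) _; rewrite C01_normN.
have down k : (n - e k <= C01_norm Om (s k))%E.
  have n_le : (n <= C01_norm Om (s k) + e k)%E.
    have -> : n = C01_norm Om (fun x => s k x + (v x - s k x)).
      by apply: (congr1 (C01_norm Om)); apply/funext => x; rewrite addrC subrK.
    exact: C01_normD.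
  have [ef|] := boolP (e k \is a fin_num); first by rewrite leeBlDr.
  rewrite ge0_fin_numE ?C01_norm_ge0// -leNgt leye_eq => /eqP ->.
  by rewrite -(fineK nfin) addeNy leNye.
apply: (squeeze_cvge (f := fun k => (n - e k)%E) (h := fun k => (n + e k)%E)).
- by near=> k; rewrite up down.
- rewrite -[X in _ --> X]sube0; apply: cvgeB; [|exact: cvg_cst|exact: cv].
  by first [exact: fin_num_adde_defl|exact: fin_num_adde_defr].
- rewrite -[X in _ --> X]adde0; apply: cvgeD; [|exact: cvg_cst|exact: cv].
  by first [exact: fin_num_adde_defl|exact: fin_num_adde_defr].
Unshelve. all: by end_near. Qed.

(** The norm of v t is almost everywhere a limit of norms of simple fields,
    hence measurable; outside the null set l equals it. *)
Lemma L1_C01_majorant (T : R) (v : R -> R * R -> R * R) : L1_C01 Om T v ->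
  exists (l : R -> R) (N : set R), [/\ measurable N, mu N = 0%E,
    mu.-integrable `]0, T[ (EFin \o l),
    forall t, t \in `]0, T[ -> ~ N t -> C01 Om (v t) /\ l t = fine (C01_norm Om (v t)) &
    \int[mu]_(t in `]0, T[) l t <= Lambda Om v T].
Proof.
move=> [[N1 [mN1 N10 sN1]] [s ss [N2 [mN2 N20 sN2]]] fin].
pose N := N1 `|` N2; have mN : measurable N by exact: measurableU.
pose I : set R := `]0, T[%classic `\` N.
have mI : measurable I by apply: measurableD => //; exact: measurable_itv.
have good t : I t -> C01 Om (v t) /\ C01_norm Om (s k t) @[k --> \oo] --> C01_norm Om (v t).
  move=> [tI nN]; have tI' : t \in `]0, T[ by [].
  have c1 : C01 Om (v t) by apply: contrapT => h; apply: nN; left; apply: sN1 => /= /(_ tI').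
  split => //; apply: C01_norm_cvg => //.
  by apply: contrapT => h; apply: nN; right; apply: sN2 => /= /(_ tI').
pose n t := C01_norm Om (v t).
have mn : measurable_fun I n.
  apply: (emeasurable_fun_cvg (fun k t => C01_norm Om (s k t))).
    by move=> k; apply: measurable_funTS; exact: measurable_C01_norm_simple.
  by move=> t /good[].
pose l := (fine \o n) \_ I.
have l0 t : 0 <= l t by rewrite /l patchE; case: ifP => // _; rewrite fine_ge0// C01_norm_ge0.
have ml : measurable_fun setT l.
  by apply/(measurable_restrictT _ mI); apply: measurableT_comp.
have le_l : (\int[mu]_(t in `]0%R, T[) (l t)%:E <= \int[mu]_(t in `]0%R, T[) n t)%E.
  rewrite [leLHS]integral_mkcond [leRHS]integral_mkcond.
  apply: ge0_le_integral_nonmeasurable => t.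
    by rewrite patchE; case: ifP => // _; rewrite lee_fin.
  rewrite !patchE; case: ifPn => // _; rewrite /l patchE.
  case: ifPn => [/set_mem /good [[_ nf] _]|_]; last exact: C01_norm_ge0.
  by rewrite /= fineK// ge0_fin_numE// C01_norm_ge0.
have il : mu.-integrable `]0, T[ (EFin \o l).
  apply/integrableP; split; first by apply/measurable_EFinP; exact: measurable_funTS.
  apply: le_lt_trans fin; apply: le_trans le_l.
  by rewrite le_eqVlt; apply/orP; left; apply/eqP; apply: eq_integral => t _; rewrite /= ger0_norm.
exists l, N; split => //.
- apply/eqP; rewrite eq_le measure_ge0 andbT.
  by apply: (@le_trans _ _ (mu N1 + mu N2)%E); [exact: measureU2|rewrite N10 N20 adde0].
- move=> t tI nN; have It : I t by split.
  by have [c1 _] := good t It; split => //; rewrite /l patchE mem_set.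
- rewrite /Lambda -lee_fin [leRHS]fineK; last first.
    have i0 : (0 <= \int[mu]_(t in `]0%R, T[) n t)%E.
      by apply: integral_ge0 => t _; exact: (C01_norm_ge0 hOm).
    by rewrite (ge0_fin_numE i0).
  by apply: le_trans le_l; rewrite /Rintegral fineK//; exact: integrable_fin_num il.
Qed.

Lemma Lambda_ge0 (v : R -> R * R -> R * R) t : 0 <= Lambda Om v t.
Proof. by rewrite /Lambda fine_ge0//; apply: integral_ge0 => s _; exact: C01_norm_ge0. Qed.

End bochner.

(** * Dissipation along the flow *)

Section configuration_estimates.
Variables (R : realType) (Om : planar_domain R) (N : nat).
Hypothesis hOm : admissible_domain Om.
Hypothesis N0 : (0 < N)%N.
Variable D : R.
Hypothesis D_ge0 : 0 <= D.
Let S := area (cell Om).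
Implicit Types X Y : conf Om N.

(** The properties shared by all configurations along the flow, with D of the
    order of the mesh size. *)
Definition regular_conf X : Prop :=
  [/\ conf_in Om N X, distinct_generators X, max_diameter X <= D &
      forall i, 0 < volume X i].

(** The centroid is the average of points at distance at most D from X i. *)
Lemma displacement_le X i : regular_conf X -> enorm (displacement X i) <= D.
Proof.
move=> [hX dX XD V0]; have [d1 d2] := volume_displacement hOm hX dX (V0 i).
set d := displacement X i in d1 d2 *.
have [k1 k2] := integrable_coord hOm hX dX i.
have mv := @measurable_vcell _ _ _ X hOm i.
have l1 := plane_integrableZl mv d.1 k1; have l2 := plane_integrableZl mv d.2 k2.
have [->|dn] := eqVneq (enorm d) 0; first by [].
have d0 : 0 < enorm d by rewrite lt_def dn enorm_ge0.
have E : volume X i * enorm d ^+ 2 =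
    \int[leb2 R]_(y in vcell X i) (d.1 * (y.1 - (X i).1) + d.2 * (y.2 - (X i).2)).
  rewrite (plane_RintegralD mv l1 l2) (plane_RintegralZl mv _ k1) (plane_RintegralZl mv _ k2).
  by rewrite -d1 -d2 enorm_sqr; ring.
have le : volume X i * enorm d ^+ 2 <= D * enorm d * volume X i.
  have -> : D * enorm d * volume X i = \int[leb2 R]_(y in vcell X i) (D * enorm d).
    by rewrite Rintegral_cst// leb2_vcell.
  rewrite E; apply: le_Rintegral => //.
  - exact: (plane_integrableD mv l1 l2).
  - by apply: (integrable_vcell hOm dX (M := `|D * enorm d|)).
  move=> y vy; apply: le_trans (ler_norm _) _.
  have -> : d.1 * (y.1 - (X i).1) + d.2 * (y.2 - (X i).2) = dot (y - X i) d by rewrite /dot /=; ring.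
  apply: le_trans (dot_le_enorm _ _) _; rewrite ler_wpM2r ?enorm_ge0//.
  exact: le_trans (vcell_enorm_le hOm hX dX vy) XD.
have : (volume X i * enorm d) * enorm d <= (volume X i * enorm d) * D.
  by move: le; rewrite expr2; lra.
by rewrite ler_pM2l// mulr_gt0.
Qed.

Lemma volume_le_area X i : regular_conf X -> volume X i <= S.
Proof.
move=> [hX dX XD V0]; rewrite /S -(sum_volume hOm dX N0) (bigD1 i)//= lerDl.
by apply: sumr_ge0 => j _; exact: ltW.
Qed.

Lemma energy_ge0 X : conf_in Om N X -> 0 <= energy X.
Proof. by move=> hX; apply: Rintegral_ge0 => x _; exact: cost_ge0. Qed.

Lemma energy_le X : regular_conf X -> energy X <= D ^+ 2 * S.
Proof.
move=> [hX dX XD V0]; rewrite (energy_vcells hOm N0 hX dX) /S -(sum_volume hOm dX N0) mulr_sumr.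
apply: ler_sum => i _; have mv := @measurable_vcell _ _ _ X hOm i.
have [M hM] := cost_bound hOm N0 hX.
have -> : D ^+ 2 * volume X i = \int[leb2 R]_(y in vcell X i) (D ^+ 2).
  by rewrite Rintegral_cst// leb2_vcell.
apply: le_Rintegral => //.
- apply: (integrable_vcell hOm dX (M := M)); first by apply: measurable_funTS; exact: measurable_cost.
  by move=> y /vcell_sub_carrier Oy; rewrite ger0_norm ?cost_ge0 ?hM.
- by apply: (integrable_vcell hOm dX (M := `|D ^+ 2|)).
move=> y vy; rewrite (cost_vcell hOm N0 dX vy).
rewrite lerXn2r ?nnegrE ?enorm_ge0//.
exact: le_trans (vcell_enorm_le hOm hX dX vy) XD.
Qed.

Lemma energy_incr X Y : regular_conf X -> conf_in Om N Y ->
  (forall i, enorm (Y i - X i) <= 1) ->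
  energy Y - energy X <= S * (1 + 2 * D) * \sum_(i < N) enorm (Y i - X i).
Proof.
move=> rX hY small; have [hX dX XD V0] := rX.
apply: le_trans (energy_semiconcave hOm N0 hX hY dX V0) _.
rewrite mulr_sumr; apply: ler_sum => i _.
have a0 := enorm_ge0 (Y i - X i); have a1 := small i.
have dd := dot_le_enorm (Y i - X i) (displacement X i).
have dD := displacement_le i rX; have VS := volume_le_area i rX; have V := V0 i.
have : - dot (Y i - X i) (displacement X i) <= enorm (Y i - X i) * D.
  have h1 := ler_normr (dot (Y i - X i) (displacement X i)) (- dot (Y i - X i) (displacement X i)).
  apply: (@le_trans _ _ `|dot (Y i - X i) (displacement X i)|).
    by rewrite -normrN ler_norm.
  by apply: le_trans dd _; rewrite ler_wpM2l.
move: (enorm (Y i - X i)) (dot _ _) (volume X i) a0 a1 VS V => a b w a0 a1 wS w0 hb.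
have aa : a ^+ 2 <= a by rewrite expr2 ler_piMl.
apply: (@le_trans _ _ (w * (a * (1 + 2 * D)))).
  by rewrite ler_pM2l//; lra.
have -> : S * (1 + 2 * D) * a = S * (a * (1 + 2 * D)) by ring.
by apply: ler_wpM2r => //; rewrite mulr_ge0// addr_ge0// mulr_ge0.
Qed.

End configuration_estimates.

Lemma finite_choose_pos (R : realType) (n : nat) (P : 'I_n -> R -> Prop) :
  (forall i (d d' : R), 0 < d' -> d' <= d -> P i d -> P i d') ->
  (forall i, exists2 d : R, 0 < d & P i d) ->
  exists2 d : R, 0 < d & forall i, P i d.
Proof.
move=> mono ex; pose d i := projT1 (cid2 (ex i)).
have dP i : 0 < d i /\ P i (d i) by rewrite /d; case: (cid2 (ex i)).
exists (\big[Num.min/1]_(i < n) d i).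
  by elim/big_ind: _ => // [x y x0 y0|i _]; [rewrite lt_min x0|have [] := dP i].
move=> i; apply: (mono i (d i)).
- by elim/big_ind: _ => // [x y x0 y0|j _]; [rewrite lt_min x0|have [] := dP j].
- by rewrite (bigD1 i)//= ge_min lexx.
- by have [] := dP i.
Qed.

Lemma ler_norm_two_sided (R : realType) (x y u w : R) :
  x - y <= u -> y - x <= u -> 0 <= w -> `|x - y| <= u + w.
Proof. by move=> h1 h2 w0; rewrite ler_norml; apply/andP; split; lra. Qed.

Lemma dini_algebra (R : realType) (n : nat) (V q e2 b : 'I_n -> R) (S h eta' W D : R) :
  0 < h -> (forall i, 0 <= V i) -> \sum_i V i = S -> 0 <= eta' ->
  (forall i, e2 i <= h ^+ 2 * W) -> (forall i, - q i <= h * (- b i) + 2 * eta' * h * D) ->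
  \sum_i V i * (e2 i - 2 * q i) <=
    h * (- 2 * \sum_i V i * b i + S * (h * W + 4 * eta' * D)).
Proof.
move=> h0 V0 VS eta0 he hq; rewrite -VS mulr_suml mulr_sumr -big_split /= mulr_sumr.
apply: ler_sum => i _; have h1 := he i; have h2 := hq i.
have -> : h * (- 2 * (V i * b i) + V i * (h * W + 4 * eta' * D)) =
  V i * (h ^+ 2 * W - 2 * h * b i + 4 * eta' * h * D) by ring.
by apply: ler_wpM2l => //; lra.
Qed.

Lemma enorm_le_norm (R : realType) (z : R * R) : enorm z <= 2 * `|z|.
Proof.
apply: le_trans (enorm_le_coord z) _; rewrite prod_normE.
have : `|z.1| <= Num.max `|z.1| `|z.2| by rewrite le_max lexx.
have : `|z.2| <= Num.max `|z.1| `|z.2| by rewrite le_max lexx orbT.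
lra.
Qed.

Lemma dini_integrand_le (R : realType) (L a b y u : R) : u <= y ->
  2 * (L * a * b) - 2 * y <= 2 * (a * b) * L + (-2) * u.
Proof. by move=> uy; lra. Qed.

Lemma energy_balance_le (R : realType) (eT e0 E C l Lam u : R) :
  eT - e0 <= 2 * C * l + (-2) * u -> C * l <= C * Lam -> e0 <= E -> 0 <= eT -> 0 <= E ->
  u <= E + C * Lam.
Proof. by move=> *; lra. Qed.

Section trajectory.
Variables (R : realType) (Om : planar_domain R) (N : nat).
Hypothesis hOm : admissible_domain Om.
Hypothesis N0 : (0 < N)%N.
Variables (D T : R) (v : R -> R * R -> R * R) (alpha : R -> R) (X0 : conf Om N)
  (X : R -> conf Om N) (r : R).
Hypothesis D_ge0 : 0 <= D.
Hypothesis T_gt0 : 0 < T.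
Hypothesis r_ge0 : 0 <= r.
Hypothesis cell_r : in_square (cell Om) r.
Hypothesis Xreg : forall t, t \in `[0, T] -> regular_conf D (X t).
Hypothesis Xsol : lloyd_solution T v alpha X0 X.
Hypothesis hv : L1_C01 Om T v.
Let S := area (cell Om).
Notation mu := (@lebesgue_measure R).

(** By energy_incr, used from either end, the energy is Lipschitz along small
    displacements. *)
Lemma energy_trajectory_ac : ac_on T (fun t => energy (X t)).
Proof.
move=> e e0; have [_ Xac _ _] := Xsol.
pose K := S * (1 + 2 * D) + 1.
have S0 : 0 < S by exact: area_cell_gt0.
have K0 : 0 < K by rewrite ltr_wpDl// mulr_ge0 ?addr_ge0 ?mulr_ge0// ltW.
pose e' := Num.min 1 (e / (K * N.+1%:R)).
have e'0 : 0 < e' by rewrite lt_min ltr01 divr_gt0// mulr_gt0.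
pose P (i : 'I_N) (d : R) := forall (n : nat) (a b : 'I_n -> R),
  (forall l, 0 <= a l <= b l /\ b l <= T) -> trivIset setT (fun l => `]a l, b l[%classic) ->
  \sum_(l < n) (b l - a l) < d -> \sum_(l < n) enorm (X (b l) i - X (a l) i) < e'.
have [|i|d d0 dP] := @finite_choose_pos R N P.
- move=> i d d' d'0 dd' Pd n a b ab tab s; apply: Pd => //; exact: lt_le_trans dd'.
- exact: Xac.
exists d => // n a b ab tab sd.
have small l i : enorm (X (b l) i - X (a l) i) <= 1.
  have := dP i n a b ab tab sd; rewrite (bigD1 l)//= => h.
  have : \sum_(l' < n | l' != l) enorm (X (b l') i - X (a l') i) >= 0.
    by apply: sumr_ge0 => l' _; exact: enorm_ge0.
  have : e' <= 1 by rewrite ge_min lexx.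
  by lra.
have inI l : a l \in `[0, T] /\ b l \in `[0, T].
  have [/andP[a0 ab'] bT] := ab l; rewrite !in_itv/= a0 bT (le_trans a0 ab').
  by rewrite (le_trans ab' bT).
have incr l : `|energy (X (b l)) - energy (X (a l))| <=
    K * \sum_(i < N) enorm (X (b l) i - X (a l) i).
  have [aI bI] := inI l; have ra := Xreg aI; have rb := Xreg bI.
  have h1 := energy_incr hOm N0 D_ge0 ra (let: And4 h _ _ _ := rb in h) (small l).
  have small' i : enorm (X (a l) i - X (b l) i) <= 1 by rewrite -enormN opprB.
  have h2 := energy_incr hOm N0 D_ge0 rb (let: And4 h _ _ _ := ra in h) small'.
  have E : \sum_(i < N) enorm (X (a l) i - X (b l) i) = \sum_(i < N) enorm (X (b l) i - X (a l) i).
    by apply: eq_bigr => i _; rewrite -enormN opprB.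
  rewrite E in h2.
  have s0 : 0 <= \sum_(i < N) enorm (X (b l) i - X (a l) i).
    by apply: sumr_ge0 => i _; exact: enorm_ge0.
  by rewrite /K mulrDl mul1r; exact: (ler_norm_two_sided h1 h2 s0).
apply: le_lt_trans (ler_sum _ (fun l _ => incr l)) _.
rewrite -mulr_sumr exchange_big /=.
apply: (@le_lt_trans _ _ (K * \sum_(i < N) e')).
  by rewrite ler_pM2l//; apply: ler_sum => i _; exact/ltW/dP.
rewrite sumr_const card_ord -(mulr_natr e' N).
have le1 : e' <= e / (K * N.+1%:R) by rewrite ge_min lexx orbT.
apply: (@le_lt_trans _ _ (K * (e / (K * N.+1%:R) * N%:R))).
  by rewrite ler_pM2l// ler_wpM2r.
have Kn : K != 0 by rewrite gt_eqF.
have E2 (m k : R) : m != 0 -> K * (e / (K * m) * k) = e * (k / m).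
  by clearbody K => mn; field; rewrite Kn mn.
rewrite E2 ?pnatr_eq0//.
by rewrite gtr_pMr// ltr_pdivrMr// mul1r ltr_nat.
Qed.

(** energy_semiconcave to first order in h: the relaxation term produces the
    centroid defect, and flux_bound takes care of the field v. *)
Lemma energy_trajectory_dini (t eta : R) : t \in `]0, T[ -> C01 Om (v t) ->
  (forall i, is_derive t 1 (fun s => X s i) (v t (X t i) + alpha t *: displacement (X t) i)) ->
  0 < eta ->
  exists2 h0, 0 < h0 & forall h, 0 < h -> h < h0 -> energy (X (t + h)) - energy (X t) <=
    h * (2 * (fine (C01_norm Om (v t)) * D ^+ 2 * (3 * S + 4 * r)) -
         2 * (alpha t * centroid_defect (X t)) + eta).
Proof.
move=> tI cv dX eta0; have /andP[t0 tT] : 0 < t < T by move: tI; rewrite in_itv.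
have S0 : 0 < S by exact: area_cell_gt0.
have rt : regular_conf D (X t) by apply: Xreg; rewrite in_itv/= !ltW.
have [hX dXt XD V0] := rt.
pose w i := v t (X t i) + alpha t *: displacement (X t) i.
pose b i := dot (w i) (displacement (X t) i).
have SD0 : 0 <= S * D by rewrite mulr_ge0// ltW.
pose eta' := eta / (8 * (S * D + 1)).
have eta'0 : 0 < eta' by rewrite divr_gt0// mulr_gt0// ltr_wpDl.
pose W := (\sum_(i < N) enorm (w i) + 2 * eta') ^+ 2.
have W0 : 0 <= W by exact: sqr_ge0.
have sw0 : 0 <= \sum_(i < N) enorm (w i) + 2 * eta'.
  apply: addr_ge0; first by apply: sumr_ge0 => j _; exact: enorm_ge0.
  by apply: mulr_ge0 => //; exact: ltW.
have SW0 : 0 <= S * W by rewrite mulr_ge0// ltW.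
pose P (i : 'I_N) (d : R) := forall h, 0 < h -> h < d ->
  `|X (t + h) i - X t i - h *: w i| <= eta' * h.
have [|i|d d0 dP] := @finite_choose_pos R N P.
- by move=> i d d' d'0 dd' Pd h h0 hd; apply: Pd => //; exact: lt_le_trans hd dd'.
- exact: (is_derive_estimate (dX i) eta'0).
pose h1 := eta / (2 * (S * W + 1)).
have h10 : 0 < h1 by rewrite divr_gt0// mulr_gt0// ltr_wpDl.
exists (Num.min d (Num.min (T - t) h1)); first by rewrite !lt_min d0 subr_gt0 tT.
move=> h h0; rewrite !lt_min => /and3P[hd hT hh1].
have rth : regular_conf D (X (t + h)).
  by apply: Xreg; rewrite in_itv/=; apply/andP; split; lra.
have [hXh _ _ _] := rth.
apply: le_trans (energy_semiconcave hOm N0 hX hXh dXt V0) _.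
have rem i : enorm (X (t + h) i - X t i - h *: w i) <= 2 * eta' * h.
  by apply: le_trans (enorm_le_norm _) _; have := dP i h h0 hd; lra.
have e2le i : enorm (X (t + h) i - X t i) ^+ 2 <= h ^+ 2 * W.
  rewrite /W -exprMn lerXn2r ?nnegrE ?enorm_ge0//.
    by apply: mulr_ge0 => //; exact: ltW.
  have := enormD (X (t + h) i - X t i - h *: w i) (h *: w i); rewrite subrK => le.
  apply: le_trans le _; rewrite enormZ (gtr0_norm h0).
  have : enorm (w i) <= \sum_(j < N) enorm (w j).
    by rewrite (bigD1 i)//= lerDl; apply: sumr_ge0 => j _; exact: enorm_ge0.
  move=> hw; rewrite mulrDr addrC; apply: lerD; first by rewrite ler_pM2l.
  by rewrite [h * _]mulrC; exact: rem.
have qle i : - dot (X (t + h) i - X t i) (displacement (X t) i) <=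
    h * (- b i) + 2 * eta' * h * D.
  have -> : dot (X (t + h) i - X t i) (displacement (X t) i) =
      h * b i + dot (X (t + h) i - X t i - h *: w i) (displacement (X t) i).
    by rewrite /b /dot /= /GRing.scale /=; ring.
  have h2 : `|dot (X (t + h) i - X t i - h *: w i) (displacement (X t) i)| <= 2 * eta' * h * D.
    apply: le_trans (dot_le_enorm _ _) _; apply: ler_pM; rewrite ?enorm_ge0//.
    exact: (displacement_le hOm D_ge0 i rt).
  by move: h2; rewrite ler_norml => /andP[h3 _]; lra.
have VS := sum_volume hOm dXt N0.
apply: le_trans (dini_algebra h0 (fun i => ltW (V0 i)) VS (ltW eta'0) e2le qle) _.
rewrite ler_pM2l// -/S.
have [L0 vL vlip vper] := C01_bounds hOm cv.
have fl := flux_bound hOm N0 hX dXt D_ge0 L0 r_ge0 cell_r XD V0 vL vlip vper.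
have sb : \sum_(i < N) volume (X t) i * b i =
    \sum_(i < N) volume (X t) i * dot (displacement (X t) i) (v t (X t i)) +
    alpha t * centroid_defect (X t).
  rewrite /centroid_defect mulr_sumr -big_split /=; apply: eq_bigr => i _.
  by rewrite enorm_sqr /b /w /dot /= /GRing.scale /=; ring.
rewrite sb; rewrite -/S in fl.
have s1 : S * (h * W) <= eta / 2.
  have -> : S * (h * W) = h * (S * W) by ring.
  apply: (@le_trans _ _ (h1 * (S * W))); first by rewrite ler_wpM2r// ltW.
  rewrite /h1 mulrAC ler_pdivrMr ?mulr_gt0 ?ltr_wpDl//.
  have -> : eta / 2 * (2 * (S * W + 1)) = eta * (S * W) + eta by field.
  by rewrite lerDl ltW.
have s2 : S * (4 * eta' * D) <= eta / 2.
  have -> : S * (4 * eta' * D) = 4 * (S * D) * eta / (8 * (S * D + 1)).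
    by rewrite /eta'; field; rewrite gt_eqF// ltr_wpDl.
  rewrite ler_pdivrMr ?mulr_gt0 ?ltr_wpDl//.
  by move: (S * D) SD0 => z z0; nra.
move: fl s1 s2; move: (\sum_(i < N) _ * dot _ _) (alpha t * _) => A B.
rewrite [S * (h * W + _)]mulrDr; move: (S * (h * W)) (S * (4 * eta' * D)) => u1 u2.
by move: (_ * D ^+ 2 * _) => Z; lra.
Qed.

(** Integration of energy_trajectory_dini, with u in place of the possibly
    nonmeasurable dissipation; the energy is at most D ^+ 2 * S at the
    beginning and nonnegative at the end. *)
Lemma dissipation_bound (u : R -> R) : mu.-integrable `]0, T[ (EFin \o u) ->
  {ae mu, forall t, t \in `]0, T[ -> u t <= alpha t * centroid_defect (X t)} ->
  \int[mu]_(t in `]0, T[) u t <=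
    D ^+ 2 * S + D ^+ 2 * (3 * S + 4 * r) * Lambda Om v T.
Proof.
move=> iu aeu.
have [l [M [mM M0 il lE lL]]] := L1_C01_majorant hOm hv.
have [_ _ aed _] := Xsol.
pose C := D ^+ 2 * (3 * S + 4 * r).
have mI : measurable (`]0, T[%classic : set R) by exact: measurable_itv.
pose g t := 2 * C * l t + (-2) * u t.
have il' : mu.-integrable `]0, T[ (EFin \o (fun t => 2 * C * l t)).
  exact: (@integrableZl _ _ _ mu _ mI (2 * C) _ il).
have iu' : mu.-integrable `]0, T[ (EFin \o (fun t => (-2) * u t)).
  exact: (@integrableZl _ _ _ mu _ mI (-2) _ iu).
have ig : mu.-integrable `]0, T[ (EFin \o g).
  exact: (@integrableD _ _ _ mu _ mI _ _ il' iu').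
have gE : \int[mu]_(t in `]0, T[) g t = 2 * C * \int[mu]_(t in `]0, T[) l t +
    (-2) * \int[mu]_(t in `]0, T[) u t.
  by rewrite /g RintegralD// !RintegralZl.
have := ac_le_integral T_gt0 ig energy_trajectory_ac _.
rewrite gE => H.
have {}H := H _.
have e0 : energy (X 0) <= D ^+ 2 * S.
  by apply: (energy_le hOm N0 D_ge0); apply: Xreg; rewrite in_itv/= lexx ltW.
have eT : 0 <= energy (X T).
  have [hXT _ _ _] : regular_conf D (X T) by apply: Xreg; rewrite in_itv/= lexx ltW.
  exact: energy_ge0.
have C0 : 0 <= C.
  by rewrite mulr_ge0 ?sqr_ge0// addr_ge0 ?mulr_ge0// ltW// area_cell_gt0.
have CL : C * \int[mu]_(t in `]0, T[) l t <= C * Lambda Om v T by rewrite ler_wpM2l.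
have DS : 0 <= D ^+ 2 * S by rewrite mulr_ge0 ?sqr_ge0// ltW// area_cell_gt0.
have ineq : energy (X T) - energy (X 0) <= 2 * C * \int[mu]_(t in `]0, T[) l t +
    (-2) * \int[mu]_(t in `]0, T[) u t.
  apply: H.
  have [M1 [mM1 M10 sM1]] := aeu; have [M2 [mM2 M20 sM2]] := aed.
  have mMM : measurable (M `|` (M1 `|` M2)) by do 2 apply: measurableU => //.
  exists (M `|` (M1 `|` M2)); split => //.
    apply/eqP; rewrite eq_le measure_ge0 andbT.
    apply: (@le_trans _ _ (mu M + mu (M1 `|` M2))%E).
      by apply: measureU2 => //; exact: measurableU.
    rewrite M0 add0e; apply: (@le_trans _ _ (mu M1 + mu M2)%E); first exact: measureU2.
    by rewrite M10 M20 adde0.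
  move=> t nP; apply: contrapT => nM; apply: nP => tI eta eta0.
  have [cv lt] := lE t tI (fun h => nM (or_introl h)).
  have ut : u t <= alpha t * centroid_defect (X t).
    by apply: contrapT => h; apply: nM; right; left; apply: sM1 => /= /(_ tI).
  have dX i : is_derive t 1 (fun s => X s i) (v t (X t i) + alpha t *: displacement (X t) i).
    by apply: contrapT => h; apply: nM; right; right; apply: sM2 => /= /(_ tI i).
  have [h0 h00 hh] := energy_trajectory_dini tI cv dX eta0.
  exists h0 => // h hp hlt; apply: le_trans (hh h hp hlt) _.
  rewrite ler_pM2l// lerD2r /g lt /C.
  exact: (dini_integrand_le _ _ _ ut).
exact: (energy_balance_le ineq CL e0 eT DS).
Qed.

End trajectory.

(** * The transport error *)

(** If x <= b * y the quadratic term is enough. Otherwise z = x / b is larger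
    than y, and the first term is x * z `^ (m - 1) >= x * y, as 0 < m - 1 <= 1
    and y <= 1. *)
Lemma young_small (R : realType) (m b x y : R) : 1 < m -> m <= 2 -> 0 < b ->
  0 <= x -> 0 <= y -> y <= 1 ->
  x * y <= b `^ (1 - m) * x `^ m + b * y ^+ 2.
Proof.
move=> m1 m2 b0 x0 y0 y1.
have [xy|yx] := leP x (b * y).
  apply: (@le_trans _ _ (b * y ^+ 2)); last by rewrite lerDr mulr_ge0// powR_ge0.
  by rewrite expr2 mulrA ler_wpM2r.
have xp : 0 < x by apply: le_lt_trans yx; rewrite mulr_ge0// ltW.
apply: (@le_trans _ _ (b `^ (1 - m) * x `^ m)); last by rewrite lerDl mulr_ge0 ?sqr_ge0// ltW.
have -> : b `^ (1 - m) * x `^ m = x * (x / b) `^ (m - 1).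
  rewrite powRM ?invr_ge0 ?ltW// -[b^-1]powR_inv1 ?ltW// -powRrM mulrA.
  rewrite -[X in X * x `^ (m - 1)]powRr1 ?ltW// -powRD; last by rewrite (gt_eqF xp) implybT.
  rewrite mulrC; congr (_ `^ _ * _ `^ _); ring.
rewrite ler_pM2l//.
have yz : y <= x / b by rewrite ler_pdivlMr// mulrC ltW.
have zp : 0 < x / b by rewrite divr_gt0.
have [z1|z1] := leP (x / b) 1.
  apply: le_trans yz _; rewrite -{1}[x / b]powRr1 ?(ltW zp)//.
  by apply: ger_powR; [rewrite zp z1|lra].
apply: le_trans y1 _; rewrite -{1}(powRr0 (x / b)).
by apply: ler_powR; [exact: ltW|lra].
Qed.

(** For finite p the L^p norm q enters through q `^ p, for p = +oo through the
    essential bound q on a set of area S. *)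
Definition moment_const (R : realType) (S : R) (p : \bar R) (q : R) : R :=
  S + S * q ^+ 2 + q `^ fine p.

Section moment.
Variables (R : realType) (Om : planar_domain R).
Hypothesis hOm : admissible_domain Om.
Let S := area (cell Om).

Let S0 : 0 < S. Proof. exact: area_cell_gt0. Qed.
Let mC : measurable (cell Om). Proof. exact: cell_measurable. Qed.

Lemma powR_min_le (r x : R) : 0 <= x -> 1 < r -> x `^ Num.min r 2 <= 1 + x `^ r.
Proof.
move=> x0 r1; have r0 := powR_ge0 x r.
have [x1|x1] := leP x 1.
  apply: (@le_trans _ _ 1); last by rewrite lerDl.
  have [->|xp] := eqVneq x 0.
    by rewrite powR0// gt_eqF// lt_min; apply/andP; split; lra.
  rewrite -[leRHS](powRr0 x); apply: ger_powR; first by rewrite lt_def xp x0.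
  by rewrite le_min; apply/andP; split; lra.
apply: (@le_trans _ _ (x `^ r)); last by rewrite lerDr.
by apply: ler_powR; [exact: ltW|rewrite ge_min lexx].
Qed.

Lemma moment_bound (p : \bar R) (rho : R * R -> R) : (1 < p)%E ->
  measurable_fun (cell Om) rho -> (Lp_norm Om p rho < +oo)%E ->
  (\int[leb2 R]_(x in cell Om) (`|rho x| `^ fine (mine p 2%:E))%:E <=
    (moment_const S p (fine (Lp_norm Om p rho)))%:E)%E.
Proof.
move=> p1 mr fin; set q := fine (Lp_norm _ _ _).
have nq : Lp_norm Om p rho = q%:E.
  by rewrite /q fineK// ge0_fin_numE// Lnorm_ge0.
have q0 : 0 <= q by rewrite /q fine_ge0// Lnorm_ge0.
have mpow (s : R) : measurable_fun (cell Om) (fun x => (`|rho x| `^ s)%:E).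
  apply/measurable_EFinP.
  apply: (@measurableT_comp _ _ _ _ _ _ (fun x : R => x `^ s)); first exact: measurable_powR.
  by apply: measurableT_comp.
case: p p1 fin q nq q0 => [r||//] p1 fin q nq q0.
- rewrite lte_fin in p1.
  have -> : fine (mine r%:E 2%:E) = Num.min r 2.
    by rewrite -EFin_min.
  have rn : r != 0 by rewrite gt_eqF//; lra.
  have E : (\int[leb2 R]_(x in cell Om) (`|rho x| `^ r)%:E = (q `^ r)%:E)%E.
    rewrite -[RHS]poweR_EFin -nq /Lp_norm poweR_Lnorm// [LHS]integral_mkcond.
    apply: eq_integral => x _; rewrite /= !patchE; case: ifPn => _ //.
    by rewrite normr0 powR0.
  apply: (@le_trans _ _ (\int[leb2 R]_(x in cell Om) (1 + (`|rho x| `^ r)%:E))%E).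
    apply: (@ge0_le_integral _ _ R (leb2 R) _ mC).
    + by move=> x _; rewrite lee_fin powR_ge0.
    + exact: mpow.
    + by apply: emeasurable_funD; [exact: measurable_cst|exact: mpow].
    + by move=> x _; rewrite -EFinD lee_fin powR_min_le.
  rewrite (@ge0_integralD _ _ R (leb2 R) _ mC).
  + rewrite (@integral_cst _ _ R (leb2 R) _ mC 1) mul1e leb2_cell// E -EFinD lee_fin.
    by rewrite /moment_const /= lerD2r lerDl mulr_ge0// ?sqr_ge0// ltW.
  + by move=> x _; rewrite lee_fin.
  + exact: measurable_cst.
  + by move=> x _; rewrite lee_fin powR_ge0.
  + exact: mpow.
- have -> : fine (mine +oo%E (2:R)%:E) = 2 by rewrite min_r// leey.
  have mu0 : (0 < leb2 R setT)%E.
    apply: (@lt_le_trans _ _ (leb2 R (cell Om))); last by rewrite le_measure ?inE.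
    by rewrite leb2_cell// lte_fin.
  have aeq : {ae leb2 R, forall x, cell Om x -> ((`|rho x| `^ 2)%:E <= (q ^+ 2)%:E)%E}.
    have := ess_sup_ge (leb2 R) (abse \o (EFin \o (rho \_ (cell Om)))).
    have <- : Lp_norm Om +oo rho = ess_sup (leb2 R) (abse \o (EFin \o (rho \_ (cell Om)))).
      by rewrite /Lp_norm unlock mu0.
    rewrite nq; apply: filterS => x /= + Cx; rewrite patchE mem_set// !lee_fin => h.
    by rewrite powR_mulrn// lerXn2r ?nnegrE.
  apply: (@le_trans _ _ (\int[leb2 R]_(x in cell Om) (q ^+ 2)%:E)%E).
    apply: (@ae_ge0_le_integral _ _ R (leb2 R) _ mC).
    + by move=> x _; rewrite lee_fin powR_ge0.
    + exact: mpow.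
    + by move=> x _; rewrite lee_fin sqr_ge0.
    + exact: measurable_cst.
    + exact: aeq.
  rewrite (@integral_cst _ _ R (leb2 R) _ mC) leb2_cell// -EFinM lee_fin.
  rewrite /moment_const /= powRr0 -/S mulrC.
  have := sqr_ge0 q; have := ltW S0; lra.
Qed.

End moment.

Section mass.
Variables (R : realType) (Om : planar_domain R) (N : nat).
Hypothesis hOm : admissible_domain Om.
Variables (X : conf Om N) (rho : R * R -> R) (m Rb : R).
Hypothesis mr : measurable_fun (cell Om) rho.
Hypothesis m_gt1 : 1 < m.
Hypothesis m_le2 : m <= 2.
Hypothesis moment : (\int[leb2 R]_(x in cell Om) (`|rho x| `^ m)%:E <= Rb%:E)%E.
Let W i := voronoi X i `&` cell Om.
Let mC : measurable (cell Om). Proof. exact: cell_measurable. Qed.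
Let mW i : measurable (W i).
Proof. by apply: measurableI => //; exact: measurable_voronoi. Qed.
Let WC i : W i `<=` cell Om. Proof. by move=> x []. Qed.
Let M i := (\int[leb2 R]_(x in W i) (`|rho x| `^ m)%:E)%E.

Let mpow D : D `<=` cell Om -> measurable_fun D (fun x => (`|rho x| `^ m)%:E).
Proof.
move=> DC; apply: (measurable_funS mC DC); apply/measurable_EFinP.
apply: (@measurableT_comp _ _ _ _ _ _ (fun x : R => x `^ m)); first exact: measurable_powR.
by apply: measurableT_comp.
Qed.

Lemma sum_moment_le : (\sum_(i < N) M i <= Rb%:E)%E.
Proof.
apply: le_trans moment.
have tW : trivIset [set` index_enum 'I_N] W.
  move=> i j _ _ [x [[[_ xi] _] [[_ xj] _]]]; apply: contrapT => /eqP ij.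
  have := lt_trans (xi j _) (xj i ij); rewrite ltxx eq_sym ij => /(_ isT).
  by [].
rewrite -(@ge0_integral_bigsetU _ _ R (leb2 R) _ W _ _ mW _ tW) ?index_enum_uniq//.
- apply: ge0_subset_integral => //.
  + by apply: bigsetU_measurable => i _; exact: mW.
  + exact: mpow.
  + by rewrite -bigcup_seq => x [i _ []].
- by apply: mpow; rewrite -bigcup_seq => x [i _ []].
Qed.

(** young_small is integrated over each cell, with x the density and y the
    weight of the cell. *)
Lemma weighted_mass_le (y : 'I_N -> R) (b : R) : 0 < b ->
  (forall i, 0 <= y i <= 1) ->
  \sum_(i < N) mass rho X i * y i <=
    b `^ (1 - m) * Rb + b * \sum_(i < N) volume X i * y i ^+ 2.
Proof.
move=> b0 y01; rewrite -lee_fin.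
have Mfin i : M i \is a fin_num.
  rewrite ge0_fin_numE; last by apply: integral_ge0 => x _; rewrite lee_fin powR_ge0.
  apply: le_lt_trans (ltry Rb); apply: le_trans sum_moment_le.
  rewrite (bigD1 i)//= leeDl// sume_ge0// => j _.
  by apply: integral_ge0 => x _; rewrite lee_fin powR_ge0.
have step i : mass rho X i * y i <= b `^ (1 - m) * fine (M i) + b * (volume X i * y i ^+ 2).
  have /andP[y0 y1] := y01 i.
  have Wlty : (leb2 R (W i) < +oo)%E by rewrite leb2_voronoi// ltry.
  have ipow : (leb2 R).-integrable (W i) (EFin \o (fun x => `|rho x| `^ m)).
    apply/integrableP; split; first exact: mpow.
    apply: (@le_lt_trans _ _ (M i)); last by rewrite ltey_eq Mfin.
    rewrite le_eqVlt; apply/orP; left; apply/eqP; apply: eq_integral => x _.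
    by rewrite /= ger0_norm// powR_ge0.
  have icst (k : R) : (leb2 R).-integrable (W i) (EFin \o (fun=> k)).
    exact: (bounded_integrable (M := `|k|) (mW i) Wlty (@measurable_cst _ _ _ _ _ _)).
  have ibig (k1 k2 : R) :
      (leb2 R).-integrable (W i) (EFin \o (fun x => k1 * `|rho x| `^ m + k2)).
    exact: (plane_integrableD (mW i) (plane_integrableZl (mW i) k1 ipow) (icst k2)).
  have mrW : measurable_fun (W i) rho by exact: (measurable_funS mC (@WC i) mr).
  have irho : (leb2 R).-integrable (W i) (EFin \o rho).
    apply: (@le_integrable _ _ _ (leb2 R) _ (mW i) _ (EFin \o (fun x => 1 * `|rho x| `^ m + 1))).
    - exact/measurable_EFinP.
    - move=> x _; rewrite /= lee_fin; apply: le_trans (ler_norm _).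
      have := young_small m_gt1 m_le2 ltr01 (normr_ge0 (rho x)) ler01 (lexx 1).
      by rewrite powR1 expr1n !mul1r !mulr1.
    - exact: ibig.
  have -> : mass rho X i * y i = \int[leb2 R]_(x in W i) (y i * rho x).
    by rewrite mulrC (plane_RintegralZl (mW i) (y i) irho).
  have -> : b `^ (1 - m) * fine (M i) + b * (volume X i * y i ^+ 2) =
      \int[leb2 R]_(x in W i) (b `^ (1 - m) * `|rho x| `^ m + b * y i ^+ 2).
    rewrite (plane_RintegralD (mW i) (plane_integrableZl (mW i) _ ipow) (icst _)).
    rewrite (plane_RintegralZl (mW i) _ ipow); congr (_ * _ + _).
    by rewrite (@Rintegral_cst _ _ R (leb2 R) _ (mW i)) leb2_voronoi//=; ring.
  apply: (@le_Rintegral _ _ _ (leb2 R) _ _ _ (mW i) (plane_integrableZl (mW i) (y i) irho) (ibig _ _)).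
  move=> x _; apply: le_trans (young_small m_gt1 m_le2 b0 (normr_ge0 (rho x)) y0 y1).
  by rewrite mulrC ler_wpM2r// ler_norm.
apply: (@le_trans _ _ (\sum_(i < N) (b `^ (1 - m) * fine (M i) + b * (volume X i * y i ^+ 2)))%:E).
  by rewrite lee_fin; apply: ler_sum => i _; exact: step.
rewrite big_split /= -!mulr_sumr lee_fin lerD2r ler_wpM2l ?powR_ge0//.
by rewrite -lee_fin -sumEFin; under eq_bigr do rewrite fineK//; exact: sum_moment_le.
Qed.

End mass.

Section transport.
Variables (R : realType) (Om : planar_domain R) (N : nat).
Hypothesis hOm : admissible_domain Om.
Hypothesis N0 : (0 < N)%N.
Variables (D T : R) (v : R -> R * R -> R * R) (alpha : R -> R) (X0 : conf Om N)
  (X : R -> conf Om N) (r : R).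
Hypothesis D_gt0 : 0 < D.
Hypothesis T_gt0 : 0 < T.
Hypothesis r_ge0 : 0 <= r.
Hypothesis cell_r : in_square (cell Om) r.
Hypothesis Xreg : forall t, t \in `[0, T] -> regular_conf D (X t).
Hypothesis Xsol : lloyd_solution T v alpha X0 X.
Hypothesis hv : L1_C01 Om T v.
Notation mu := (@lebesgue_measure R).
Hypothesis ialpha : mu.-integrable `]0, T[ (EFin \o alpha).
Hypothesis alpha_ge0 : {ae mu, forall t, t \in `]0, T[ -> 0 <= alpha t}.
Let S := area (cell Om).
Let A := \int[mu]_(t in `]0, T[) alpha t.
Let K := S + (3 * S + 4 * r) * Lambda Om v T.
Let mI : measurable (`]0, T[%classic : set R). Proof. exact: measurable_itv. Qed.

Lemma total_rate_ge0 : 0 <= A.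
Proof.
have iw : mu.-integrable `]0, T[ (EFin \o (fun t => `|alpha t|)) by exact: integrable_norm.
suff -> : A = \int[mu]_(t in `]0, T[) `|alpha t|.
  by apply: Rintegral_ge0 => t _; exact: normr_ge0.
rewrite /A /Rintegral; congr fine; apply: ae_eq_integral => //.
- by case/integrableP: ialpha.
- by case/integrableP: iw.
move: alpha_ge0; apply: filterS; first exact: (ae_filter_ringOfSetsType mu).
move=> t h tI; congr EFin.
by rewrite ger0_norm// h.
Qed.

Variables (rho : R * R -> R) (m Rb C4 : R).
Hypothesis mr : measurable_fun (cell Om) rho.
Hypothesis m_gt1 : 1 < m.
Hypothesis m_le2 : m <= 2.
Hypothesis moment : (\int[leb2 R]_(x in cell Om) (`|rho x| `^ m)%:E <= Rb%:E)%E.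
Hypothesis Rb_ge0 : 0 <= Rb.
Hypothesis C4_gt0 : 0 < C4.
Hypothesis volume_comparable : forall t, t \in `[0, T] -> forall i,
  volume (X 0) i <= C4 * volume (X t) i.

(** weighted_mass_le with the weights |d_i| / D, which are at most 1. *)
Lemma weighted_displacement_le (b t : R) : 0 < b -> t \in `[0, T] ->
  \sum_(i < N) mass rho (X 0) i * enorm (displacement (X t) i) <=
    D * (b `^ (1 - m) * Rb) + b * C4 / D * centroid_defect (X t).
Proof.
move=> b0 tI; pose y i := enorm (displacement (X t) i) / D.
have y01 i : 0 <= y i <= 1.
  rewrite divr_ge0 ?enorm_ge0 ?(ltW D_gt0)//= ler_pdivrMr// mul1r.
  exact: (displacement_le hOm (ltW D_gt0) i (Xreg tI)).
have yD i : enorm (displacement (X t) i) = D * y i by rewrite /y mulrC divfK// gt_eqF.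
have := weighted_mass_le hOm (X 0) mr m_gt1 m_le2 moment b0 y01.
rewrite -(ler_pM2l D_gt0) => h; apply: le_trans (le_trans _ h) _.
  rewrite mulr_sumr; apply: ler_sum => i _; rewrite yD.
  by rewrite [leRHS]mulrCA.
rewrite mulrDr lerD2l.
have -> : centroid_defect (X t) = D ^+ 2 * \sum_(i < N) volume (X t) i * y i ^+ 2.
  rewrite mulr_sumr; apply: eq_bigr => i _; rewrite yD exprMn; ring.
have -> : b * C4 / D * (D ^+ 2 * \sum_(i < N) volume (X t) i * y i ^+ 2) =
    D * (b * (\sum_(i < N) C4 * volume (X t) i * y i ^+ 2)).
  rewrite -[X in _ = D * (b * X)](_ : C4 * \sum_(i < N) volume (X t) i * y i ^+ 2 = _); last first.
    by rewrite mulr_sumr; apply: eq_bigr => i _; rewrite mulrA.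
  by field; rewrite gt_eqF.
rewrite ler_pM2l// ler_pM2l//; apply: ler_sum => i _.
by rewrite ler_wpM2r ?sqr_ge0// volume_comparable.
Qed.

(** dissipation_bound applies to any u below the integrand once the part
    proportional to alpha has been subtracted. *)
Lemma transport_error_le (b : R) : 0 < b ->
  (transport_error T v alpha rho X <=
    (expR (Lambda Om v T) * D * (b `^ (1 - m) * Rb * A + b * C4 * K))%:E)%E.
Proof.
move=> b0; set E := expR _; have E0 : 0 < E := expR_gt0 _.
apply: integral_itv_le => u _ _ iu uf.
pose c1 := E * (D * (b `^ (1 - m) * Rb)); pose c2 := D / (E * (b * C4)).
have c10 : 0 <= c1.
  by rewrite mulr_ge0 ?(ltW E0)// mulr_ge0 ?(ltW D_gt0)// mulr_ge0// powR_ge0.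
have c20 : 0 < c2 by rewrite divr_gt0// !mulr_gt0.
have i1 : mu.-integrable `]0, T[ (EFin \o (fun t => - c1 * alpha t)).
  exact: (@integrableZl _ _ _ mu _ mI (- c1) _ ialpha).
have i2 : mu.-integrable `]0, T[ (EFin \o (fun t => u t + - c1 * alpha t)).
  exact: (@integrableD _ _ _ mu _ mI _ _ iu i1).
have iw : mu.-integrable `]0, T[ (EFin \o (fun t => c2 * (u t + - c1 * alpha t))).
  exact: (@integrableZl _ _ _ mu _ mI c2 _ i2).
have := dissipation_bound hOm N0 (ltW D_gt0) T_gt0 r_ge0 cell_r Xreg Xsol hv iw.
rewrite RintegralZl// RintegralD// RintegralZl// -/A -/S.
move=> H; have {}H := H _.
have {}H : c2 * (\int[mu]_(t in `]0, T[) u t + - c1 * A) <= D ^+ 2 * K.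
  apply: le_trans (H _) _; last by rewrite /K; lra.
  move: alpha_ge0; apply: filterS; first exact: (ae_filter_ringOfSetsType mu).
  move=> t a0 tI; have {}a0 := a0 tI.
  have tI' : t \in `[0, T] by apply: subset_itv_oo_cc tI.
  rewrite mulrC -ler_pdivlMr//.
  have wd := weighted_displacement_le b0 tI'.
  set Z := D * _ + _ in wd.
  have G0 : 0 <= centroid_defect (X t).
    by apply: sumr_ge0 => i _; rewrite mulr_ge0 ?sqr_ge0// volume_ge0.
  have Z0 : 0 <= Z.
    rewrite addr_ge0//; first by rewrite mulr_ge0 ?(ltW D_gt0)// mulr_ge0// powR_ge0.
    by rewrite mulr_ge0// ltW// divr_gt0// mulr_gt0.
  have uZ : u t <= E * alpha t * Z.
    rewrite -lee_fin; apply: le_trans (uf t tI) _; rewrite ge_max !lee_fin; apply/andP; split; last first.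
      by rewrite !mulr_ge0// ltW.
    apply: (@le_trans _ _ (expR (Lambda Om v T - Lambda Om v t) * alpha t * Z)).
      by rewrite ler_wpM2l// mulr_ge0// expR_ge0.
    rewrite ler_wpM2r// ler_wpM2r// ler_expR gerBl.
    exact: Lambda_ge0.
  have -> : alpha t * centroid_defect (X t) / c2 = E * alpha t * (b * C4 / D * centroid_defect (X t)).
    by rewrite /c2; field; rewrite !gt_eqF.
  rewrite mulNr lerBlDr; apply: le_trans uZ _; rewrite /Z /c1; lra.
rewrite -ler_pdivlMl// in H.
have -> : E * D * (b `^ (1 - m) * Rb * A + b * C4 * K) = c1 * A + c2^-1 * (D ^+ 2 * K).
  by rewrite /c1 /c2; field; rewrite !gt_eqF.
by move: H; rewrite mulNr lerBlDl.
Qed.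

(** With b = A `^ m^-1 both terms of transport_error_le are of the same order;
    if A = 0 the first one vanishes and b tends to 0. *)
Lemma transport_error_rate :
  (transport_error T v alpha rho X <=
    (expR (Lambda Om v T) * D * (Rb + C4 * K) * A `^ m^-1)%:E)%E.
Proof.
have S0 : 0 < S by exact: area_cell_gt0.
have K0 : 0 < K.
  by rewrite ltr_pwDl// mulr_ge0 ?Lambda_ge0// addr_ge0// mulr_ge0// ltW.
have m0 : 0 < m by exact: lt_trans m_gt1.
have := total_rate_ge0; rewrite le_eqVlt => /orP[/eqP A0|Ap].
  rewrite -A0 powR0 ?mulr0 ?invr_neq0 ?gt_eqF//.
  apply/lee_addgt0Pr => e e0; rewrite add0e.
  pose Z := expR (Lambda Om v T) * D * (C4 * K).
  have Z0 : 0 < Z by rewrite !mulr_gt0// expR_gt0.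
  apply: le_trans (transport_error_le (divr_gt0 e0 Z0)) _.
  rewrite -A0 mulr0 add0r lee_fin le_eqVlt; apply/orP; left; apply/eqP.
  have -> : expR (Lambda Om v T) * D * (e / Z * C4 * K) = e / Z * Z by rewrite /Z; ring.
  by rewrite divfK// gt_eqF.
apply: le_trans (transport_error_le (powR_gt0 m^-1 Ap)) _.
rewrite lee_fin le_eqVlt; apply/orP; left; apply/eqP.
have -> : (A `^ m^-1) `^ (1 - m) * Rb * A = Rb * A `^ m^-1.
  rewrite -powRrM -mulrA [Rb * A]mulrC mulrA [RHS]mulrC; congr (_ * _).
  rewrite -[X in _ * X](powRr1 (ltW Ap)) -powRD; last by rewrite (gt_eqF Ap) implybT.
  by congr (_ `^ _); field; rewrite gt_eqF.
ring.
Qed.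

End transport.

(** * Configurations close to a minimizer *)

Section tube.
Variables (R : realType) (Om : planar_domain R) (N : nat).
Hypothesis hOm : admissible_domain Om.
Hypothesis N0 : (0 < N)%N.
Variables (C1 c r : R).
Hypothesis C1_gt0 : 0 < C1.
Hypothesis area_near : forall a rho, carrier Om a -> 0 < rho ->
  rho <= Num.sqrt (area (cell Om)) ->
  ((c * rho ^+ 2)%:E <= leb2 R (cell Om `&` [set x | (dist_domain Om x a < rho)%R]))%E.
Hypothesis r_gt0 : 0 < r.
Hypothesis tube_distinct : forall Y, tube Om N r Y -> distinct_generators Y.
Hypothesis tube_diameter : forall Y, tube Om N r Y ->
  max_diameter Y <= C1 * mesh_size Om N.

Lemma dist_conf_ge0 (X Y : conf Om N) : 0 <= dist_conf X Y.
Proof. exact: sqrtr_ge0. Qed.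

Lemma dist_minimizers_le (X Y : conf Om N) : minimizers Om N Y ->
  dist_minimizers X <= dist_conf X Y.
Proof.
move=> mY; apply: ge_inf; last by exists Y.
by exists 0 => _ [Z _ <-]; exact: dist_conf_ge0.
Qed.

Lemma dist_domain_le_conf (X Y : conf Om N) i : dist_domain Om (X i) (Y i) <= dist_conf X Y.
Proof.
rewrite -[leLHS]ger0_norm ?dist_domain_ge0// -sqrtr_sqr; apply: ler_wsqrtr.
by rewrite (bigD1 i)//= lerDl; apply: sumr_ge0 => j _; exact: sqr_ge0.
Qed.

(** The generators of a minimizer at distance less than r are well separated,
    and each of them has moved by less than r. *)
Lemma tube_separation (X : conf Om N) i j : minimizers Om N !=set0 -> tube Om N r X -> i != j ->
  separation_const C1 c * mesh_size Om N - 2 * r <= dist_domain Om (X i) (X j).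
Proof.
move=> [Y0 mY0] [_ Xr] ij.
have [_ [Y mY <-] XY] : exists2 d, [set dist_conf X Y | Y in minimizers Om N] d & d < r.
  by apply: (@inf_lt R _ r); [exists (dist_conf X Y0), Y0|exact: Xr].
have tY : tube Om N r Y.
  split; first by case: mY.
  apply: le_lt_trans (dist_minimizers_le Y mY) _; rewrite /dist_conf big1 ?sqrtr0// => k _.
  by rewrite dist_domainxx expr0n.
have sep := minimizer_separation hOm N0 C1_gt0 area_near mY (tube_distinct tY) (tube_diameter tY) ij.
have di := dist_domain_le_conf X Y i; have dj := dist_domain_le_conf X Y j.
have t1 := dist_domain_triangle Om (X i) (Y i) (Y j); have t2 := dist_domain_triangle Om (X j) (X i) (Y j).
rewrite (dist_domainC Om (Y i) (X i)) in t1; lra.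
Qed.

End tube.

Lemma constants_algebra (R : realType) (c c3 C1 h K V V0 : R) : 0 < c -> 0 < c3 -> 0 <= K ->
  c * (c3 * h) ^+ 2 <= V -> V0 <= 16 * C1 ^+ 2 * h ^+ 2 ->
  let C4 := (1 + 16 * C1 ^+ 2) / (c * c3 ^+ 2) + C1 ^+ 2 * K in
  [/\ 0 < C4, h ^+ 2 / C4 <= V & V0 <= C4 * V].
Proof.
move=> c0 c30 K0 hV hV0 C4.
have q0 : 0 < c * c3 ^+ 2 by rewrite mulr_gt0// exprn_gt0.
have C10 : 0 <= C1 ^+ 2 by exact: sqr_ge0.
have Ch : (1 + 16 * C1 ^+ 2) * h ^+ 2 <= C4 * V.
  have V_ge0 : 0 <= V by apply: le_trans hV; rewrite mulr_ge0 ?sqr_ge0// ltW.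
  apply: (@le_trans _ _ ((1 + 16 * C1 ^+ 2) / (c * c3 ^+ 2) * V)); last first.
    by rewrite ler_wpM2r// lerDl mulr_ge0.
  apply: (@le_trans _ _ ((1 + 16 * C1 ^+ 2) / (c * c3 ^+ 2) * (c * (c3 * h) ^+ 2))).
    have -> : (1 + 16 * C1 ^+ 2) / (c * c3 ^+ 2) * (c * (c3 * h) ^+ 2) = (1 + 16 * C1 ^+ 2) * h ^+ 2.
      by field; rewrite !gt_eqF.
    exact: lexx.
  by rewrite ler_wpM2l// divr_ge0 ?ltW//; lra.
have C40 : 0 < C4.
  apply: ltr_wpDr; first exact: mulr_ge0.
  by rewrite divr_gt0//; lra.
have h0 := sqr_ge0 h; have Ch0 : 0 <= C1 ^+ 2 * h ^+ 2 by rewrite mulr_ge0.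
split => //; last by lra.
by rewrite ler_pdivrMr// mulrC; lra.
Qed.

Theorem corollary3p2 (R : realType) (Om : planar_domain R)
    (hOm : admissible_domain Om) (C1 : R) (hC1 : 0 < C1) :
  exists2 C3 : R, 0 < C3 &
  exists (C4 : R -> R) (C5 : R -> \bar R -> R -> R),
  [/\ forall lam, 0 < C4 lam,
      forall lam p q, 0 < C5 lam p q &
  forall (T : R) (v : R -> R * R -> R * R) (N : nat) (r : R)
    (X0 : conf Om N) (alpha : R -> R) (X : R -> conf Om N),
  let h := mesh_size Om N in
  let A := \int[@lebesgue_measure R]_(t in `]0, T[) alpha t in
  let lam := Lambda Om v T in
  0 < T ->
  L1_C01 Om T v ->
  tangential Om T v ->
  (0 < N)%N ->
  minimizers Om N !=set0 ->
  compact (minimizers Om N) ->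
  0 < r ->
  (forall Y, closure (tube Om N r) Y -> distinct_generators Y) ->
  closure (tube Om N r) `<=` conf_in Om N ->
  (forall Y, tube Om N r Y -> max_diameter Y <= C1 * h) ->
  tube Om N r X0 ->
  ((energy X0 - min_energy Om N)%R%:E < energy_gap Om N r)%E ->
  (@lebesgue_measure R).-integrable `]0, T[ (EFin \o alpha) ->
  {ae @lebesgue_measure R, forall t, t \in `]0, T[ -> 0 <= alpha t} ->
  lloyd_solution T v alpha X0 X ->
  (forall Y, lloyd_solution T v alpha X0 Y ->
    forall t, t \in `[0, T] -> forall i, Y t i = X t i) ->
  (forall t, t \in `[0, T] -> tube Om N r (X t)) ->
  r <= C3 * h ->
  forall t : R, t \in `[0, T] ->
  [/\ (forall i j, i != j -> dist_domain Om (X t i) (X t j) >= 2 * C3 * h),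
      (forall i, volume (X t) i >= h ^+ 2 / C4 lam /\
                 volume (X t) i >= volume (X 0) i / C4 lam),
      (\int[@lebesgue_measure R]_(s in `]0%R, T[)
         (alpha s * centroid_defect (X s))%R%:E <= (C4 lam * h ^+ 2)%R%:E)%E &
      (forall (p : \bar R) (rho0 : R * R -> R),
         (1 < p)%E ->
         lattice_periodic Om rho0 ->
         measurable_fun (cell Om) rho0 ->
         (Lp_norm Om p rho0 < +oo)%E ->
         {ae leb2 R, forall x, x \in cell Om -> 0 <= rho0 x} ->
         (transport_error T v alpha rho0 X <=
          (C5 lam p (fine (Lp_norm Om p rho0)) * h *
             A `^ (fine (mine p 2%:E))^-1)%R%:E)%E)]].
Proof.
have S0 := area_cell_gt0 hOm.
have [c c0 near] := cell_area_near hOm (eq_ind_r is_true S0 (sqrtr_gt0 _)).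
have [rc rc0 cell_r] := cell_in_square hOm.
pose S := area (cell Om); pose sep := separation_const C1 c.
have sep0 : 0 < sep by exact: separation_const_gt0.
(* dissipation_bound reads D ^+ 2 * K, where the absolute value only serves to
   make the constants positive for all lam. *)
pose K (lam : R) := S + (3 * S + 4 * rc) * `|lam|.
have K0 lam : 0 < K lam.
  by rewrite ltr_pwDl// mulr_ge0// addr_ge0// mulr_ge0// ltW.
(* The minimizers are separated by 4 * C3 * h, and two generators of a
   configuration of the tube lose at most 2 * r <= 2 * C3 * h of it. *)
pose C3 := sep / 4; have C30 : 0 < C3 by rewrite divr_gt0.
have C3le : C3 <= 1.
  have : sep <= 1 by rewrite /sep /separation_const ge_min lexx.
  by rewrite /C3; lra.
(* The first term compares volumes between c * (C3 * h) ^+ 2 and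
   16 * C1 ^+ 2 * h ^+ 2, the second one bounds the dissipation. *)
pose C4 (lam : R) := (1 + 16 * C1 ^+ 2) / (c * C3 ^+ 2) + C1 ^+ 2 * K lam.
have C40 lam : 0 < C4 lam.
  apply: ltr_wpDr; first by rewrite mulr_ge0 ?sqr_ge0// ltW.
  apply: divr_gt0; last by rewrite mulr_gt0// exprn_gt0.
  by rewrite ltr_pwDl// mulr_ge0// sqr_ge0.
have Rb0 p q : 0 < moment_const S p q.
  rewrite /moment_const -addrA; apply: ltr_pwDl => //; apply: addr_ge0; last exact: powR_ge0.
  by rewrite mulr_ge0 ?sqr_ge0// ltW.
exists C3 => //; exists C4, (fun lam p q => expR lam * C1 * (moment_const S p q + C4 lam * K lam)).
split => // [lam p q|].
  apply: mulr_gt0; first by rewrite mulr_gt0// expR_gt0.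
  by apply: addr_gt0 => //; exact: mulr_gt0.
move=> T v N r X0 alpha X h A lam T0 hv _ N0 min0 _ r0 tdist _ tdiam _ _ ia a0 Xsol _ Xtube rC3 t tI.
have h0 : 0 < h by exact: mesh_size_gt0.
have lam0 : 0 <= lam by exact: Lambda_ge0.
have td Y : tube Om N r Y -> distinct_generators Y by move=> tY; apply: tdist; exact: subset_closure.
have separated s i j : s \in `[0, T] -> i != j -> 2 * C3 * h <= dist_domain Om (X s i) (X s j).
  move=> sI ij.
  have := tube_separation hOm N0 hC1 near r0 td tdiam min0 (Xtube s sI) ij.
  rewrite -/h -/sep => /(le_trans _); apply; move: rC3; rewrite /C3; lra.
have volume_lower s i : s \in `[0, T] -> c * (C3 * h) ^+ 2 <= volume (X s) i.
  move=> sI; have [cX _] := Xtube s sI; apply: (volume_ge hOm near cX).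
  - exact: mulr_gt0.
  - apply: (@le_trans _ _ h); last exact: mesh_size_le.
    by rewrite ger_pMl.
  - by move=> j ji; rewrite mulrA; apply: separated; rewrite 1?eq_sym.
have O_in : 0 \in `[0, T] by rewrite in_itv/= lexx ltW.
have volume_upper i : volume (X 0) i <= 16 * C1 ^+ 2 * h ^+ 2.
  have tX := Xtube 0 O_in; have [cX _] := tX.
  exact: (volume_le hOm N0 hC1 i cX (td _ tX) (tdiam _ tX)).
have volumes s i : s \in `[0, T] ->
    h ^+ 2 / C4 lam <= volume (X s) i /\ volume (X 0) i <= C4 lam * volume (X s) i.
  move=> sI.
  by have [_ ? ?] := constants_algebra c0 C30 (ltW (K0 lam)) (volume_lower s i sI) (volume_upper i).
have D0 : 0 < C1 * h by exact: mulr_gt0.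
have Xreg s : s \in `[0, T] -> regular_conf (C1 * h) (X s).
  move=> sI; have tX := Xtube s sI; have [cX _] := tX; split => //.
  - exact: td.
  - exact: tdiam.
  - move=> i; apply: lt_le_trans (volume_lower s i sI).
    by rewrite mulr_gt0// exprn_gt0// mulr_gt0.
split.
- by move=> i j; exact: separated.
- move=> i; have [? v2] := volumes t i tI; split => //.
  by rewrite ler_pdivrMr// mulrC.
- apply: integral_itv_le => u _ _ iu uf.
  apply: le_trans (dissipation_bound hOm N0 (ltW D0) T0 (ltW rc0) cell_r Xreg Xsol hv iu _) _.
    move: a0; apply: filterS; first exact: (ae_filter_ringOfSetsType (@lebesgue_measure R)).
    move=> s as0 sI; rewrite -lee_fin; apply: le_trans (uf s sI) _.
    rewrite ge_max lexx lee_fin mulr_ge0 ?as0//.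
    by apply: sumr_ge0 => i _; rewrite mulr_ge0 ?sqr_ge0// volume_ge0.
  apply: (@le_trans _ _ (C1 ^+ 2 * K lam * h ^+ 2)).
    rewrite le_eqVlt; apply/orP; left; apply/eqP.
    by rewrite /K (ger0_norm lam0) -/S -/lam; ring.
  rewrite ler_wpM2r ?sqr_ge0// lerDr; apply: divr_ge0.
    by rewrite addr_ge0// mulr_ge0// sqr_ge0.
  by rewrite mulr_ge0 ?sqr_ge0// ltW.
- move=> p rho p1 _ mrho Lfin _.
  have m1 : 1 < fine (mine p 2%:E) /\ fine (mine p 2%:E) <= 2.
    case: p p1 {Lfin} => [p p1|_|//]; last by rewrite min_r ?leey//=; split; lra.
    rewrite -EFin_min /= ge_min lexx orbT lt_min; split => //.
    by apply/andP; split; [rewrite -lte_fin|lra].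
  have [m1' m2] := m1.
  have := transport_error_rate hOm N0 D0 T0 (ltW rc0) cell_r Xreg Xsol hv ia a0 mrho m1' m2
    (moment_bound hOm p1 mrho Lfin) (ltW (Rb0 _ _)) (C40 lam)
    (fun s sI i => (volumes s i sI).2).
  move=> /le_trans; apply; rewrite lee_fin le_eqVlt; apply/orP; left; apply/eqP.
  by rewrite /K (ger0_norm lam0) -/lam -/S -/A; ring.
Qed.
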